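(* Let $s\ge-1$ with $s\ne0$ and $s$ not an odd positive integer, and let $(a_n)_{n=0}^\infty\subset S^1$ be a greedy $s$-energy sequence with $\alpha_{N,s}=(a_0,\dots,a_{N-1})$. Then $$E_s(\alpha_{N,s})=v(s)N^2+\frac{2}{(2\pi)^s}\sum_{j=0}^{\lfloor(s+1)/2\rfloor}\beta_j(s)\,\zeta(s-2j)\,H(\eta(N);s-2j)\,N^{s-2j+1}+\rho_{N,s},$$ where the sequence $(\rho_{N,s})_{N=2}^\infty$ is bounded uniformly in $N$. In the special case that $s$ is a positive even integer, $v(s)=0$ and $\rho_{N,s}=0$ for all $N\ge2$.
   Context: $S^1=\{z\in\mathbb{C}:|z|=1\}$. For $s\in\mathbb{R}$ the Riesz kernel is $k_s(z,w)=|z-w|^{-s}$ if $s\ne 0$ and $k_0(z,w)=-\log|z-w|$ (with value $+\infty$ at $z=w$ when $s\ge 0$). For points $z_1,\dots,z_N$, $N\geq 2$, the energy is $E_s((z_1,\dots,z_N))=\sum_{1\le i\ne j\le N}k_s(z_i,z_j)$. A greedy $s$-energy sequence is a sequence $(a_n)_{n=0}^\infty\subset S^1$ with $a_0\in S^1$ arbitrary and, for all $N\ge 1$, $E_s((a_0,\dots,a_{N-1},a_N))=\min_{z\in S^1}E_s((a_0,\dots,a_{N-1},z))$ if $s\ge 0$; if $s<0$ the minimum is replaced by the maximum. $\zeta$ is the (analytically continued) Riemann zeta function; $v(s)=\frac{2^{-s}\Gamma((1-s)/2)}{\sqrt\pi\,\Gamma(1-s/2)}$ for $s\in\mathbb{C}\setminus\{1,3,5,\dots\}$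 (with $1/\Gamma$ understood as $0$ at the poles of $\Gamma$); the coefficients $\beta_n(s)$ are defined by $$\left(\frac{\sin(\pi z)}{\pi z}\right)^{-s}=\sum_{n=0}^\infty\beta_n(s)z^{2n},\qquad|z|<1$$ (the branch equal to $1$ at $z=0$). For a vector $\vec\theta=(\theta_1,\dots,\theta_p)$ of positive numbers and $s\in\mathbb{R}$, $$H(\vec\theta;s)=\sum_{k=1}^p\theta_k^{s+1}+2(2^s-1)\sum_{k=1}^{p-1}\theta_k^s\sum_{j=k+1}^p\theta_j.$$ If $N\in\mathbb{N}$ has binary decomposition $N=2^{n_1}+\cdots+2^{n_p}$, $n_1>\cdots>n_p\ge0$, then $\eta(N)=(2^{n_1}/N,\dots,2^{n_p}/N)$. *)

(* Defs.v *)
From Stdlib Require Import Reals List Arith.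
From Coquelicot Require Import Coquelicot.
Import ListNotations.
Open Scope R_scope.

Definition Rsum (l : list R) : R := fold_right Rplus 0 l.
Definition Rprod (l : list R) : R := fold_right Rmult 1 l.
Definition Rbar_sum (l : list Rbar) : Rbar := fold_right Rbar_plus (Finite 0) l.

Definition on_circle (z : C) : Prop := Cmod z = 1.

(* The diagonal is treated apart because [Rpower 0 t] and [ln 0] are junk
   values: for [s < 0] the mathematical value [0 ^ (-s)] is 0. *)
Definition riesz_kernel (s : R) (z w : C) : Rbar :=
  if Ceq_dec z w then
    (if Rlt_dec s 0 then Finite 0 else p_infty)
  else if Req_EM_T s 0 then Finite (- ln (Cmod (z - w)))
  else Finite (Rpower (Cmod (z - w)) (- s)).

(* All values of the kernel are in (-oo, +oo], so the junk value of
   [Rbar_plus p_infty m_infty] never occurs. *)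
Definition energy (s : R) (l : list C) : Rbar :=
  Rbar_sum (map (fun ij => riesz_kernel s (nth (fst ij) l (RtoC 0))
                                          (nth (snd ij) l (RtoC 0)))
    (filter (fun ij => negb (fst ij =? snd ij))
       (list_prod (seq 0 (length l)) (seq 0 (length l))))).

Definition prefix (a : nat -> C) (N : nat) : list C := map a (seq 0 N).

Definition greedy_energy_sequence (s : R) (a : nat -> C) : Prop :=
  (forall n, on_circle (a n)) /\
  forall N : nat, (1 <= N)%nat -> forall z : C, on_circle z ->
    (0 <= s -> Rbar_le (energy s (prefix a N ++ [a N]))
                       (energy s (prefix a N ++ [z]))) /\
    (s < 0 -> Rbar_le (energy s (prefix a N ++ [z]))
                      (energy s (prefix a N ++ [a N]))).

(* Euler's integral, meaningful for x > 0. *)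
Definition Gamma_int (x : R) : R :=
  RInt_gen (fun t => Rpower t (x - 1) * exp (- t))
           (at_right 0) (Rbar_locally p_infty).

(* A natural number with x + Gamma_shift x > 0, equal to 0 when x > 0. *)
Definition Gamma_shift (x : R) : nat := Z.to_nat (up (- x)).

(* x (x+1) ... (x+m-1) *)
Definition rising (x : R) (m : nat) : R :=
  Rprod (map (fun k => x + INR k) (seq 0 m)).

(* Extension by Gamma(x+m) = x (x+1) ... (x+m-1) Gamma(x); meaningful when x is
   not a pole 0, -1, -2, ... *)
Definition Gamma (x : R) : R :=
  Gamma_int (x + INR (Gamma_shift x)) / rising x (Gamma_shift x).

(* 1/Gamma, for all real x: at the poles of Gamma the numerator vanishes. *)
Definition inv_Gamma (x : R) : R :=
  rising x (Gamma_shift x) / Gamma_int (x + INR (Gamma_shift x)).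

Definition v (s : R) : R :=
  Rpower 2 (- s) * Gamma ((1 - s) / 2) / sqrt PI * inv_Gamma (1 - s / 2).

Definition Cexp (z : C) : C :=
  (exp (Re z) * cos (Im z), exp (Re z) * sin (Im z)).

Definition Csin (z : C) : C :=
  ((Cexp (Ci * z) - Cexp (- (Ci * z))) / (RtoC 2 * Ci))%C.

Definition analytic_at (f : C -> C) (z0 : C) : Prop :=
  exists (r : R) (c : nat -> C), 0 < r /\
    forall z : C, Cmod (z - z0) < r ->
      is_pseries (K := C_AbsRing) (V := C_NormedModule) c (z - z0)%C (f z).

(* zeta is the analytic continuation to C \ {1} of the Dirichlet series
   sum_(n >= 1) n^(-z); since C \ {1} is connected this determines zeta
   everywhere except at 1. *)
Definition is_riemann_zeta (zeta : C -> C) : Prop :=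
  (forall z : C, z <> RtoC 1 -> analytic_at zeta z) /\
  (forall z : C, 1 < Re z ->
     is_series (K := C_AbsRing) (V := C_NormedModule)
       (fun n => Cexp (- z * RtoC (ln (INR (S n))))%C) (zeta z)).

(* [L] is the logarithm of sin(pi z)/(pi z) on the unit disc that vanishes at 0,
   so exp(-s L) is the branch of (sin(pi z)/(pi z))^(-s) equal to 1 at 0. *)
Definition is_log_sinc (L : C -> C) : Prop :=
  (forall z : C, Cmod z < 1 -> continuous L z) /\
  L (RtoC 0) = RtoC 0 /\
  (forall z : C, Cmod z < 1 -> z <> RtoC 0 ->
     Cexp (L z) = (Csin (RtoC PI * z) / (RtoC PI * z))%C).

Definition is_sinc_coeffs (s : R) (beta : nat -> R) : Prop :=
  exists L : C -> C, is_log_sinc L /\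
    forall z : C, Cmod z < 1 ->
      is_series (K := C_AbsRing) (V := C_NormedModule)
        (fun n => RtoC (beta n) * Cpow z (2 * n))%C
        (Cexp (- RtoC s * L z)%C).

(* The exponents n_1 > ... > n_p >= 0 of N = 2^n_1 + ... + 2^n_p. *)
Definition binary_exponents (N : nat) : list nat :=
  filter (Nat.testbit N) (rev (seq 0 N)).

Definition eta (N : nat) : list R :=
  map (fun n => 2 ^ n / INR N) (binary_exponents N).

(* Indices are shifted to start at 0. *)
Definition H (theta : list R) (s : R) : R :=
  let p := length theta in
  let th k := nth k theta 0 in
  Rsum (map (fun k => Rpower (th k) (s + 1)) (seq 0 p)) +
  2 * (Rpower 2 s - 1) *
    Rsum (map (fun k => Rpower (th k) s *
                        Rsum (map th (seq (k + 1) (p - 1 - k))))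
              (seq 0 (p - 1))).

(* Main.v *)
Require Import Defs.
From Stdlib Require Import Reals List Arith Lra Lia ZArith Ranalysis5 ClassicalEpsilon.
From Coquelicot Require Import Coquelicot.
Import ListNotations.
Open Scope R_scope.

(** The theorem rests on two facts: the energy of a greedy configuration is a
    sum over the binary digits of [N] of energies of roots of unity, and the
    latter have a complete asymptotic expansion.

    Structure. For [s >= -1], [s <> 0], the potential of the roots of unity of
    order [M] is extremal exactly at the points midway between neighbours:
    mirror the roots in pairs and use the convexity (for [s < 0], the
    concavity) of the kernel ([kern_midpoint], [coset_kern_min]). So once the
    first [2^n] points of a greedy sequence form a coset of the roots of unity
    of order [2^n], the next point lies midway, and as all midpoints are
    equally good for the first block, the points that follow form a greedy
    sequence of their own ([second_block], [greedy_blocks]). Hence the first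
    [2^n] points form such a coset for every [n], and the potential met by the
    point [a_k] is a sum, over the binary digits of [k], of the potential of
    the [2^n]-th roots of unity at a midpoint, which is [root_sum s (2^(n+1))
    - root_sum s (2^n)]. Summing up, the energy of [N] points is the linear
    functional [block_energy] of the sequence [root_sum s (2^n)]
    ([energy_greedy], [greedy_energy_blocks]).

    Asymptotics of [root_sum s M] for [M = 2K]. By symmetry only the angles
    [PI k / M] with [k <= K] matter, and there the kernel is [(2 PI k /
    M)^(-s)] times the power series of [sinc^(-s)] in [(k/M)^2], which
    converges absolutely and uniformly, as [k/M <= 1/2 < 1]. Term by term this
    leaves the power sums of [k^(2j-s)], [k <= K], the last summand halved; by
    Euler-Maclaurin each is an integral, plus the boundary term of order
    [K^(2j-s-1)], plus [zeta(s-2j)] or, for large [j], an error that is small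
    relative to [M^(2j-s)]. The integrals add up to [M] times the finite part
    of an integral of the kernel. The boundary terms add up to a derivative of
    the kernel at the antipodal point, which is 0. The result is
    [root_sum_asymptotic], with error [O(M^(-1-d))] for some [d > 0].

    Identification of the constants. The limit in Euler-Maclaurin is [zeta]
    because [(z-1)] times the series of trapezoidal errors of [x^(-z)] is
    analytic on [Re z > -1]; it agrees with the expression in [zeta] for [Re z
    > 1] and hence, by the identity theorem along an arc around the pole, at
    every real point of this region ([zeta_trap_err]); the value at [-1],
    which occurs too, follows by letting the exponent tend to it
    ([zeta_minus_one]). The finite part of the integral and [v] satisfy the
    same recursion from [s - 2] to [s], by integration by parts and by the
    functional equation of [Gamma] respectively. For [s < 1] the recursion
    fixes their quotient along [s, s - 2, s - 4, ...], and both have the same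
    asymptotics there, by Wallis' integrals and the log-convexity of [Gamma]
    ([mean_sin_gamma]); the recursion then extends the identity to larger [s]
    ([mean_potential_v]).

    Assembly. On the powers [M^t], [block_energy] is [N^(t+1) H(eta N; t)], in
    particular [N^2] for [t = 1] ([block_energy_power],
    [block_energy_square]); and as an error [O(M^(-1-d))] contributes at most
    [O(M^(-d))] for each binary digit [M] of [N], the total error is bounded
    by a geometric series ([block_energy_error_bound]). For even [s > 0], both
    [root_sum s (2^n)] and its expansion are polynomials in [4^n], so they
    coincide as soon as their difference tends to 0, and the error vanishes
    identically ([root_sum_even]). *)

(** * Finite sums *)

Fixpoint bigsum (f : nat -> R) (n : nat) : R :=
  match n with O => 0 | S m => bigsum f m + f m end.

Lemma bigsum_ext f g n :
  (forall i, (i < n)%nat -> f i = g i) -> bigsum f n = bigsum g n.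
Proof.
  induction n as [|n IH]; simpl; intros E; [reflexivity|].
  rewrite IH, E; auto; intros; apply E; lia.
Qed.

Lemma bigsum_plus f g n :
  bigsum (fun i => f i + g i) n = bigsum f n + bigsum g n.
Proof. induction n as [|n IH]; simpl; [lra|rewrite IH; lra]. Qed.

Lemma bigsum_scal c f n : bigsum (fun i => c * f i) n = c * bigsum f n.
Proof. induction n as [|n IH]; simpl; [lra|rewrite IH; lra]. Qed.

Lemma bigsum_minus f g n :
  bigsum (fun i => f i - g i) n = bigsum f n - bigsum g n.
Proof. induction n as [|n IH]; simpl; [lra|rewrite IH; lra]. Qed.

Lemma bigsum_0 f n : (forall i, (i < n)%nat -> f i = 0) -> bigsum f n = 0.
Proof.
  induction n as [|n IH]; simpl; intros E; [reflexivity|].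
  rewrite IH, E; auto; lra.
Qed.

Lemma bigsum_const c n : bigsum (fun _ => c) n = INR n * c.
Proof.
  induction n as [|n IH]; [simpl; lra|].
  rewrite S_INR; simpl; rewrite IH; lra.
Qed.

Lemma bigsum_le f g n :
  (forall i, (i < n)%nat -> f i <= g i) -> bigsum f n <= bigsum g n.
Proof.
  induction n as [|n IH]; simpl; intros E; [lra|].
  apply Rplus_le_compat; [apply IH; intros; apply E; lia | apply E; lia].
Qed.

Lemma bigsum_lt f g n :
  (0 < n)%nat -> (forall i, (i < n)%nat -> f i < g i) ->
  bigsum f n < bigsum g n.
Proof.
  destruct n as [|n]; [lia|]; intros _ E; simpl.
  apply Rplus_le_lt_compat; [apply bigsum_le; intros; apply Rlt_le, E; lia|].
  apply E; lia.
Qed.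

Lemma bigsum_nonneg f n :
  (forall i, (i < n)%nat -> 0 <= f i) -> 0 <= bigsum f n.
Proof.
  intros E; rewrite <- (bigsum_0 (fun _ => 0) n); [|auto].
  now apply bigsum_le.
Qed.

Lemma bigsum_Rabs f n : Rabs (bigsum f n) <= bigsum (fun i => Rabs (f i)) n.
Proof.
  induction n as [|n IH]; simpl; [rewrite Rabs_R0; lra|].
  eapply Rle_trans; [apply Rabs_triang | lra].
Qed.

Lemma bigsum_eq0_inv f n :
  (forall i, (i < n)%nat -> 0 <= f i) -> bigsum f n = 0 ->
  forall i, (i < n)%nat -> f i = 0.
Proof.
  induction n as [|n IH]; simpl; intros Hf E i Hi; [lia|].
  assert (0 <= bigsum f n) by (apply bigsum_nonneg; intros; apply Hf; lia).
  assert (0 <= f n) by (apply Hf; lia).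
  destruct (Nat.eq_dec i n) as [->|Hin]; [lra|].
  apply IH; [intros; apply Hf; lia | lra | lia].
Qed.

Lemma bigsum_Sl f n : bigsum f (S n) = f O + bigsum (fun i => f (S i)) n.
Proof.
  induction n as [|n IH]; [simpl; lra|].
  change (bigsum f (S (S n))) with (bigsum f (S n) + f (S n)).
  rewrite IH; simpl; lra.
Qed.

Lemma bigsum_add f n m :
  bigsum f (n + m) = bigsum f n + bigsum (fun i => f (n + i)%nat) m.
Proof.
  induction m as [|m IH]; [rewrite Nat.add_0_r; simpl; lra|].
  rewrite Nat.add_succ_r; simpl; rewrite IH; lra.
Qed.

Lemma bigsum_even_odd f n :
  bigsum f (2 * n) =
  bigsum (fun i => f (2 * i)%nat) n + bigsum (fun i => f (2 * i + 1)%nat) n.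
Proof.
  induction n as [|n IH]; [simpl; lra|].
  replace (2 * S n)%nat with (S (S (2 * n))) by lia.
  cbn [bigsum]; rewrite IH.
  replace (2 * n + 1)%nat with (S (2 * n)) by lia. lra.
Qed.

Lemma bigsum_rev f n :
  bigsum (fun i => f (n - 1 - i)%nat) n = bigsum f n.
Proof.
  revert f; induction n as [|n IH]; intros f; [reflexivity|].
  rewrite (bigsum_Sl f).
  cbn [bigsum]; replace (S n - 1 - n)%nat with O by lia.
  rewrite Rplus_comm; f_equal.
  rewrite <- (IH (fun i => f (S i))).
  apply bigsum_ext; intros; f_equal; lia.
Qed.

Lemma bigsum_sum_f_R0 f n : sum_f_R0 f n = bigsum f (S n).
Proof. induction n as [|n IH]; simpl in *; [lra|rewrite IH; lra]. Qed.

Lemma bigsum_sum_n f n : sum_n f n = bigsum f (S n).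
Proof. rewrite sum_n_Reals; apply bigsum_sum_f_R0. Qed.

Lemma Rsum_app l1 l2 : Rsum (l1 ++ l2) = Rsum l1 + Rsum l2.
Proof.
  unfold Rsum; induction l1 as [|x l IH]; simpl; [lra|rewrite IH; lra].
Qed.

Lemma Rsum_map_seq f n : Rsum (map f (seq 0 n)) = bigsum f n.
Proof.
  induction n as [|n IH]; [reflexivity|].
  rewrite seq_S, map_app, Rsum_app, IH; unfold Rsum; simpl; lra.
Qed.

(** Partial sums of [1/k^2] stay below 2, by comparison with
    [1/(k(k-1)) = 1/(k-1) - 1/k]. *)
Lemma bigsum_inv_sq_le2 n : bigsum (fun k => / (INR (S k))^2) n <= 2.
Proof.
  assert (E : forall n, bigsum (fun k => / (INR (S k))^2) (S n)
                        <= 2 - / INR (S n)).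
  { clear n; induction n as [|n IH]; [simpl; lra|].
    change (bigsum (fun k => / (INR (S k))^2) (S (S n)))
      with (bigsum (fun k => / (INR (S k))^2) (S n) + / (INR (S (S n)))^2).
    assert (0 < INR (S n)) by (apply lt_0_INR; lia).
    rewrite (S_INR (S n)) in *.
    set (x := INR (S n)) in *.
    assert (/ (x + 1)^2 <= / x - / (x + 1)); [|lra].
    replace (/ x - / (x + 1)) with (/ (x * (x + 1))) by (field; lra).
    apply Rinv_le_contravar; nra. }
  destruct n as [|n]; [simpl; lra|].
  specialize (E n). assert (0 < / INR (S n)); [|lra].
  apply Rinv_0_lt_compat, lt_0_INR; lia.
Qed.

(** * Mean value estimates and powers *)

Lemma derive_bound (f df : R -> R) a b B : a <= b ->
  (forall x, a <= x <= b -> is_derive f x (df x)) ->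
  (forall x, a <= x <= b -> Rabs (df x) <= B) ->
  Rabs (f b - f a) <= B * (b - a).
Proof.
  intros Hab Hd HB.
  destruct (MVT_gen f a b df) as [c [Hc E]].
  - rewrite Rmin_left, Rmax_right by lra. intros; apply Hd; lra.
  - rewrite Rmin_left, Rmax_right by lra. intros.
    apply continuity_pt_filterlim, (ex_derive_continuous (K := R_AbsRing) (V := R_NormedModule)).
    eexists; apply Hd; lra.
  - rewrite Rmin_left, Rmax_right in Hc by lra.
    rewrite E, Rabs_mult, (Rabs_pos_eq (b - a)) by lra.
    apply Rmult_le_compat_r; [lra | auto].
Qed.

Lemma derive_incr (f df : R -> R) a b : a <= b ->
  (forall x, a <= x <= b -> is_derive f x (df x)) ->
  (forall x, a <= x <= b -> 0 <= df x) -> f a <= f b.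
Proof.
  intros Hab Hd HB.
  destruct (MVT_gen f a b df) as [c [Hc E]].
  - rewrite Rmin_left, Rmax_right by lra. intros; apply Hd; lra.
  - rewrite Rmin_left, Rmax_right by lra. intros.
    apply continuity_pt_filterlim, (ex_derive_continuous (K := R_AbsRing) (V := R_NormedModule)).
    eexists; apply Hd; lra.
  - rewrite Rmin_left, Rmax_right in Hc by lra.
    specialize (HB c Hc). nra.
Qed.

Lemma exp_le a b : a <= b -> exp a <= exp b.
Proof. intros [L| ->]; [apply Rlt_le, exp_increasing, L | apply Rle_refl]. Qed.

Lemma ln_1p_bounds y : 0 <= y ->
  y - y^2/2 <= ln (1 + y) <= y - y^2/2 + y^3/3.
Proof.
  intros Hy; split.
  - assert (Q : ln (1 + 0) - (0 - 0^2/2) <= ln (1 + y) - (y - y^2/2)).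
    { apply (derive_incr (fun y => ln (1 + y) - (y - y^2/2))
               (fun y => / (1 + y) - (1 - y))); [exact Hy| |].
      - intros x Hx; auto_derive; [lra | field; lra].
      - intros x Hx. replace (/ (1 + x) - (1 - x)) with (x^2 / (1 + x))
          by (field; lra). apply Rdiv_le_0_compat; nra. }
    rewrite Rplus_0_r, ln_1 in Q. lra.
  - assert (Q : 0 - 0^2/2 + 0^3/3 - ln (1 + 0) <= y - y^2/2 + y^3/3 - ln (1 + y)).
    { apply (derive_incr (fun y => y - y^2/2 + y^3/3 - ln (1 + y))
               (fun y => 1 - y + y^2 - / (1 + y))); [exact Hy| |].
      - intros x Hx; auto_derive; [lra | field; lra].
      - intros x Hx. replace (1 - x + x^2 - / (1 + x)) with (x^3 / (1 + x))
          by (field; lra). apply Rdiv_le_0_compat; [|lra].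
        apply pow_le; lra. }
    rewrite Rplus_0_r, ln_1 in Q. lra.
Qed.

Lemma Rpower_pos x y : 0 < Rpower x y.
Proof. apply exp_pos. Qed.

Lemma is_derive_Rpower x q : 0 < x ->
  is_derive (fun x => Rpower x q) x (q * Rpower x (q - 1)).
Proof.
  intros Hx; apply is_derive_Reals, derivable_pt_lim_power; exact Hx.
Qed.

Lemma Rpower_le_base a b q : 0 <= q -> 0 < a <= b -> Rpower a q <= Rpower b q.
Proof. intros; apply Rle_Rpower_l; lra. Qed.

Lemma Rpower_le_base_neg a b q :
  q <= 0 -> 0 < a <= b -> Rpower b q <= Rpower a q.
Proof.
  intros Hq Hab. replace q with (- (- q)) by ring.
  rewrite (Rpower_Ropp a), (Rpower_Ropp b).
  apply Rinv_le_contravar; [apply Rpower_pos|]. apply Rle_Rpower_l; lra.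
Qed.

Lemma Rpower_base1 q : Rpower 1 q = 1.
Proof. unfold Rpower; rewrite ln_1, Rmult_0_r; apply exp_0. Qed.

Lemma Rpower_ge1 x q : 1 <= x -> 0 <= q -> 1 <= Rpower x q.
Proof.
  intros. apply Rle_trans with (Rpower 1 q); [rewrite Rpower_base1; lra|].
  apply Rpower_le_base; lra.
Qed.

Lemma Rpower_le1 x q : 1 <= x -> q <= 0 -> Rpower x q <= 1.
Proof.
  intros. apply Rle_trans with (Rpower 1 q); [|rewrite Rpower_base1; lra].
  apply Rpower_le_base_neg; lra.
Qed.

(** Convergence of [sum k^(-1-d)]: by [1 + x <= exp x], each term is at most a
    difference of values of [k^(-d)/d]. *)
Lemma bigsum_power_bound d n : 0 < d ->
  bigsum (fun i => Rpower (INR (S i)) (- (1 + d))) n <= 1 + / d.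
Proof.
  intros Hd.
  assert (Q : forall n, bigsum (fun i => Rpower (INR (S i)) (- (1 + d))) (S n)
                <= 1 + / d - / d * Rpower (INR (S n)) (- d)).
  { clear n; induction n as [|n IH].
    - simpl. rewrite !Rpower_base1. lra.
    - change (bigsum (fun i => Rpower (INR (S i)) (- (1 + d))) (S (S n))) with
        (bigsum (fun i => Rpower (INR (S i)) (- (1 + d))) (S n)
         + Rpower (INR (S (S n))) (- (1 + d))).
      assert (Hn : 0 < INR (S n)) by (apply lt_0_INR; lia).
      rewrite (S_INR (S n)) in *. set (x := INR (S n)) in *.
      assert (Rpower (x + 1) (- (1 + d)) <=
              / d * Rpower x (- d) - / d * Rpower (x + 1) (- d)); [|lra].
      replace (Rpower (x + 1) (- (1 + d))) with (Rpower (x + 1) (- d) / (x + 1)).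
      2:{ replace (- (1 + d)) with (- d + - (1)) by ring.
          rewrite Rpower_plus, (Rpower_Ropp _ 1), Rpower_1 by lra. reflexivity. }
      assert (E : Rpower (x + 1) (- d) * (1 + d / (x + 1)) <= Rpower x (- d)).
      { replace (Rpower x (- d)) with
          (Rpower (x + 1) (- d) * exp (d * (ln (x + 1) - ln x))).
        2:{ unfold Rpower; rewrite <- exp_plus; f_equal; ring. }
        apply Rmult_le_compat_l; [apply Rlt_le, Rpower_pos|].
        eapply Rle_trans; [|apply exp_ineq1_le].
        apply Rplus_le_compat_l, Rmult_le_compat_l; [lra|].
        rewrite <- ln_div by lra.
        assert (L : ln (x / (x + 1)) <= x / (x + 1) - 1).
        { assert (0 < x / (x + 1)) by (apply Rdiv_lt_0_compat; lra).
          pose proof (exp_ineq1_le (ln (x / (x + 1)))) as Q.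
          rewrite exp_ln in Q by assumption. lra. }
        rewrite ln_div in * by lra.
        replace (x / (x + 1) - 1) with (- / (x + 1)) in L by (field; lra).
        unfold Rdiv. lra. }
      replace (Rpower (x + 1) (- d) / (x + 1)) with
        (/ d * (Rpower (x + 1) (- d) * (1 + d / (x + 1)))
         - / d * Rpower (x + 1) (- d)) by (field; lra).
      assert (0 < / d) by (apply Rinv_0_lt_compat, Hd).
      assert (/ d * (Rpower (x + 1) (- d) * (1 + d / (x + 1)))
              <= / d * Rpower x (- d)) by (apply Rmult_le_compat_l; lra).
      lra. }
  destruct n as [|n].
  - simpl. assert (0 < / d) by (apply Rinv_0_lt_compat, Hd). lra.
  - eapply Rle_trans; [apply Q|].
    assert (0 < / d * Rpower (INR (S n)) (- d)); [|lra].
    apply Rmult_lt_0_compat; [apply Rinv_0_lt_compat, Hd | apply Rpower_pos].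
Qed.

Lemma is_lim_seq_Rpower_neg d : 0 < d ->
  is_lim_seq (fun n => Rpower (INR (S n)) (- d)) 0.
Proof.
  intros Hd. apply is_lim_seq_spec; intros eps.
  destruct (INR_unbounded (Rpower eps (- / d))) as [N HN].
  exists N; intros n Hn. rewrite Rminus_0_r, Rabs_pos_eq
    by (apply Rlt_le, Rpower_pos).
  assert (Hlt : Rpower eps (- / d) < INR (S n)).
  { eapply Rlt_le_trans; [exact HN|]. apply le_INR; lia. }
  replace (pos eps) with (Rpower (Rpower eps (- / d)) (- d)).
  2:{ rewrite Rpower_mult. replace (- / d * - d) with 1 by (field; lra).
      apply Rpower_1, cond_pos. }
  rewrite !(Rpower_Ropp _ d). apply Rinv_lt_contravar.
  - apply Rmult_lt_0_compat; apply Rpower_pos.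
  - apply Rlt_Rpower_l; [exact Hd|]. split; [apply Rpower_pos | exact Hlt].
Qed.

(** * Complex sequences and absolutely convergent power series *)

Fixpoint Csum (f : nat -> C) (n : nat) : C :=
  match n with O => RtoC 0 | S m => (Csum f m + f m)%C end.

Definition Ccv (u : nat -> C) (l : C) : Prop :=
  forall eps, 0 < eps -> exists N, forall n, (N <= n)%nat ->
    Cmod (u n - l) < eps.

Lemma Csum_ext f g n :
  (forall i, (i < n)%nat -> f i = g i) -> Csum f n = Csum g n.
Proof.
  induction n as [|n IH]; simpl; intros E; [reflexivity|].
  rewrite IH, E; auto; intros; apply E; lia.
Qed.

Lemma Csum_plus f g n :
  Csum (fun i => f i + g i)%C n = (Csum f n + Csum g n)%C.
Proof. induction n as [|n IH]; simpl; [ring|rewrite IH; ring]. Qed.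

Lemma Csum_scal c f n : Csum (fun i => c * f i)%C n = (c * Csum f n)%C.
Proof. induction n as [|n IH]; simpl; [ring|rewrite IH; ring]. Qed.

Lemma Csum_0 f n : (forall i, (i < n)%nat -> f i = RtoC 0) -> Csum f n = RtoC 0.
Proof.
  induction n as [|n IH]; simpl; intros E; [reflexivity|].
  rewrite IH, E; auto; ring.
Qed.

Lemma Csum_Sl f n : Csum f (S n) = (f O + Csum (fun i => f (S i)) n)%C.
Proof.
  induction n as [|n IH]; [simpl; ring|].
  change (Csum f (S (S n))) with (Csum f (S n) + f (S n))%C.
  rewrite IH; simpl; ring.
Qed.

Lemma Csum_add f n m :
  Csum f (n + m) = (Csum f n + Csum (fun i => f (n + i)%nat) m)%C.
Proof.
  induction m as [|m IH]; [rewrite Nat.add_0_r; simpl; ring|].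
  rewrite Nat.add_succ_r; simpl; rewrite IH; ring.
Qed.

Lemma Csum_swap (f : nat -> nat -> C) n m :
  Csum (fun i => Csum (fun j => f i j) m) n =
  Csum (fun j => Csum (fun i => f i j) n) m.
Proof.
  induction n as [|n IH]; simpl; [symmetry; apply Csum_0; auto|].
  rewrite IH, <- Csum_plus; reflexivity.
Qed.

Lemma Cmod_Csum_le f n : Cmod (Csum f n) <= bigsum (fun i => Cmod (f i)) n.
Proof.
  induction n as [|n IH]; simpl; [rewrite Cmod_0; lra|].
  eapply Rle_trans; [apply Cmod_triangle | lra].
Qed.

Lemma Csum_RtoC f n : Csum (fun i => RtoC (f i)) n = RtoC (bigsum f n).
Proof. induction n as [|n IH]; simpl; [|rewrite IH, RtoC_plus]; reflexivity. Qed.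

Lemma Cmod_minus_sym x y : Cmod (x - y) = Cmod (y - x).
Proof. rewrite <- Cmod_opp; f_equal; ring. Qed.

Lemma Cmod_le_add x y : Cmod x <= Cmod y + Cmod (x - y).
Proof.
  replace x with (y + (x - y))%C at 1 by ring. apply Cmod_triangle.
Qed.

Lemma Ccv_unique u l1 l2 : Ccv u l1 -> Ccv u l2 -> l1 = l2.
Proof.
  intros C1 C2.
  destruct (Ceq_dec l1 l2) as [E|E]; [exact E|exfalso].
  assert (P : 0 < Cmod (l1 - l2)) by (apply Cmod_gt_0, Cminus_eq_contra, E).
  destruct (C1 (Cmod (l1 - l2) / 2)) as [N1 Q1]; [lra|].
  destruct (C2 (Cmod (l1 - l2) / 2)) as [N2 Q2]; [lra|].
  specialize (Q1 (N1 + N2)%nat ltac:(lia)).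
  specialize (Q2 (N1 + N2)%nat ltac:(lia)).
  assert (Cmod (l1 - l2) <= Cmod (u (N1 + N2)%nat - l1)
                            + Cmod (u (N1 + N2)%nat - l2)); [|lra].
  rewrite (Cmod_minus_sym _ l1).
  replace (l1 - l2)%C with ((l1 - u (N1 + N2)%nat) + (u (N1 + N2)%nat - l2))%C
    by ring.
  apply Cmod_triangle.
Qed.

Lemma Ccv_ext u v l : (forall n, u n = v n) -> Ccv u l -> Ccv v l.
Proof.
  intros E Cu eps Heps; destruct (Cu eps Heps) as [N HN].
  exists N; intros; rewrite <- E; auto.
Qed.

Lemma Ccv_const c : Ccv (fun _ => c) c.
Proof.
  intros eps Heps; exists O; intros.
  replace (c - c)%C with (RtoC 0) by ring. rewrite Cmod_0; lra.
Qed.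

Lemma Ccv_plus u v a b :
  Ccv u a -> Ccv v b -> Ccv (fun n => u n + v n)%C (a + b)%C.
Proof.
  intros Ca Cb eps Heps.
  destruct (Ca (eps / 2)) as [N1 Q1]; [lra|].
  destruct (Cb (eps / 2)) as [N2 Q2]; [lra|].
  exists (N1 + N2)%nat; intros n Hn.
  specialize (Q1 n ltac:(lia)); specialize (Q2 n ltac:(lia)).
  replace (u n + v n - (a + b))%C with ((u n - a) + (v n - b))%C by ring.
  eapply Rle_lt_trans; [apply Cmod_triangle | lra].
Qed.

Lemma Ccv_scal c u a : Ccv u a -> Ccv (fun n => c * u n)%C (c * a)%C.
Proof.
  intros Ca eps Heps.
  pose proof (Cmod_ge_0 c).
  destruct (Ca (eps / (Cmod c + 1))) as [N Q]; [apply Rdiv_lt_0_compat; lra|].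
  exists N; intros n Hn; specialize (Q n Hn).
  replace (c * u n - c * a)%C with (c * (u n - a))%C by ring.
  rewrite Cmod_mult.
  pose proof (Cmod_ge_0 (u n - a)).
  apply Rle_lt_trans with ((Cmod c + 1) * Cmod (u n - a)); [nra|].
  apply Rlt_le_trans with ((Cmod c + 1) * (eps / (Cmod c + 1))).
  - apply Rmult_lt_compat_l; lra.
  - right; field; lra.
Qed.

Lemma Ccv_S u l : Ccv u l -> Ccv (fun n => u (S n)) l.
Proof.
  intros Cu eps Heps; destruct (Cu eps Heps) as [N HN].
  exists N; intros; apply HN; lia.
Qed.

Lemma Ccv_S_inv u l : Ccv (fun n => u (S n)) l -> Ccv u l.
Proof.
  intros Cu eps Heps; destruct (Cu eps Heps) as [N HN].
  exists (S N); intros [|n] Hn; [lia|]. apply HN; lia.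
Qed.

Lemma Ccv_Cmod_le u l B :
  (forall n, Cmod (u n) <= B) -> Ccv u l -> Cmod l <= B.
Proof.
  intros Hu Cu. apply le_epsilon; intros eps Heps.
  destruct (Cu eps Heps) as [N HN].
  specialize (HN N (le_n _)). specialize (Hu N).
  pose proof (Cmod_le_add l (u N)). rewrite Cmod_minus_sym in HN. lra.
Qed.

Lemma Ccv_bound u l (b : nat -> R) :
  (forall n, Cmod (u n - l) <= b n) -> is_lim_seq b 0 -> Ccv u l.
Proof.
  intros Hu Hb eps Heps.
  apply is_lim_seq_spec in Hb.
  destruct (Hb (mkposreal eps Heps)) as [N HN].
  exists N; intros n Hn; specialize (HN n Hn); simpl in HN.
  rewrite Rminus_0_r in HN.
  eapply Rle_lt_trans; [apply Hu|].
  eapply Rle_lt_trans; [apply Rle_abs | exact HN].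
Qed.

Lemma Ccv_Re u l : Ccv u l -> is_lim_seq (fun n => Re (u n)) (Re l).
Proof.
  intros Cu; apply is_lim_seq_spec; intros eps.
  destruct (Cu eps (cond_pos eps)) as [N HN].
  exists N; intros n Hn; specialize (HN n Hn).
  eapply Rle_lt_trans; [|exact HN].
  replace (Re (u n) - Re l) with (Re (u n - l)%C) by reflexivity.
  apply re_le_Cmod.
Qed.

Lemma is_series_Ccv (c : nat -> C) (l : C) :
  is_series (K := C_AbsRing) (V := C_NormedModule) c l <-> Ccv (Csum c) l.
Proof.
  assert (E : forall n, sum_n (G := C_NormedModule) c n = Csum c (S n)).
  { induction n as [|n IH].
    - rewrite sum_O; simpl; ring.
    - rewrite sum_Sn, IH; reflexivity. }
  unfold is_series.
  rewrite (filterlim_locally_ball_norm (K := C_AbsRing) (U := C_NormedModule)).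
  split.
  - intros Hc; apply Ccv_S_inv; intros eps Heps.
    destruct (Hc (mkposreal eps Heps)) as [N HN].
    exists N; intros n Hn; specialize (HN n Hn).
    rewrite E in HN; exact HN.
  - intros Hc eps.
    destruct (Ccv_S _ _ Hc eps (cond_pos eps)) as [N HN].
    exists N; intros n Hn; specialize (HN n Hn).
    rewrite E; exact HN.
Qed.

Lemma Csum_abs_cv (c : nat -> C) A :
  (forall n, bigsum (fun k => Cmod (c k)) n <= A) ->
  exists l, Ccv (Csum c) l /\ Cmod l <= A.
Proof.
  intros HA.
  assert (Hs : ex_series (fun k => Cmod (c k))).
  { apply ex_finite_lim_seq_incr with A.
    - intros n. rewrite !bigsum_sum_n; simpl.
      pose proof (Cmod_ge_0 (c (S n))); lra.
    - intros n; rewrite bigsum_sum_n; auto. }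
  destruct (ex_series_le (V := C_CompleteNormedModule) c (fun k => Cmod (c k)))
    as [l Hl]; [intros; apply Rle_refl | exact Hs|].
  exists l. assert (Q : Ccv (Csum c) l) by (now apply is_series_Ccv).
  split; [exact Q|].
  apply (Ccv_Cmod_le (Csum c)); [|exact Q].
  intros n; eapply Rle_trans; [apply Cmod_Csum_le | apply HA].
Qed.

(** Limits may be taken term by term in a series dominated by a fixed
    convergent one: the tails are uniformly small, the heads are finite sums. *)
Lemma dominated_Csum (u : nat -> nat -> C) (l : nat -> C) (A : nat -> R)
    (T : nat -> C) (B : R) (S : C) :
  (forall K n, Cmod (u K n) <= A n) ->
  (forall n, bigsum A n <= B) ->
  (forall n, Ccv (fun K => u K n) (l n)) ->
  (forall K, Ccv (Csum (u K)) (T K)) -> Ccv (Csum l) S ->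
  Ccv T S.
Proof.
  intros Hu HB Hl HT HS eps Heps.
  assert (HA : forall n, 0 <= A n)
    by (intros n; eapply Rle_trans; [apply Cmod_ge_0 | apply (Hu O)]).
  assert (HlA : forall n, Cmod (l n) <= A n)
    by (intros n; apply (Ccv_Cmod_le (fun K => u K n)); auto).
  assert (Hs : ex_series A).
  { apply ex_finite_lim_seq_incr with B.
    - intros n. rewrite !bigsum_sum_n; simpl. specialize (HA (Datatypes.S n)); lra.
    - intros n; rewrite bigsum_sum_n; auto. }
  assert (exists N, forall m, bigsum (fun i => A (N + i)%nat) m < eps / 4)
    as [N HN].
  { apply (Cauchy_ex_series (K := R_AbsRing) (V := R_CompleteNormedModule)) in Hs.
    destruct (Hs (mkposreal (eps / 4) ltac:(lra))) as [N HN].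
    exists (Datatypes.S N); intros [|m]; [simpl; lra|].
    specialize (HN (Datatypes.S N) (Datatypes.S N + m)%nat
                  ltac:(lia) ltac:(lia)). simpl in HN.
    change (norm ?x) with (Rabs x) in HN.
    eapply Rle_lt_trans; [apply Rle_abs|].
    replace (bigsum _ _) with (sum_n_m A (Datatypes.S N) (Datatypes.S (N + m)));
      [exact HN|].
    clear. induction m as [|m IH].
    - rewrite Nat.add_0_r, sum_n_n; simpl; rewrite Nat.add_0_r; lra.
    - rewrite Nat.add_succ_r, sum_n_Sm by lia. rewrite IH.
      change (plus ?x ?y) with (x + y). simpl. do 2 f_equal; lia. }
  assert (Tail : forall (f : nat -> C) (F : C), (forall n, Cmod (f n) <= A n) ->
            Ccv (Csum f) F -> Cmod (F - Csum f N) <= eps / 4).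
  { intros f F Hf HF.
    apply (Ccv_Cmod_le (fun m => Csum (fun i => f (N + i)%nat) m)).
    - intros m; eapply Rle_trans; [apply Cmod_Csum_le|].
      eapply Rle_trans; [|apply Rlt_le, (HN m)].
      apply bigsum_le; auto.
    - apply (Ccv_ext (fun m => Csum f (N + m) + - Csum f N)%C).
      + intros m; rewrite Csum_add; ring.
      + apply Ccv_plus; [|apply Ccv_const].
        intros e He; destruct (HF e He) as [M HM].
        exists M; intros; apply HM; lia. }
  assert (Hd : Ccv (fun K => Csum (u K) N) (Csum l N)).
  { clear - Hl. induction N as [|N IH]; simpl; [apply Ccv_const|].
    apply Ccv_plus; auto. }
  destruct (Hd (eps / 4)) as [K0 HK0]; [lra|].
  exists K0; intros K HK; specialize (HK0 K HK).
  pose proof (Tail (u K) (T K) (Hu K) (HT K)) as Q1.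
  pose proof (Tail l S HlA HS) as Q2.
  replace (T K - S)%C with ((T K - Csum (u K) N) + ((Csum (u K) N - Csum l N)
    + - (S - Csum l N)))%C by ring.
  eapply Rle_lt_trans; [apply Cmod_triangle|].
  eapply Rle_lt_trans;
    [apply Rplus_le_compat_l, Cmod_triangle|].
  rewrite Cmod_opp; lra.
Qed.

(** [abs_analytic F z0 r A]: on the closed disc of radius [r] around [z0], [F]
    is the sum of a power series whose coefficients have weighted l1-norm at
    most [A].  Keeping track of the norm [A] is what makes infinite sums of
    such functions analytic again. *)
Definition abs_analytic (F : C -> C) (z0 : C) (r A : R) : Prop :=
  exists c : nat -> C,
    (forall n, bigsum (fun k => Cmod (c k) * r ^ k) n <= A) /\
    forall w, Cmod w <= r ->
      Ccv (Csum (fun k => c k * w ^ k)%C) (F (z0 + w)%C).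

Lemma abs_analytic_ext F G z0 r A :
  (forall w, Cmod w <= r -> F (z0 + w)%C = G (z0 + w)%C) ->
  abs_analytic F z0 r A -> abs_analytic G z0 r A.
Proof.
  intros E [c [H1 H2]]; exists c; split; [exact H1|].
  intros w Hw; rewrite <- E; auto.
Qed.

Lemma abs_analytic_weaken F z0 r A B :
  A <= B -> abs_analytic F z0 r A -> abs_analytic F z0 r B.
Proof.
  intros E [c [H1 H2]]; exists c; split; [|exact H2].
  intros n; eapply Rle_trans; [apply H1 | exact E].
Qed.

Lemma abs_analytic_scal d F z0 r A : 0 <= r ->
  abs_analytic F z0 r A -> abs_analytic (fun z => d * F z)%C z0 r (Cmod d * A).
Proof.
  intros Hr [c [H1 H2]]; exists (fun k => d * c k)%C; split.
  - intros n.
    rewrite (bigsum_ext _ (fun k => Cmod d * (Cmod (c k) * r ^ k))).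
    + rewrite bigsum_scal. apply Rmult_le_compat_l; [apply Cmod_ge_0 | auto].
    + intros; rewrite Cmod_mult; ring.
  - intros w Hw. apply (Ccv_ext (fun n => d * Csum (fun k => c k * w ^ k) n)%C).
    + intros n; rewrite <- Csum_scal; apply Csum_ext; intros; ring.
    + apply Ccv_scal; auto.
Qed.

Lemma abs_analytic_plus F G z0 r A B : 0 <= r ->
  abs_analytic F z0 r A -> abs_analytic G z0 r B ->
  abs_analytic (fun z => F z + G z)%C z0 r (A + B).
Proof.
  intros Hr [c [H1 H2]] [d [H3 H4]]; exists (fun k => c k + d k)%C; split.
  - intros n. eapply Rle_trans;
      [|apply Rplus_le_compat; [apply (H1 n) | apply (H3 n)]].
    rewrite <- bigsum_plus. apply bigsum_le; intros i _.
    pose proof (Cmod_triangle (c i) (d i)). pose proof (pow_le r i Hr). nra.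
  - intros w Hw.
    apply (Ccv_ext (fun n => Csum (fun k => c k * w ^ k) n
                             + Csum (fun k => d k * w ^ k) n)%C).
    + intros n; rewrite <- Csum_plus; apply Csum_ext; intros; ring.
    + apply Ccv_plus; auto.
Qed.

Lemma abs_analytic_const d z0 r : abs_analytic (fun _ => d) z0 r (Cmod d).
Proof.
  exists (fun k => match k with O => d | S _ => RtoC 0 end); split.
  - intros [|n]; [apply Cmod_ge_0|].
    rewrite bigsum_Sl, (bigsum_0 _ n); [simpl; lra|].
    intros; rewrite Cmod_0; ring.
  - intros w Hw; apply Ccv_S_inv.
    apply (Ccv_ext (fun _ => d)); [|apply Ccv_const].
    intros n; rewrite Csum_Sl, Csum_0; [simpl; ring|intros; ring].
Qed.

Lemma abs_analytic_mult_linear d F z0 r A : 0 <= r ->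
  abs_analytic F z0 r A ->
  abs_analytic (fun z => (z + d) * F z)%C z0 r ((Cmod (z0 + d) + r) * A).
Proof.
  intros Hr [c [H1 H2]].
  replace ((Cmod (z0 + d) + r) * A) with (Cmod (z0 + d) * A + r * A) by ring.
  apply (abs_analytic_ext
    (fun z => (z0 + d) * F z + (z - z0) * F z)%C); [intros; ring|].
  apply (abs_analytic_plus (fun z => (z0 + d) * F z)%C
           (fun z => (z - z0) * F z)%C); [exact Hr| |].
  - apply abs_analytic_scal; [exact Hr|]. now exists c.
  - exists (fun k => match k with O => RtoC 0 | S k => c k end); split.
    + intros [|n].
      * simpl. specialize (H1 O); simpl in H1; nra.
      * rewrite bigsum_Sl, Cmod_0, Rmult_0_l, Rplus_0_l.
        rewrite (bigsum_ext _ (fun k => r * (Cmod (c k) * r ^ k))).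
        -- rewrite bigsum_scal; apply Rmult_le_compat_l; auto.
        -- intros; simpl; ring.
    + intros w Hw; apply Ccv_S_inv.
      replace (z0 + w - z0)%C with w by ring.
      apply (Ccv_ext (fun n => w * Csum (fun k => c k * w ^ k) n)%C).
      * intros n; rewrite Csum_Sl, <- Csum_scal.
        replace (RtoC 0 * w ^ 0)%C with (RtoC 0) by ring.
        rewrite Cplus_0_l. apply Csum_ext; intros; rewrite Cpow_S; ring.
      * apply Ccv_scal; auto.
Qed.

Lemma abs_analytic_mult_pow F z0 r A j : 0 <= r ->
  abs_analytic F z0 r A ->
  abs_analytic (fun z => z ^ j * F z)%C z0 r ((Cmod z0 + r) ^ j * A).
Proof.
  intros Hr HF; induction j as [|j IH].
  - rewrite pow_O, Rmult_1_l. eapply abs_analytic_ext; [|exact HF].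
    intros; simpl; ring.
  - eapply abs_analytic_ext; [|eapply abs_analytic_weaken;
      [|apply (abs_analytic_mult_linear (RtoC 0) _ _ _ _ Hr IH)]].
    + intros; cbv beta; rewrite Cpow_S; ring.
    + replace (z0 + RtoC 0)%C with z0 by ring. simpl; right; ring.
Qed.

(** A sum of functions with summable l1-norms is analytic: its coefficients
    are the sums of the coefficients, by dominated convergence. *)
Lemma abs_analytic_sum (F : nat -> C -> C) G z0 r (A : nat -> R) B :
  0 < r ->
  (forall n, abs_analytic (F n) z0 r (A n)) ->
  (forall n, bigsum A n <= B) ->
  (forall w, Cmod w <= r ->
     Ccv (Csum (fun n => F n (z0 + w)%C)) (G (z0 + w)%C)) ->
  abs_analytic G z0 r B.
Proof.
  intros Hr HF HB HG.
  pose (c := fun n => proj1_sig (constructive_indefinite_description _ (HF n))).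
  assert (Hc1 : forall n K, bigsum (fun k => Cmod (c n k) * r ^ k) K <= A n).
  { intros n; exact (proj1 (proj2_sig
      (constructive_indefinite_description _ (HF n)))). }
  assert (Hc2 : forall n w, Cmod w <= r ->
      Ccv (Csum (fun k => c n k * w ^ k)%C) (F n (z0 + w)%C)).
  { intros n; exact (proj2 (proj2_sig
      (constructive_indefinite_description _ (HF n)))). }
  clearbody c.
  assert (Hck : forall n k, Cmod (c n k) * r ^ k <= A n).
  { intros n k; eapply Rle_trans; [|apply (Hc1 n (S k))]. simpl.
    assert (0 <= bigsum (fun k => Cmod (c n k) * r ^ k) k); [|lra].
    apply bigsum_nonneg; intros.
    apply Rmult_le_pos; [apply Cmod_ge_0 | apply pow_le; lra]. }
  assert (Hb : forall k, exists b, Ccv (Csum (fun n => c n k)) b).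
  { intros k. destruct (Csum_abs_cv (fun n => c n k) (B / r ^ k)) as [b [Hb _]];
      [|now exists b].
    intros n. assert (0 < r ^ k) by (apply pow_lt; lra).
    apply Rmult_le_reg_r with (r ^ k); [assumption|].
    unfold Rdiv; rewrite Rmult_assoc, Rinv_l, Rmult_1_r by lra.
    rewrite Rmult_comm, <- bigsum_scal.
    eapply Rle_trans; [|apply (HB n)].
    apply bigsum_le; intros; rewrite Rmult_comm; auto. }
  pose (b := fun k => proj1_sig (constructive_indefinite_description _ (Hb k))).
  assert (Hb' : forall k, Ccv (Csum (fun n => c n k)) (b k))
    by (intros k; exact (proj2_sig
          (constructive_indefinite_description _ (Hb k)))).
  clearbody b; clear Hb.
  exists b; split.
  - intros K. apply le_epsilon; intros eps Heps.
    assert (exists n, bigsum (fun k => Cmod (b k) * r ^ k) K <=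
              bigsum (fun k => Cmod (Csum (fun i => c i k) n) * r ^ k) K + eps)
      as [n Hn].
    { assert (Q : forall K eps, 0 < eps -> exists N, forall n, (N <= n)%nat ->
        bigsum (fun k => Cmod (b k) * r ^ k) K <=
        bigsum (fun k => Cmod (Csum (fun i => c i k) n) * r ^ k) K + eps).
      { clear K eps Heps; induction K as [|K IH]; intros eps Heps;
          [exists O; intros; simpl; lra|].
        destruct (IH (eps / 2)) as [N1 Q1]; [lra|].
        assert (0 < r ^ K) by (apply pow_lt; lra).
        destruct (Hb' K (eps / 2 / r ^ K)) as [N2 Q2];
          [apply Rdiv_lt_0_compat; lra|].
        exists (N1 + N2)%nat; intros n Hn.
        specialize (Q1 n ltac:(lia)); specialize (Q2 n ltac:(lia)); simpl.
        pose proof (Cmod_le_add (b K) (Csum (fun i => c i K) n)) as Q3.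
        rewrite Cmod_minus_sym in Q2.
        assert (Cmod (b K) * r ^ K <= (Cmod (Csum (fun i => c i K) n)
                  + eps / 2 / r ^ K) * r ^ K)
          by (apply Rmult_le_compat_r; lra).
        replace ((Cmod (Csum (fun i => c i K) n) + eps / 2 / r ^ K) * r ^ K)
          with (Cmod (Csum (fun i => c i K) n) * r ^ K + eps / 2) in H0
          by (field; lra).
        lra. }
      destruct (Q K eps Heps) as [N HN]; exists N; auto. }
    eapply Rle_trans; [exact Hn|]. apply Rplus_le_compat_r.
    eapply Rle_trans; [|apply (HB n)].
    assert (Q : forall n, bigsum (fun k => Cmod (Csum (fun i => c i k) n) * r ^ k) K
                <= bigsum (fun i => bigsum (fun k => Cmod (c i k) * r ^ k) K) n).
    { clear Hn; clear n. induction n as [|n IH].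
      - simpl. rewrite bigsum_0; [lra|]. intros; rewrite Cmod_0; ring.
      - simpl. eapply Rle_trans; [|apply Rplus_le_compat_r, IH].
        rewrite <- bigsum_plus. apply bigsum_le; intros k _.
        pose proof (Cmod_triangle (Csum (fun i => c i k) n) (c n k)).
        pose proof (pow_le r k ltac:(lra)). nra. }
    eapply Rle_trans; [apply Q|]. apply bigsum_le; auto.
  - intros w Hw.
    apply (dominated_Csum (fun K n => Csum (fun k => c n k * w ^ k)%C K)
             (fun n => F n (z0 + w)%C) A _ B); auto.
    + intros K n. eapply Rle_trans; [apply Cmod_Csum_le|].
      eapply Rle_trans; [|apply (Hc1 n K)].
      apply bigsum_le; intros i _. rewrite Cmod_mult, Cmod_pow.
      apply Rmult_le_compat_l; [apply Cmod_ge_0|].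
      apply pow_incr; split; [apply Cmod_ge_0 | exact Hw].
    + intros K.
      apply (Ccv_ext (fun N => Csum (fun k => w ^ k * Csum (fun n => c n k) N)%C K)).
      { intros N; rewrite Csum_swap; apply Csum_ext; intros k _.
        rewrite <- Csum_scal; apply Csum_ext; intros; ring. }
      clear - Hb'. induction K as [|K IH]; simpl; [apply Ccv_const|].
      apply Ccv_plus; [exact IH|]. rewrite (Cmult_comm (b K)).
      apply Ccv_scal; auto.
Qed.

(** If zeros accumulate at the centre, the first nonvanishing coefficient [c n]
    would satisfy [|c n| <= |w| A / r^(n+1)] for arbitrarily small zeros [w]. *)
Lemma abs_analytic_zero F z0 r A :
  0 < r -> abs_analytic F z0 r A ->
  (forall eps, 0 < eps -> exists w, w <> RtoC 0 /\ Cmod w < eps /\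
     F (z0 + w)%C = RtoC 0) ->
  forall w, Cmod w <= r -> F (z0 + w)%C = RtoC 0.
Proof.
  intros Hr [c [HA HF]] Hz.
  assert (Hc : forall n k, (k < n)%nat -> c k = RtoC 0).
  { induction n as [|n IH]; intros k Hk; [lia|].
    destruct (Nat.eq_dec k n) as [->|Hkn]; [|apply IH; lia].
    apply Cmod_eq_0, Rle_antisym; [|apply Cmod_ge_0].
    assert (HA0 : 0 <= A) by apply (HA O).
    assert (0 < r ^ S n) by (apply pow_lt; lra).
    apply le_epsilon; intros eps Heps; rewrite Rplus_0_l.
    destruct (Hz (Rmin r (eps * r ^ S n / (A + 1)))) as [w [Hw0 [Hw Fw]]].
    { apply Rmin_pos; [lra|]. apply Rdiv_lt_0_compat; nra. }
    assert (Hwr : Cmod w <= r) by (eapply Rle_trans;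
      [apply Rlt_le, Hw | apply Rmin_l]).
    assert (Hwe : Cmod w < eps * r ^ S n / (A + 1)) by (eapply Rlt_le_trans;
      [apply Hw | apply Rmin_r]).
    assert (Hwp : 0 < Cmod w) by (now apply Cmod_gt_0).
    specialize (HF w Hwr); rewrite Fw in HF.
    assert (Hle : Cmod (c n * w ^ n) <= (Cmod w / r) ^ S n * A).
    { apply (Ccv_Cmod_le (fun m => - (Csum (fun k => c k * w ^ k) (S n + m)
                                 - c n * w ^ n)))%C.
      - intros m. rewrite Cmod_opp, Csum_add.
        cbn [Csum]. rewrite (Csum_0 _ n) by (intros; rewrite IH by lia; ring).
        replace (RtoC 0 + c n * w ^ n + _ - c n * w ^ n)%C with
          (Csum (fun i => c (S n + i)%nat * w ^ (S n + i))%C m) by ring.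
        eapply Rle_trans; [apply Cmod_Csum_le|].
        eapply Rle_trans; [|apply Rmult_le_compat_l; [|apply (HA (S n + m)%nat)]].
        + rewrite bigsum_add, Rmult_plus_distr_l, <- !bigsum_scal.
          match goal with |- ?x <= ?y + ?z =>
            assert (0 <= y); [|assert (x <= z); [|lra]] end.
          * apply bigsum_nonneg; intros.
            apply Rmult_le_pos; [apply pow_le, Rlt_le, Rdiv_lt_0_compat; lra|].
            apply Rmult_le_pos; [apply Cmod_ge_0 | apply pow_le; lra].
          * apply bigsum_le; intros i _. rewrite Cmod_mult, Cmod_pow.
            replace ((Cmod w / r) ^ S n * (Cmod (c (S n + i)%nat) * r ^ (S n + i)))
              with (Cmod (c (S n + i)%nat) * (Cmod w ^ S n * r ^ i)).
            2:{ unfold Rdiv; rewrite Rpow_mult_distr, pow_inv, pow_add by lra.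
                field. lra. }
            apply Rmult_le_compat_l; [apply Cmod_ge_0|].
            rewrite pow_add. apply Rmult_le_compat_l; [apply pow_le; lra|].
            apply pow_incr; lra.
        + apply pow_le, Rlt_le, Rdiv_lt_0_compat; lra.
      - set (P := (c n * w ^ n)%C).
        assert (Q : Ccv (fun m => - (1) * (Csum (fun k => c k * w ^ k) (S n + m)
                       + - P))%C (- (1) * (RtoC 0 + - P))%C).
        { apply Ccv_scal, Ccv_plus; [|apply Ccv_const].
          intros e He; destruct (HF e He) as [M HM]; exists M; intros.
          apply HM; lia. }
        replace (- (1) * (RtoC 0 + - P))%C with P in Q by ring.
        eapply Ccv_ext; [|exact Q]. intros; cbv beta; ring. }
    rewrite Cmod_mult, Cmod_pow in Hle.
    assert (0 < Cmod w ^ n) by (apply pow_lt; lra).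
    apply Rmult_le_reg_r with (Cmod w ^ n); [assumption|].
    eapply Rle_trans; [exact Hle|].
    replace ((Cmod w / r) ^ S n * A) with ((Cmod w * A / r ^ S n) * Cmod w ^ n)
      by (unfold Rdiv; rewrite Rpow_mult_distr, pow_inv by lra; simpl; ring).
    apply Rmult_le_compat_r; [lra|].
    apply Rmult_le_reg_r with (r ^ S n); [lra|].
    unfold Rdiv; rewrite Rmult_assoc, Rinv_l, Rmult_1_r by lra.
    assert (Cmod w * (A + 1) < eps * r ^ S n); [|nra].
    apply Rmult_lt_reg_r with (/ (A + 1)); [apply Rinv_0_lt_compat; lra|].
    rewrite Rmult_assoc, Rinv_r, Rmult_1_r by lra. exact Hwe. }
  intros w Hw. apply (Ccv_unique (Csum (fun k => c k * w ^ k)%C)); auto.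
  apply (Ccv_ext (fun _ => RtoC 0)); [|apply Ccv_const].
  intros n; rewrite Csum_0; [reflexivity|].
  intros; rewrite (Hc (S i)) by lia; ring.
Qed.

(** Terms of a convergent power series are bounded, so on half the radius the
    coefficients are summable. *)
Lemma analytic_at_abs_analytic f z0 :
  analytic_at f z0 -> exists r A, 0 < r /\ abs_analytic f z0 r A.
Proof.
  intros [r [c [Hr Hc]]].
  assert (Hc' : forall w, Cmod w < r ->
            Ccv (Csum (fun k => c k * w ^ k)%C) (f (z0 + w)%C)).
  { intros w Hw. specialize (Hc (z0 + w)%C).
    replace (z0 + w - z0)%C with w in Hc by ring.
    specialize (Hc Hw). apply is_series_Ccv in Hc.
    eapply Ccv_ext; [|exact Hc]. intros n; apply Csum_ext; intros i _.
    change (pow_n w i * c i = c i * w ^ i)%C.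
    replace (pow_n w i : C) with (w ^ i)%C; [ring|].
    clear. induction i as [|i IH]; [reflexivity|].
    rewrite Cpow_S, IH; reflexivity. }
  assert (HM : exists M, forall k, Cmod (c k) * (r / 2) ^ k <= M).
  { destruct (Hc' (RtoC (r / 2))) with (eps := 1) as [N HN];
      [rewrite Cmod_R, Rabs_pos_eq; lra | lra|].
    assert (Q : forall k, (N <= k)%nat -> Cmod (c k) * (r / 2) ^ k <= 2).
    { intros k Hk.
      pose proof (HN k ltac:(lia)) as Q1.
      pose proof (HN (S k) ltac:(lia)) as Q2. simpl in Q2.
      replace (Cmod (c k) * (r / 2) ^ k) with (Cmod (c k * RtoC (r / 2) ^ k)).
      2:{ rewrite Cmod_mult, Cmod_pow, Cmod_R, Rabs_pos_eq; lra. }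
      set (x := (c k * RtoC (r / 2) ^ k)%C) in *.
      set (y := Csum (fun k => c k * RtoC (r / 2) ^ k)%C k) in *.
      set (l := f (z0 + RtoC (r / 2))%C) in *.
      replace x with ((y + x - l) + - (y - l))%C by ring.
      eapply Rle_trans; [apply Cmod_triangle|]. rewrite Cmod_opp; lra. }
    exists (2 + bigsum (fun k => Cmod (c k) * (r / 2) ^ k) N). intros k.
    assert (P : forall i, 0 <= Cmod (c i) * (r / 2) ^ i)
      by (intros; apply Rmult_le_pos; [apply Cmod_ge_0 | apply pow_le; lra]).
    destruct (le_lt_dec N k) as [Hk|Hk].
    - specialize (Q k Hk).
      pose proof (bigsum_nonneg (fun k => Cmod (c k) * (r / 2) ^ k) N
                    (fun i _ => P i)). lra.
    - assert (Cmod (c k) * (r / 2) ^ k <=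
              bigsum (fun k => Cmod (c k) * (r / 2) ^ k) N); [|lra].
      replace N with (S k + (N - S k))%nat by lia.
      rewrite bigsum_add; simpl.
      pose proof (bigsum_nonneg (fun k => Cmod (c k) * (r / 2) ^ k) k
                    (fun i _ => P i)).
      pose proof (bigsum_nonneg (fun i => Cmod (c (S (k + i))) * ((r / 2) * (r / 2) ^ (k + i)))
                    (N - S k) (fun i _ => P (S (k + i)))). lra. }
  destruct HM as [M HM].
  exists (r / 4), (2 * M); split; [lra|].
  exists c; split; [|intros w Hw; apply Hc'; lra].
  intros n.
  assert (HM0 : 0 <= M).
  { eapply Rle_trans; [|apply (HM O)].
    apply Rmult_le_pos; [apply Cmod_ge_0 | simpl; lra]. }
  apply Rle_trans with (M * bigsum (fun k => (1/2)^k) n).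
  - rewrite <- bigsum_scal. apply bigsum_le; intros k _.
    replace (r / 4) with (r / 2 * (1 / 2)) by field.
    rewrite Rpow_mult_distr, <- Rmult_assoc.
    apply Rmult_le_compat_r; [apply pow_le; lra | auto].
  - assert (bigsum (fun k => (1/2)^k) n = 2 - 2 * (1/2)^n) as ->.
    { clear. induction n as [|n IH]; simpl; [lra|rewrite IH; field]. }
    assert (0 < (1/2)^n) by (apply pow_lt; lra). nra.
Qed.

(** The identity theorem along an arc: the set of times up to which [F]
    vanishes on the arc is closed and open, because zeros accumulate at the
    point reached and force the whole local power series to vanish. *)
Lemma identity_along_arc (F : C -> C) (path : R -> C) (L e : R) :
  0 <= L -> 0 < e < 1 ->
  (forall s t, 0 <= s <= 1 -> 0 <= t <= 1 ->
     Cmod (path s - path t) <= L * Rabs (s - t)) ->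
  (forall s t, path s = path t -> s = t) ->
  (forall t, 0 <= t <= 1 -> exists r A, 0 < r /\ abs_analytic F (path t) r A) ->
  (forall t, 0 <= t <= e -> F (path t) = RtoC 0) ->
  F (path 1) = RtoC 0.
Proof.
  intros HL He Hlip Hinj Han H0.
  pose (E := fun x => 0 <= x <= 1 /\ forall t, 0 <= t <= x -> F (path t) = RtoC 0).
  destruct (completeness E) as [m [Hm1 Hm2]].
  { exists 1; intros x [Hx _]; lra. }
  { exists 0; split; [lra|]. intros; apply H0; lra. }
  assert (Hem : e <= m) by (apply Hm1; split; [lra|auto]).
  assert (Hm : m <= 1) by (apply Hm2; intros x [Hx _]; lra).
  assert (Hbelow : forall t, 0 <= t < m -> F (path t) = RtoC 0).
  { intros t Ht. destruct (classic (exists x, E x /\ t < x)) as [[x [[_ Ex] Hx]]|N].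
    - apply Ex; lra.
    - exfalso. assert (m <= t); [|lra]. apply Hm2; intros x Ex.
      destruct (Rle_lt_dec x t); [assumption|]. exfalso; eauto. }
  destruct (Han m ltac:(lra)) as [r [A [Hr HA]]].
  assert (Hball : forall w, Cmod w <= r -> F (path m + w)%C = RtoC 0).
  { apply (abs_analytic_zero F (path m) r A Hr HA).
    intros eps Heps.
    pose (d := Rmin (m / 2) (eps / (2 * (L + 1)))).
    assert (Hd : 0 < d) by (apply Rmin_pos; [lra|apply Rdiv_lt_0_compat; lra]).
    assert (d <= m / 2) by apply Rmin_l.
    exists (path (m - d)%R - path m)%C; split; [|split].
    - intros E0. assert (m - d = m); [|lra]. apply Hinj.
      replace (path (m - d)%R) with (path (m - d)%R - path m + path m)%C by ring.
      rewrite E0; ring.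
    - eapply Rle_lt_trans; [apply Hlip; lra|].
      replace (m - d - m) with (- d) by ring.
      rewrite Rabs_Ropp, Rabs_pos_eq by lra.
      assert (d <= eps / (2 * (L + 1))) by apply Rmin_r.
      apply Rle_lt_trans with ((L + 1) * (eps / (2 * (L + 1)))); [nra|].
      replace ((L + 1) * (eps / (2 * (L + 1)))) with (eps / 2) by (field; lra).
      lra.
    - replace (path m + (path (m - d)%R - path m))%C with (path (m - d)%R) by ring.
      apply Hbelow; lra. }
  assert (Hnear : forall t, m <= t <= 1 -> t <= m + r / (L + 1) ->
            F (path t) = RtoC 0).
  { intros t H1 H2.
    replace (path t) with (path m + (path t - path m))%C by ring.
    apply Hball. eapply Rle_trans; [apply Hlip; lra|].
    rewrite Rabs_pos_eq by lra.
    apply Rle_trans with ((L + 1) * (r / (L + 1))); [nra|].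
    right; field; lra. }
  assert (0 < r / (L + 1)) by (apply Rdiv_lt_0_compat; lra).
  destruct (Rle_lt_dec 1 (m + r / (L + 1))) as [Hc|Hc]; [apply Hnear; lra|].
  exfalso. assert (m + r / (L + 1) <= m); [|lra].
  apply Hm1; split; [lra|]. intros t Ht.
  destruct (Rlt_le_dec t m); [apply Hbelow; lra | apply Hnear; lra].
Qed.

(** * The complex exponential *)

Lemma Cexp_plus a b : Cexp (a + b) = (Cexp a * Cexp b)%C.
Proof.
  unfold Cexp; destruct a as [a1 a2], b as [b1 b2]; simpl.
  rewrite exp_plus, cos_plus, sin_plus.
  apply injective_projections; simpl; ring.
Qed.

Lemma Cexp_0 : Cexp (RtoC 0) = RtoC 1.
Proof.
  unfold Cexp; simpl; rewrite exp_0, cos_0, sin_0.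
  apply injective_projections; simpl; ring.
Qed.

Lemma Cexp_RtoC x : Cexp (RtoC x) = RtoC (exp x).
Proof.
  unfold Cexp; simpl; rewrite cos_0, sin_0.
  apply injective_projections; simpl; ring.
Qed.

Lemma Cmod_Cexp z : Cmod (Cexp z) = exp (Re z).
Proof.
  unfold Cmod, Cexp; simpl.
  replace (_ + _) with (Rsqr (exp (Re z)) *
    (Rsqr (sin (Im z)) + Rsqr (cos (Im z)))) by (unfold Rsqr; simpl; ring).
  rewrite sin2_cos2, Rmult_1_r, sqrt_Rsqr; [reflexivity|].
  apply Rlt_le, exp_pos.
Qed.

Definition Cder (f : R -> C) (t : R) (d : C) : Prop :=
  is_derive (fun t => Re (f t)) t (Re d) /\ is_derive (fun t => Im (f t)) t (Im d).

Lemma Cder_plus f g t a b :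
  Cder f t a -> Cder g t b -> Cder (fun t => f t + g t)%C t (a + b)%C.
Proof.
  intros [A1 A2] [B1 B2]; split; simpl.
  - now apply (is_derive_plus (V := R_NormedModule)
                 (fun t => Re (f t)) (fun t => Re (g t))).
  - now apply (is_derive_plus (V := R_NormedModule)
                 (fun t => Im (f t)) (fun t => Im (g t))).
Qed.

Lemma Cder_mult f g t a b :
  Cder f t a -> Cder g t b ->
  Cder (fun t => f t * g t)%C t (a * g t + f t * b)%C.
Proof.
  assert (M : forall f g a b, is_derive f t a -> is_derive g t b ->
            is_derive (fun t : R => f t * g t : R) t (a * g t + f t * b)).
  { intros; apply (is_derive_mult (K := R_AbsRing)); try assumption.
    intros; apply Rmult_comm. }
  intros [A1 A2] [B1 B2]; split; simpl.
  - replace (_ + _) with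
      ((Re a * Re (g t) + Re (f t) * Re b) - (Im a * Im (g t) + Im (f t) * Im b))
      by (unfold Re, Im; simpl; ring).
    apply (is_derive_minus (V := R_NormedModule)
             (fun t => Re (f t) * Re (g t)) (fun t => Im (f t) * Im (g t)));
      [now apply (M (fun t => Re (f t)) (fun t => Re (g t)))
      |now apply (M (fun t => Im (f t)) (fun t => Im (g t)))].
  - replace (_ + _) with
      ((Re a * Im (g t) + Re (f t) * Im b) + (Im a * Re (g t) + Im (f t) * Re b))
      by (unfold Re, Im; simpl; ring).
    apply (is_derive_plus (V := R_NormedModule)
             (fun t => Re (f t) * Im (g t)) (fun t => Im (f t) * Re (g t)));
      [now apply (M (fun t => Re (f t)) (fun t => Im (g t)))
      |now apply (M (fun t => Im (f t)) (fun t => Re (g t)))].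
Qed.

Lemma Cder_real f t a c : is_derive f t a ->
  Cder (fun t => RtoC (f t) * c)%C t (RtoC a * c)%C.
Proof.
  intros D; split; simpl.
  - eapply (is_derive_ext (V := R_NormedModule));
      [|replace (a * fst c - 0 * snd c) with (a * fst c) by ring;
        apply (is_derive_scal_l (K := R_AbsRing) (V := R_NormedModule) f t a (fst c) D)].
    intros; unfold scal; simpl; unfold mult; simpl; ring.
  - eapply (is_derive_ext (V := R_NormedModule));
      [|replace (a * snd c + 0 * fst c) with (a * snd c) by ring;
        apply (is_derive_scal_l (K := R_AbsRing) (V := R_NormedModule) f t a (snd c) D)].
    intros; unfold scal; simpl; unfold mult; simpl; ring.
Qed.

Lemma Cder_ext f g t a :
  (forall t, f t = g t) -> Cder f t a -> Cder g t a.
Proof.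
  intros E [A B]; split; eapply (is_derive_ext (V := R_NormedModule));
    try eassumption; intros; cbv beta; now rewrite E.
Qed.

Lemma Cder_const c t : Cder (fun _ => c) t (RtoC 0).
Proof. split; apply (is_derive_const (V := R_NormedModule)). Qed.

Lemma Cder_exp w t :
  Cder (fun t => Cexp (RtoC t * w)) t (w * Cexp (RtoC t * w))%C.
Proof.
  destruct w as [x y]; split; simpl.
  - apply (is_derive_ext (V := R_NormedModule)
             (fun t => exp (t * x) * cos (t * y))).
    + intros u; f_equal; f_equal; ring.
    + replace (t * x - 0 * y) with (t * x) by ring.
      replace (t * y + 0 * x) with (t * y) by ring.
      auto_derive; [exact I | ring].
  - apply (is_derive_ext (V := R_NormedModule)
             (fun t => exp (t * x) * sin (t * y))).
    + intros u; f_equal; f_equal; ring.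
    + replace (t * x - 0 * y) with (t * x) by ring.
      replace (t * y + 0 * x) with (t * y) by ring.
      auto_derive; [exact I | ring].
Qed.

Lemma Cder_bound f d B :
  (forall t, 0 <= t <= 1 -> Cder f t (d t) /\ Cmod (d t) <= B) ->
  Cmod (f 1 - f 0) <= 2 * B.
Proof.
  intros Hd.
  assert (HB : 0 <= B) by (eapply Rle_trans; [apply Cmod_ge_0|
                             apply (Hd 0); lra]).
  assert (R1 : Rabs (Re (f 1) - Re (f 0)) <= B * (1 - 0)).
  { apply (derive_bound (fun t => Re (f t)) (fun t => Re (d t))); [lra| |].
    - intros; now apply Hd.
    - intros; eapply Rle_trans; [apply re_le_Cmod | now apply Hd]. }
  assert (R2 : Rabs (Im (f 1) - Im (f 0)) <= B * (1 - 0)).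
  { apply (derive_bound (fun t => Im (f t)) (fun t => Im (d t))); [lra| |].
    - intros; now apply Hd.
    - intros t Ht; eapply Rle_trans; [|apply (proj2 (Hd t Ht))].
      eapply Rle_trans; [|apply Rmax_Cmod]. apply Rmax_r. }
  eapply Rle_trans; [apply Cmod_2Rmax|].
  assert (sqrt 2 <= 2) by (apply Rsqr_incr_0_var;
    [unfold Rsqr; rewrite sqrt_def; lra | lra]).
  pose proof (sqrt_pos 2).
  apply Rmult_le_compat; try lra.
  - eapply Rle_trans; [apply Rabs_pos | apply Rmax_l].
  - apply Rmax_lub; simpl; unfold Re, Im in *;
      rewrite Rminus_0_r, Rmult_1_r in *; assumption.
Qed.

Lemma is_lim_seq_pow_fact x :
  is_lim_seq (fun n => x ^ n / INR (fact n)) 0.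
Proof.
  apply (is_lim_seq_ext (fun n => scal (pow_n x n) (/ INR (fact n)))).
  - intros n. rewrite pow_n_pow. reflexivity.
  - apply ex_series_lim_0. exists (exp x). apply is_exp_Reals.
Qed.

(** For the Taylor polynomial [P_n] of exp one has
    [d/dt (exp(-tw) P_n(tw)) = - w exp(-tw) (tw)^n/n!], which tends to 0
    uniformly on [[0,1]]; hence [exp(-w) P_n(w)] tends to 1. *)
Lemma Cexp_series w :
  Ccv (Csum (fun k => RtoC (/ INR (fact k)) * w ^ k)%C) (Cexp w).
Proof.
  assert (Hf : forall k, INR (fact k) <> 0) by apply INR_fact_neq_0.
  pose (P := fun n t => Csum (fun k => RtoC (t ^ k) *
                                (RtoC (/ INR (fact k)) * w ^ k))%C n).
  assert (DP : forall n t, Cder (P (S n)) t (w * P n t)%C).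
  { induction n as [|n IH]; intros t.
    - replace (w * P O t)%C with (RtoC 0) by (unfold P; simpl; ring).
      apply (Cder_ext (fun _ => RtoC 1)); [|apply Cder_const].
      intros u; unfold P; simpl. rewrite Rinv_1; ring.
    - change (P (S (S n))) with (fun t => P (S n) t +
        RtoC (t ^ S n) * (RtoC (/ INR (fact (S n))) * w ^ S n))%C.
      replace (w * P (S n) t)%C with (w * P n t + RtoC (INR (S n) * t ^ n) *
        (RtoC (/ INR (fact (S n))) * w ^ S n))%C.
      + apply Cder_plus; [apply IH|].
        apply (Cder_real (fun t => t ^ S n)).
        auto_derive; [exact I|]. rewrite S_INR; destruct n; simpl; ring.
      + unfold P; simpl Csum.
        rewrite Cmult_plus_distr_l; f_equal.
        replace (/ INR (fact n)) with (INR (S n) * / INR (fact (S n))).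
        * rewrite !RtoC_mult, Cpow_S. ring.
        * rewrite fact_simpl, mult_INR. field.
          split; [apply Hf|]. apply not_0_INR; lia. }
  assert (DG : forall n t,
    Cder (fun t => Cexp (RtoC t * - w) * P (S n) t)%C t
      (- w * Cexp (RtoC t * - w) * (RtoC (t ^ n) *
         (RtoC (/ INR (fact n)) * w ^ n)))%C).
  { intros n t.
    replace (- w * _ * _)%C with (- w * Cexp (RtoC t * - w) * P (S n) t +
      Cexp (RtoC t * - w) * (w * P n t))%C.
    - apply Cder_mult; [apply Cder_exp | apply DP].
    - unfold P; simpl Csum; ring. }
  apply Ccv_S_inv.
  apply (Ccv_ext (fun n => Cexp w * (Cexp (- w) * P (S n) 1))%C).
  { intros n. rewrite Cmult_assoc, <- Cexp_plus.
    replace (w + - w)%C with (RtoC 0) by ring. rewrite Cexp_0, Cmult_1_l.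
    unfold P; apply Csum_ext; intros. rewrite pow1; ring. }
  rewrite <- (Cmult_1_r (Cexp w)) at 1. apply Ccv_scal.
  pose (B := Cmod w * exp (Cmod w)).
  apply (Ccv_bound _ _ (fun n => 2 * B * (Cmod w ^ n / INR (fact n)))).
  - intros n.
    replace (Cexp (- w) * P (S n) 1 - RtoC 1)%C with
      (Cexp (RtoC 1 * - w) * P (S n) 1 - Cexp (RtoC 0 * - w) * P (S n) 0)%C.
    2:{ rewrite Cmult_1_l. replace (RtoC 0 * - w)%C with (RtoC 0) by ring.
        rewrite Cexp_0. f_equal. f_equal. rewrite Cmult_1_l.
        unfold P; rewrite Csum_Sl, Csum_0.
        - simpl. rewrite Rinv_1. ring.
        - intros; rewrite pow_i by lia; ring. }
    rewrite Rmult_assoc.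
    apply (Cder_bound (fun t => Cexp (RtoC t * - w) * P (S n) t)%C
      (fun t => - w * Cexp (RtoC t * - w) * (RtoC (t ^ n)%R *
         (RtoC (/ INR (fact n)) * w ^ n)))%C).
    intros t Ht; split; [apply DG|].
    rewrite !Cmod_mult, Cmod_opp, !Cmod_R, Cmod_Cexp, Cmod_pow.
    rewrite (Rabs_pos_eq (/ _)) by (apply Rlt_le, Rinv_0_lt_compat, INR_fact_lt_0).
    rewrite (Rabs_pos_eq (t ^ n)) by (apply pow_le; lra).
    unfold B, Rdiv. rewrite !Rmult_assoc.
    apply Rmult_le_compat_l; [apply Cmod_ge_0|].
    apply Rmult_le_compat; try (apply Rlt_le, exp_pos).
    + apply Rmult_le_pos; [apply pow_le; lra|]. apply Rmult_le_pos;
        [apply Rlt_le, Rinv_0_lt_compat, INR_fact_lt_0 | apply pow_le, Cmod_ge_0].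
    + apply exp_le.
      assert (Q : Rabs (Re (RtoC t * - w)%C) <= Cmod w).
      { eapply Rle_trans; [apply re_le_Cmod|].
        rewrite Cmod_mult, Cmod_opp, Cmod_R, Rabs_pos_eq by lra.
        pose proof (Cmod_ge_0 w); nra. }
      eapply Rle_trans; [apply Rle_abs | exact Q].
    + rewrite <- Rmult_assoc, (Rmult_comm (t ^ n)), Rmult_assoc, Rmult_comm.
      apply Rmult_le_compat_r; [apply Rlt_le, Rinv_0_lt_compat, INR_fact_lt_0|].
      assert (t ^ n <= 1) by (rewrite <- (pow1 n); apply pow_incr; lra).
      pose proof (pow_le (Cmod w) n (Cmod_ge_0 w)). nra.
  - replace (Finite 0) with (Rbar_mult (2 * B) 0) by (simpl; f_equal; ring).
    apply is_lim_seq_scal_l, is_lim_seq_pow_fact.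
Qed.

Lemma bigsum_exp_le x n : 0 <= x ->
  bigsum (fun k => x ^ k / INR (fact k)) n <= exp x.
Proof.
  intros Hx.
  assert (L : is_lim_seq (bigsum (fun k => x ^ k / INR (fact k))) (exp x)).
  { apply is_lim_seq_incr_1.
    apply (is_lim_seq_ext (fun n => sum_n (fun k => scal (pow_n x k) (/ INR (fact k))) n)).
    - intros m; rewrite bigsum_sum_n. apply bigsum_ext; intros.
      rewrite pow_n_pow; reflexivity.
    - apply (is_exp_Reals x). }
  apply (is_lim_seq_incr_compare _ _ L).
  intros m; simpl.
  assert (0 <= x ^ m / INR (fact m)); [|lra].
  apply Rdiv_le_0_compat; [apply pow_le, Hx | apply INR_fact_lt_0].
Qed.

Lemma abs_analytic_exp L z0 r : 0 <= r ->
  abs_analytic (fun z => Cexp (- z * RtoC L)) z0 r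
    (exp (- Re z0 * L) * exp (r * Rabs L)).
Proof.
  intros Hr.
  exists (fun k => Cexp (- z0 * RtoC L) *
            (RtoC (/ INR (fact k)) * RtoC ((- L) ^ k)))%C; split.
  - intros n.
    rewrite (bigsum_ext _ (fun k => exp (- Re z0 * L) *
               ((r * Rabs L) ^ k / INR (fact k)))).
    + rewrite bigsum_scal. apply Rmult_le_compat_l; [apply Rlt_le, exp_pos|].
      apply bigsum_exp_le, Rmult_le_pos; [exact Hr | apply Rabs_pos].
    + intros k _. rewrite !Cmod_mult, Cmod_Cexp, !Cmod_R.
      rewrite <- RPow_abs, Rabs_Ropp, Rabs_pos_eq
        by (apply Rlt_le, Rinv_0_lt_compat, INR_fact_lt_0).
      rewrite Rpow_mult_distr. unfold Rdiv.
      replace (Re (- z0 * RtoC L)%C) with (- Re z0 * L)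
        by (unfold Re; simpl; ring). ring.
  - intros w _.
    replace (- (z0 + w) * RtoC L)%C with (- z0 * RtoC L + - RtoC L * w)%C by ring.
    rewrite Cexp_plus.
    eapply Ccv_ext; [|apply (Ccv_scal _ _ _ (Cexp_series (- RtoC L * w)%C))].
    intros n; cbv beta; rewrite <- Csum_scal. apply Csum_ext; intros k _.
    rewrite Cpow_mult_l, RtoC_pow, RtoC_opp. ring.
Qed.

(** * The zeta function on (-1, oo) *)

Definition npow (n : nat) (z : C) : C := Cexp (- z * RtoC (ln (INR (S n))))%C.

(** [(z-1)] times the trapezoidal error of [x^(-z)] on [[n+1, n+2]]; the factor
    removes the pole that the integral has at [z = 1]. *)
Definition trap_err (n : nat) (z : C) : C :=
  ((z - 1) / 2 * (npow n z + npow (S n) z) +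
   (RtoC (INR (S (S n))) * npow (S n) z - RtoC (INR (S n)) * npow n z))%C.

Lemma npow_0 z : npow 0 z = RtoC 1.
Proof.
  unfold npow; simpl INR; rewrite ln_1.
  replace (- z * RtoC 0)%C with (RtoC 0) by ring. apply Cexp_0.
Qed.

Lemma npow_real n t : npow n (RtoC t) = RtoC (Rpower (INR (S n)) (- t)).
Proof.
  unfold npow. rewrite <- RtoC_opp, <- RtoC_mult, Cexp_RtoC. reflexivity.
Qed.

Lemma Cmod_npow n z : Cmod (npow n z) = Rpower (INR (S n)) (- Re z).
Proof.
  unfold npow; rewrite Cmod_Cexp; unfold Rpower; f_equal.
  unfold Re; simpl; ring.
Qed.

(** The integrals telescope, and the trapezoidal rule halves the first and the
    last term of the sum. *)
Lemma Csum_trap_err n z :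
  Csum (fun i => trap_err i z) n =
  ((z - 1) * (Csum (fun i => npow i z) (S n) - 1 / 2 - npow n z / 2) +
   (RtoC (INR (S n)) * npow n z - 1))%C.
Proof.
  induction n as [|n IH].
  - simpl Csum. rewrite npow_0. simpl INR. field.
  - change (Csum (fun i => trap_err i z) (S n)) with
      (Csum (fun i => trap_err i z) n + trap_err n z)%C.
    rewrite IH. unfold trap_err. simpl Csum. field.
Qed.

(** Coefficients of [k^z * trap_err] as a power series in [z], where
    [k = n + 1] and [l = ln (1 + 1/k)]; the constant term vanishes, and the
    other terms are small because [l (k + 1/2) = 1 + O(1/k^2)]. *)
Definition trap_coef (k l : R) (j : nat) : R :=
  match j with
  | O => 0
  | S O => 1 - l * (k + 1 / 2)
  | S (S j) => (- l) ^ S j / INR (fact (S j)) *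
               (1 / 2 - (k + 1 / 2) * l / INR (S (S j)))
  end.

Lemma trap_coef_series k l z :
  Ccv (Csum (fun j => RtoC (trap_coef k l j) * z ^ j)%C)
    ((z - 1) / 2 * (1 + Cexp (- z * RtoC l)) +
     (RtoC (k + 1) * Cexp (- z * RtoC l) - RtoC k))%C.
Proof.
  pose (e := fun j => (- l) ^ j / INR (fact j)).
  assert (He : Ccv (Csum (fun j => RtoC (e j) * z ^ j)%C) (Cexp (- z * RtoC l))).
  { eapply Ccv_ext; [|apply Cexp_series]. intros n; apply Csum_ext; intros j _.
    replace (- z * RtoC l)%C with (RtoC (- l) * z)%C by (rewrite RtoC_opp; ring).
    unfold e, Rdiv. rewrite Cpow_mult_l, RtoC_mult, RtoC_pow. ring. }
  set (S := Csum (fun j => RtoC (e j) * z ^ j)%C) in He.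
  apply Ccv_S_inv, Ccv_S_inv.
  apply (Ccv_ext (fun n => (z / 2 * S (1 + n)%nat + RtoC (k + 1 / 2) * S (2 + n)%nat)
                           + (z / 2 - RtoC (1 / 2 + k)))%C).
  - intros n. unfold S. clear S He. induction n as [|n IH].
    + simpl. unfold e; simpl.
      rewrite !RtoC_div, !RtoC_minus, !RtoC_mult, !RtoC_plus, !RtoC_opp
        by (try apply R1_neq_R0; try lra).
      rewrite RtoC_div by lra. field.
    + change (Csum (fun j => RtoC (trap_coef k l j) * z ^ j)%C
                (Datatypes.S (Datatypes.S (Datatypes.S n))))
        with (Csum (fun j => RtoC (trap_coef k l j) * z ^ j)%C
                (Datatypes.S (Datatypes.S n)) +
              RtoC (trap_coef k l (Datatypes.S (Datatypes.S n)))
              * z ^ (Datatypes.S (Datatypes.S n)))%C.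
      rewrite <- IH.
      change (1 + Datatypes.S n)%nat with (Datatypes.S (1 + n)).
      change (2 + Datatypes.S n)%nat with (Datatypes.S (2 + n)).
      cbn [Csum].
      replace (trap_coef k l (Datatypes.S (Datatypes.S n))) with
        (1 / 2 * e (1 + n)%nat + (k + 1 / 2) * e (2 + n)%nat).
      * change (1 + n)%nat with (Datatypes.S n).
        change (2 + n)%nat with (Datatypes.S (Datatypes.S n)).
        rewrite !(RtoC_plus (_ * _)), !RtoC_mult, (RtoC_div 1 2) by lra.
        rewrite (Cpow_S z (Datatypes.S n)). field.
      * unfold e, trap_coef. change (1 + n)%nat with (Datatypes.S n).
        change (2 + n)%nat with (Datatypes.S (Datatypes.S n)).
        rewrite (fact_simpl (Datatypes.S n)), mult_INR.
        change ((- l) ^ Datatypes.S (Datatypes.S n)) with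
          (- l * (- l) ^ Datatypes.S n).
        field. split; [apply not_0_INR; lia | apply INR_fact_neq_0].
  - replace ((z - 1) / 2 * (1 + Cexp (- z * RtoC l)) +
     (RtoC (k + 1) * Cexp (- z * RtoC l) - RtoC k))%C with
     ((z / 2 * Cexp (- z * RtoC l) + RtoC (k + 1 / 2) * Cexp (- z * RtoC l))
                           + (z / 2 - RtoC (1 / 2 + k)))%C.
    + apply Ccv_plus; [|apply Ccv_const]. apply Ccv_plus; apply Ccv_scal.
      * apply (Ccv_S _ _ He).
      * apply (Ccv_S (fun n => S (Datatypes.S n))), (Ccv_S _ _ He).
    + rewrite !RtoC_plus, (RtoC_div 1 2) by lra. field.
Qed.

(** The coefficient of [z] and that of [z^2] contain the factor
    [1 - l (k + 1/2)], the following ones the factor [l^2]. *)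
Lemma trap_coef_bound k j : 1 <= k ->
  Rabs (trap_coef k (ln (1 + / k)) (S j)) <= 2 * / k ^ 2 * / INR (fact j).
Proof.
  intros Hk. set (y := / k). set (l := ln (1 + y)).
  assert (Hy : 0 < y <= 1).
  { unfold y; split; [apply Rinv_0_lt_compat; lra|].
    rewrite <- Rinv_1. apply Rinv_le_contravar; lra. }
  assert (Ek : k = / y) by (unfold y; rewrite Rinv_inv; reflexivity).
  replace (/ k ^ 2) with (y ^ 2) by (unfold y; field; lra).
  pose proof (ln_1p_bounds y ltac:(lra)) as [L1 L2]. fold l in L1, L2.
  assert (Hl : 0 <= l <= y) by (split; nra).
  assert (M : Rabs (1 - l * (k + 1 / 2)) <= y ^ 2).
  { apply Rabs_le; split.
    - assert (l * (k + 1 / 2) <= (y - y^2/2 + y^3/3) * (k + 1/2))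
        by (apply Rmult_le_compat_r; lra).
      replace ((y - y^2/2 + y^3/3) * (k + 1/2)) with
        (1 + y^2 / 12 + y^3/6) in H by (rewrite Ek; field; lra). nra.
    - assert ((y - y^2/2) * (k + 1/2) <= l * (k + 1 / 2))
        by (apply Rmult_le_compat_r; lra).
      replace ((y - y^2/2) * (k + 1/2)) with
        (1 - y^2 / 4) in H by (rewrite Ek; field; lra). nra. }
  assert (M2 : 0 <= l * (k + 1 / 2) <= 2).
  { split; [nra|]. apply Rabs_le_between in M. nra. }
  destruct j as [|[|j]].
  - simpl trap_coef. simpl fact. simpl INR. rewrite Rinv_1. nra.
  - simpl trap_coef. simpl fact. simpl INR. rewrite Rinv_1.
    replace (- l * 1 / 1 * (1 / 2 - (k + 1 / 2) * l / (1 + 1))) with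
      (- (l / 2) * (1 - l * (k + 1 / 2))) by field.
    rewrite Rabs_mult, Rabs_Ropp, (Rabs_pos_eq (l / 2)) by lra.
    pose proof (Rabs_pos (1 - l * (k + 1 / 2))). nra.
  - set (m := S (S j)) in *.
    change (trap_coef k l (S m)) with
      ((- l) ^ m / INR (fact m) * (1 / 2 - (k + 1 / 2) * l / INR (S m))).
    assert (F : 0 < / INR (fact m)) by (apply Rinv_0_lt_compat, INR_fact_lt_0).
    unfold Rdiv at 1. rewrite !Rabs_mult, <- RPow_abs, Rabs_Ropp.
    rewrite (Rabs_pos_eq l), (Rabs_pos_eq (/ INR (fact m))) by lra.
    assert (Hm : 3 <= INR (S m)).
    { replace 3 with (INR 3) by (simpl; ring). apply le_INR; lia. }
    assert (P : Rabs (1 / 2 - (k + 1 / 2) * l / INR (S m)) <= 2).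
    { assert (0 <= (k + 1 / 2) * l / INR (S m) <= 2).
      { split; [apply Rdiv_le_0_compat; nra|].
        apply Rmult_le_reg_r with (INR (S m)); [lra|].
        unfold Rdiv; rewrite Rmult_assoc, Rinv_l by lra. nra. }
      apply Rabs_le; lra. }
    assert (Q : l ^ m <= y ^ 2).
    { unfold m. change (l ^ S (S j)) with (l * (l * l ^ j)).
      assert (l ^ j <= 1) by (rewrite <- (pow1 j); apply pow_incr; lra).
      assert (0 <= l ^ j) by (apply pow_le; lra). nra. }
    assert (0 <= l ^ m) by (apply pow_le; lra).
    replace (l ^ m * / INR (fact m) * Rabs (1 / 2 - (k + 1 / 2) * l / INR (S m)))
      with (l ^ m * Rabs (1 / 2 - (k + 1 / 2) * l / INR (S m)) * / INR (fact m))
      by ring.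
    apply Rmult_le_compat_r; [lra|].
    pose proof (Rabs_pos (1 / 2 - (k + 1 / 2) * l / INR (S m))). nra.
Qed.

(** [trap_err] is the sum of the functions [trap_coef j * z^j k^(-z)], whose norms
    add up to [O(k^(-2))] times that of [k^(-z)].  The series of all [trap_err]
    therefore converges where [Re z > -1]. *)
Lemma abs_analytic_trap_err n z0 r : 0 < r ->
  let rho := Cmod z0 + r in
  abs_analytic (trap_err n) z0 r
    (2 * rho * exp rho * Rpower (INR (S n)) (- Re z0 + r - 2)).
Proof.
  intros Hr rho. set (k := INR (S n)).
  assert (Hk : 1 <= k) by (unfold k; replace 1 with (INR 1) by reflexivity;
    apply le_INR; lia).
  assert (Hrho : 0 < rho) by (unfold rho; pose proof (Cmod_ge_0 z0); lra).
  set (l := ln (1 + / k)).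
  pose (P := exp (- Re z0 * ln k) * exp (r * Rabs (ln k))).
  assert (HP : 0 < P) by (apply Rmult_lt_0_compat; apply exp_pos).
  apply (abs_analytic_sum
    (fun j z => RtoC (trap_coef k l j) * (z ^ j * npow n z))%C _ _ _
    (fun j => Rabs (trap_coef k l j) * (rho ^ j * P))); [exact Hr| | |].
  - intros j. rewrite <- Cmod_R.
    apply (abs_analytic_scal (RtoC (trap_coef k l j)) (fun z => z ^ j * npow n z)%C);
      [lra|].
    apply abs_analytic_mult_pow; [lra|].
    apply abs_analytic_exp; lra.
  - intros N.
    replace (2 * rho * exp rho * Rpower k (- Re z0 + r - 2)) with
      (2 * / k ^ 2 * rho * P * exp rho).
    2:{ unfold P. rewrite (Rabs_pos_eq (ln k)).
        2:{ rewrite <- ln_1. apply ln_le; lra. }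
        replace (- Re z0 + r - 2) with (- Re z0 + r + - INR 2) by (simpl; ring).
        rewrite !Rpower_plus, (Rpower_Ropp k (INR 2)), Rpower_pow by lra.
        unfold Rpower. ring. }
    destruct N as [|N].
    { simpl. repeat apply Rmult_le_pos; try lra; try (apply Rlt_le, exp_pos).
      apply Rlt_le, Rinv_0_lt_compat; nra. }
    rewrite bigsum_Sl. simpl trap_coef at 1.
    rewrite Rabs_R0, Rmult_0_l, Rplus_0_l.
    eapply Rle_trans; [|apply Rmult_le_compat_l;
      [|apply (bigsum_exp_le rho N); lra]].
    + rewrite <- bigsum_scal. apply bigsum_le; intros j _.
      replace (2 * / k ^ 2 * rho * P * (rho ^ j / INR (fact j))) with
        (2 * / k ^ 2 * / INR (fact j) * (rho ^ S j * P))
        by (simpl; unfold Rdiv; ring).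
      apply Rmult_le_compat_r.
      * apply Rmult_le_pos; [apply pow_le|]; lra.
      * apply trap_coef_bound, Hk.
    + assert (0 < / k ^ 2) by (apply Rinv_0_lt_compat, pow_lt; lra).
      apply Rmult_le_pos; [apply Rmult_le_pos; [apply Rmult_le_pos|]|]; lra.
  - intros w _. set (z := (z0 + w)%C).
    assert (El : npow (S n) z = (npow n z * Cexp (- z * RtoC l))%C).
    { unfold npow; rewrite <- Cexp_plus. f_equal.
      rewrite <- Cmult_plus_distr_l, <- RtoC_plus. do 2 f_equal.
      rewrite (S_INR (S n)); fold k. unfold l.
      rewrite <- ln_mult; [f_equal; field; lra|lra|].
      assert (0 < / k) by (apply Rinv_0_lt_compat; lra). lra. }
    apply (Ccv_ext (fun N => npow n z *
             Csum (fun j => RtoC (trap_coef k l j) * z ^ j) N)%C).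
    { intros N; rewrite <- Csum_scal. apply Csum_ext; intros; ring. }
    unfold trap_err. rewrite El, (S_INR (S n)). fold k.
    replace (_ + _)%C with (npow n z * ((z - 1) / 2 * (1 + Cexp (- z * RtoC l)) +
     (RtoC (k + 1) * Cexp (- z * RtoC l) - RtoC k)))%C.
    + apply Ccv_scal, trap_coef_series.
    + field.
Qed.

Lemma Ccv_npow_0 a z : a < Re z ->
  Ccv (fun n => RtoC (Rpower (INR (S n)) a) * npow n z)%C (RtoC 0).
Proof.
  intros Ha.
  apply (Ccv_bound _ _ (fun n => Rpower (INR (S n)) (- (Re z - a)))).
  - intros n. replace (_ - RtoC 0)%C with
      (RtoC (Rpower (INR (S n)) a) * npow n z)%C by ring.
    rewrite Cmod_mult, Cmod_npow, Cmod_R, Rabs_pos_eq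
      by (apply Rlt_le, Rpower_pos).
    rewrite <- Rpower_plus. right; f_equal; ring.
  - apply is_lim_seq_Rpower_neg; lra.
Qed.

(** Both sides are analytic on [Re z > -1], [z <> 1], and agree for
    [Re z > 1]; a parabolic arc through the upper half-plane joins 2 to [t]
    while avoiding the pole. *)
Lemma zeta_trap_err zeta t : is_riemann_zeta zeta -> -1 < t -> t <> 1 ->
  Ccv (Csum (fun i => trap_err i (RtoC t)))
    ((RtoC t - 1) * (zeta (RtoC t) - 1 / 2) - 1)%C.
Proof.
  intros [Hz1 Hz2] Ht Ht1.
  pose (G := fun z => epsilon (inhabits (RtoC 0))
                        (fun l => Ccv (Csum (fun i => trap_err i z)) l)).
  assert (HG0 : forall z, (exists l, Ccv (Csum (fun i => trap_err i z)) l) ->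
            Ccv (Csum (fun i => trap_err i z)) (G z)).
  { intros z E. exact (epsilon_spec (inhabits (RtoC 0)) _ E). }
  assert (HGan : forall z0, -1 < Re z0 -> exists r A, 0 < r /\
            (forall w, Cmod w <= r ->
               Ccv (Csum (fun i => trap_err i (z0 + w)%C)) (G (z0 + w)%C)) /\
            abs_analytic G z0 r A).
  { (* Half the distance to the line Re z = -1, so that the norms of the terms on
       the disc decay like n^(-1-d). *)
    intros z0 H0. set (d := (Re z0 + 1) / 2). assert (Hd : 0 < d) by (unfold d; lra).
    set (rho := Cmod z0 + d).
    assert (HC : 0 <= 2 * rho * exp rho).
    { unfold rho; pose proof (Cmod_ge_0 z0).
      repeat apply Rmult_le_pos; try lra. apply Rlt_le, exp_pos. }
    assert (HA : forall n, bigsum (fun n => 2 * rho * exp rho *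
                   Rpower (INR (S n)) (- Re z0 + d - 2)) n
                   <= 2 * rho * exp rho * (1 + / d)).
    { intros n; rewrite bigsum_scal. apply Rmult_le_compat_l; [exact HC|].
      replace (- Re z0 + d - 2) with (- (1 + d)) by (unfold d; field).
      apply bigsum_power_bound, Hd. }
    assert (Hcv : forall w, Cmod w <= d ->
               Ccv (Csum (fun i => trap_err i (z0 + w)%C)) (G (z0 + w)%C)).
    { intros w Hw; apply HG0.
      destruct (Csum_abs_cv (fun i => trap_err i (z0 + w)%C)
                  (2 * rho * exp rho * (1 + / d))) as [l [Hl _]]; [|now exists l].
      intros n; eapply Rle_trans; [|apply (HA n)].
      apply bigsum_le; intros i _.
      destruct (abs_analytic_trap_err i z0 d Hd) as [c [Hc1 Hc2]].
      apply (Ccv_Cmod_le (Csum (fun k => c k * w ^ k)%C)); [|auto].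
      intros K; eapply Rle_trans; [apply Cmod_Csum_le|].
      eapply Rle_trans; [|apply (Hc1 K)]. apply bigsum_le; intros j _.
      rewrite Cmod_mult, Cmod_pow. apply Rmult_le_compat_l; [apply Cmod_ge_0|].
      apply pow_incr; split; [apply Cmod_ge_0 | exact Hw]. }
    exists d, (2 * rho * exp rho * (1 + / d)); split; [exact Hd|].
    split; [exact Hcv|].
    apply (abs_analytic_sum trap_err G z0 d _ _ Hd
             (fun n => abs_analytic_trap_err n z0 d Hd) HA Hcv). }
  assert (HGcv : forall z, -1 < Re z -> Ccv (Csum (fun i => trap_err i z)) (G z)).
  { intros z Hz. destruct (HGan z Hz) as [r [A [Hr [Q _]]]].
    replace z with (z + RtoC 0)%C by ring. apply Q. rewrite Cmod_0; lra. }
  pose (h := fun z => ((z - 1) * (zeta z - 1 / 2) - 1 - G z)%C).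
  assert (Hh1 : forall z, 1 < Re z -> h z = RtoC 0).
  { intros z Hz. unfold h.
    replace (G z) with ((z - 1) * (zeta z - 1 / 2) - 1)%C; [ring|].
    apply (Ccv_unique (Csum (fun i => trap_err i z))); [|apply HGcv; lra].
    eapply Ccv_ext; [intros n; symmetry; apply Csum_trap_err|].
    specialize (Hz2 z Hz). apply is_series_Ccv in Hz2. fold (npow) in Hz2.
    replace ((z - 1) * (zeta z - 1 / 2) - 1)%C with
      ((z - 1) * (zeta z + (- (1 / 2) + (- (1 / 2)) * RtoC 0)) +
        (RtoC 0 + - (1)))%C by ring.
    apply (Ccv_ext (fun n => (z - 1) * (Csum (fun i => npow i z) (S n) +
      (- (1 / 2) + - (1 / 2) * (RtoC (Rpower (INR (S n)) 0) * npow n z))) +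
      (RtoC (Rpower (INR (S n)) 1) * npow n z + - (1)))%C).
    { intros n. rewrite Rpower_O, Rpower_1 by (apply lt_0_INR; lia).
      field. }
    apply Ccv_plus; [apply Ccv_scal, Ccv_plus|apply Ccv_plus].
    - exact (Ccv_S _ _ Hz2).
    - apply Ccv_plus; [apply Ccv_const|]. apply Ccv_scal, Ccv_npow_0; lra.
    - apply Ccv_npow_0; lra.
    - apply Ccv_const. }
  assert (Hh : h (RtoC t) = RtoC 0).
  { destruct (Rlt_le_dec 1 t) as [H1|H1]; [apply Hh1; exact H1|].
    (* The real part runs from 2 to t, and the imaginary part vanishes only at
       the two ends, so the pole is not met. *)
    pose (path := fun u => (2 - u * (2 - t), u * (1 - u)) : C).
    replace (RtoC t) with (path 1) by
      (unfold path; apply injective_projections; simpl; ring).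
    assert (He : 0 < 1 / (2 * (2 - t)) < 1).
    { split; [apply Rdiv_lt_0_compat; lra|].
      apply Rmult_lt_reg_r with (2 * (2 - t)); [lra|].
      unfold Rdiv; rewrite Rmult_assoc, Rinv_l by lra. lra. }
    apply (identity_along_arc h path 6 (1 / (2 * (2 - t)))); [lra|exact He| | | |].
    - intros a b Ha Hb. eapply Rle_trans; [apply Cmod_2Rmax|].
      assert (sqrt 2 <= 2) by (apply Rsqr_incr_0_var;
        [unfold Rsqr; rewrite sqrt_def; lra | lra]).
      pose proof (sqrt_pos 2). pose proof (Rabs_pos (a - b)).
      replace (6 * Rabs (a - b)) with (2 * (3 * Rabs (a - b))) by ring.
      apply Rmult_le_compat; try lra.
      + eapply Rle_trans; [apply Rabs_pos | apply Rmax_l].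
      + apply Rmax_lub; simpl.
        * replace (_ + - _) with ((2 - t) * - (a - b)) by ring.
          rewrite Rabs_mult, Rabs_Ropp, Rabs_pos_eq by lra.
          apply Rmult_le_compat_r; lra.
        * replace (_ + - _) with ((1 - a - b) * (a - b)) by ring.
          rewrite Rabs_mult. apply Rmult_le_compat_r; [lra|].
          apply Rabs_le; lra.
    - unfold path; intros a b E. injection E as E1 E2. nra.
    - intros u Hu.
      assert (Hne : path u <> RtoC 1).
      { unfold path; intros E; injection E as E1 E2.
        assert (u = 0 \/ u = 1) as [->| ->] by nra; nra. }
      assert (Hre : -1 < Re (path u)) by (unfold path; simpl; nra).
      destruct (HGan _ Hre) as [r1 [A1 [Hr1 [_ HA1]]]].
      destruct (analytic_at_abs_analytic _ _ (Hz1 _ Hne)) as [r2 [A2 [Hr2 HA2]]].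
      assert (Shrink : forall F z0 r s A, 0 < s <= r ->
                abs_analytic F z0 r A -> abs_analytic F z0 s A).
      { intros F z0 r s A Hs [c [C1 C2]]; exists c; split.
        - intros n; eapply Rle_trans; [|apply (C1 n)].
          apply bigsum_le; intros; apply Rmult_le_compat_l; [apply Cmod_ge_0|].
          apply pow_incr; lra.
        - intros; apply C2; lra. }
      set (r := Rmin r1 r2). assert (Hr : 0 < r) by (apply Rmin_pos; lra).
      assert (r <= r1) by apply Rmin_l. assert (r <= r2) by apply Rmin_r.
      apply (Shrink _ _ _ r) in HA1; [|lra].
      apply (Shrink _ _ _ r) in HA2; [|lra].
      eexists r, _; split; [exact Hr|].
      apply (abs_analytic_ext (fun z =>
        (z + - (1)) * (zeta z + - (1 / 2)) + (- (1) + - (1) * G z))%C);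
        [intros; unfold h; ring|].
      apply (abs_analytic_plus (fun z => (z + - (1)) * (zeta z + - (1 / 2)))%C
               (fun z => - (1) + - (1) * G z)%C); [lra| |].
      + apply (abs_analytic_mult_linear (- (1))%C
                 (fun z => zeta z + - (1 / 2))%C); [lra|].
        apply (abs_analytic_plus zeta (fun _ => - (1 / 2))%C); [lra|exact HA2|].
        apply abs_analytic_const.
      + apply (abs_analytic_plus (fun _ => - (1))%C (fun z => - (1) * G z)%C);
          [lra|apply abs_analytic_const|].
        apply abs_analytic_scal; [lra|exact HA1].
    - intros u Hu. apply Hh1. unfold path; simpl.
      assert (u * (2 - t) <= 1 / 2); [|lra].
      apply Rle_trans with (1 / (2 * (2 - t)) * (2 - t)).
      + apply Rmult_le_compat_r; lra.
      + right; field; lra. }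
  replace ((RtoC t - 1) * (zeta (RtoC t) - 1 / 2) - 1)%C with (G (RtoC t)).
  - apply HGcv. exact Ht.
  - unfold h in Hh. symmetry. apply Ceq_minus. exact Hh.
Qed.

(** The last term is halved as in the trapezoidal rule; on the circle it belongs
    to the antipodal point, which the two half-circles share. *)
Definition trap_sum (K : nat) (q : R) : R :=
  bigsum (fun i => Rpower (INR (S i)) q) K - Rpower (INR K) q / 2.

(** For real [t] the partial sums of [trap_err] are those of the zeta series,
    corrected by the integral and by half of the last term. *)
Lemma zeta_limit zeta t : is_riemann_zeta zeta -> -1 < t -> t <> 1 ->
  is_lim_seq (fun n => trap_sum (S n) (- t) -
                       Rpower (INR (S n)) (1 - t) / (1 - t))
    (Re (zeta (RtoC t))).
Proof.
  intros Hz Ht Ht1.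
  pose proof (Ccv_Re _ _ (zeta_trap_err zeta t Hz Ht Ht1)) as L.
  apply (is_lim_seq_ext (fun n => / (t - 1) *
    (Re (Csum (fun i => trap_err i (RtoC t)) n) + (1 + (t - 1) / 2)))).
  - intros n. rewrite Csum_trap_err.
    rewrite (Csum_ext _ (fun i => RtoC (Rpower (INR (S i)) (- t))))
      by (intros; apply npow_real).
    rewrite Csum_RtoC, npow_real. unfold trap_sum.
    replace (Rpower (INR (S n)) (1 - t)) with
      (INR (S n) * Rpower (INR (S n)) (- t)).
    2:{ unfold Rminus; rewrite Rpower_plus, Rpower_1 by (apply lt_0_INR; lia).
        reflexivity. }
    set (X := bigsum _ _). set (Y := Rpower _ _). set (k := INR (S n)).
    unfold Cdiv. rewrite <- RtoC_inv by lra.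
    repeat (rewrite <- RtoC_mult || rewrite <- RtoC_minus || rewrite <- RtoC_plus).
    rewrite re_RtoC.
    field. lra.
  - replace (Finite (Re (zeta (RtoC t)))) with (Rbar_mult (/ (t - 1))
     (Rbar_plus (Re ((RtoC t - 1) * (zeta (RtoC t) - 1 / 2) - 1)%C)
        (1 + (t - 1) / 2))).
    + apply is_lim_seq_scal_l.
      apply (is_lim_seq_plus' _ _ _ _ L). apply is_lim_seq_const.
    + replace (Re ((RtoC t - 1) * (zeta (RtoC t) - 1 / 2) - 1)%C) with
        ((t - 1) * (Re (zeta (RtoC t)) - 1 / 2) - 1).
      * simpl. f_equal. field. lra.
      * replace (1 / 2)%C with (RtoC (1 / 2)) by (rewrite RtoC_div; [reflexivity|lra]).
        destruct (zeta (RtoC t)) as [x y]. unfold Re; simpl. ring.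
Qed.

(** * Sums of powers *)

(** Euler-Maclaurin on one unit interval.  Replacing the interval by [[0,h]]
    gives an error whose first two derivatives vanish at [h = 0] and whose
    third is [- h^2 g4 h / 12]. *)
Lemma euler_maclaurin_unit (G g g1 g2 g3 g4 : R -> R) B :
  (forall h, 0 <= h <= 1 -> is_derive G h (g h)) ->
  (forall h, 0 <= h <= 1 -> is_derive g h (g1 h)) ->
  (forall h, 0 <= h <= 1 -> is_derive g1 h (g2 h)) ->
  (forall h, 0 <= h <= 1 -> is_derive g2 h (g3 h)) ->
  (forall h, 0 <= h <= 1 -> is_derive g3 h (g4 h)) ->
  (forall h, 0 <= h <= 1 -> Rabs (g4 h) <= B) ->
  Rabs ((g 0 + g 1) / 2 - (G 1 - G 0) - (g1 1 - g1 0) / 12) <= B / 12.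
Proof.
  intros DG Dg D1 D2 D3 HB.
  assert (HB0 : 0 <= B) by (eapply Rle_trans; [apply Rabs_pos | apply (HB 0); lra]).
  pose (E0 := fun h => h * (g 0 + g h) / 2 - (G h - G 0) - h^2 * (g1 h - g1 0) / 12).
  pose (E1 := fun h => (g 0 - g h) / 2 + h * g1 h / 3 + h * g1 0 / 6 - h^2 * g2 h / 12).
  pose (E2 := fun h => - (g1 h - g1 0) / 6 + h * g2 h / 6 - h^2 * g3 h / 12).
  pose (E3 := fun h => - (h^2 * g4 h) / 12).
  assert (Q2 : forall h, 0 <= h <= 1 -> Rabs (E2 h) <= B / 12).
  { intros h Hh. replace (E2 h) with (E2 h - E2 0) by (unfold E2; field).
    apply Rle_trans with (B / 12 * (h - 0)); [|nra].
    apply (derive_bound E2 E3); [lra| |].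
    - intros x Hx. unfold E2, E3.
      specialize (D1 x ltac:(lra)); specialize (D2 x ltac:(lra));
        specialize (D3 x ltac:(lra)).
      auto_derive; [repeat split; eexists; eassumption|].
      rewrite (is_derive_unique (fun y : R => g1 y) _ _ D1), (is_derive_unique (fun y : R => g2 y) _ _ D2),
        (is_derive_unique (fun y : R => g3 y) _ _ D3). field.
    - intros x Hx. unfold E3. specialize (HB x ltac:(lra)).
      unfold Rdiv; rewrite Rabs_mult, Rabs_Ropp, Rabs_mult.
      rewrite (Rabs_pos_eq (x^2)) by nra. rewrite (Rabs_pos_eq (/ 12)) by lra.
      pose proof (Rabs_pos (g4 x)). assert (0 <= x^2 <= 1) by nra. nra. }
  assert (Q1 : forall h, 0 <= h <= 1 -> Rabs (E1 h) <= B / 12).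
  { intros h Hh. replace (E1 h) with (E1 h - E1 0) by (unfold E1; field).
    apply Rle_trans with (B / 12 * (h - 0)); [|nra].
    apply (derive_bound E1 E2); [lra| |].
    - intros x Hx. unfold E1, E2.
      specialize (Dg x ltac:(lra)); specialize (D1 x ltac:(lra));
        specialize (D2 x ltac:(lra)).
      auto_derive; [repeat split; eexists; eassumption|].
      rewrite (is_derive_unique (fun y : R => g y) _ _ Dg), (is_derive_unique (fun y : R => g1 y) _ _ D1),
        (is_derive_unique (fun y : R => g2 y) _ _ D2). field.
    - intros; apply Q2; lra. }
  replace (_ - _) with (E0 1 - E0 0) by (unfold E0; field).
  replace (B / 12) with (B / 12 * (1 - 0)) by ring.
  apply (derive_bound E0 E1); [lra| |auto].
  intros x Hx. unfold E0, E1.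
  specialize (DG x ltac:(lra)); specialize (Dg x ltac:(lra));
    specialize (D1 x ltac:(lra)).
  auto_derive; [repeat split; eexists; eassumption|].
  rewrite (is_derive_unique (fun y : R => G y) _ _ DG), (is_derive_unique (fun y : R => g y) _ _ Dg),
    (is_derive_unique (fun y : R => g1 y) _ _ D1). field.
Qed.

Lemma is_derive_Rpower_shift a q h : 0 < a + h ->
  is_derive (fun h => Rpower (a + h) q) h (q * Rpower (a + h) (q - 1)).
Proof.
  intros Ha.
  replace (q * _) with (scal 1 (q * Rpower (a + h) (q - 1)))
    by (unfold scal; simpl; unfold mult; simpl; ring).
  apply (is_derive_comp (V := R_NormedModule) (fun x => Rpower x q) (fun h => a + h)).
  - apply is_derive_Rpower, Ha.
  - auto_derive; [exact I | ring].
Qed.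

Lemma is_derive_scal_R c (f : R -> R) x d :
  is_derive f x d -> is_derive (fun x => c * f x) x (c * d).
Proof. intros D. apply (is_derive_scal f x c d D). Qed.

Definition em_err (q a : R) : R :=
  (Rpower a q + Rpower (a + 1) q) / 2
  - (Rpower (a + 1) (q + 1) - Rpower a (q + 1)) / (q + 1)
  - q / 12 * (Rpower (a + 1) (q - 1) - Rpower a (q - 1)).

Definition em_const (q : R) : R := Rabs (q * (q - 1) * (q - 2) * (q - 3)) / 12.

Lemma em_err_bound q a B : 0 < a -> q <> -1 ->
  (forall x, a <= x <= a + 1 -> Rpower x (q - 4) <= B) ->
  Rabs (em_err q a) <= em_const q * B.
Proof.
  intros Ha Hq HB. unfold em_err, em_const.
  replace (_ - _ - _) with
   ((Rpower (a + 0) q + Rpower (a + 1) q) / 2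
    - (/ (q + 1) * Rpower (a + 1) (q + 1) - / (q + 1) * Rpower (a + 0) (q + 1))
    - (q * Rpower (a + 1) (q - 1) - q * Rpower (a + 0) (q - 1)) / 12)
    by (rewrite Rplus_0_r; field; lra).
  replace (Rabs _ / 12 * B) with (Rabs (q * (q - 1) * (q - 2) * (q - 3)) * B / 12)
    by field.
  apply (euler_maclaurin_unit (fun h => / (q + 1) * Rpower (a + h) (q + 1))
    (fun h => Rpower (a + h) q) (fun h => q * Rpower (a + h) (q - 1))
    (fun h => q * (q - 1) * Rpower (a + h) (q - 2))
    (fun h => q * (q - 1) * (q - 2) * Rpower (a + h) (q - 3))
    (fun h => q * (q - 1) * (q - 2) * (q - 3) * Rpower (a + h) (q - 4))); intros h Hh.
  - replace (Rpower (a + h) q) with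
      (/ (q + 1) * ((q + 1) * Rpower (a + h) (q + 1 - 1))).
    + apply is_derive_scal_R, is_derive_Rpower_shift; lra.
    + replace (q + 1 - 1) with q by ring. field; lra.
  - apply is_derive_Rpower_shift; lra.
  - replace (q - 2) with (q - 1 - 1) by ring. rewrite Rmult_assoc.
    apply is_derive_scal_R, is_derive_Rpower_shift; lra.
  - replace (q - 3) with (q - 2 - 1) by ring. rewrite (Rmult_assoc (q * (q - 1))).
    apply is_derive_scal_R, is_derive_Rpower_shift; lra.
  - replace (q - 4) with (q - 3 - 1) by ring.
    rewrite (Rmult_assoc (q * (q - 1) * (q - 2))).
    apply is_derive_scal_R, is_derive_Rpower_shift; lra.
  - rewrite Rabs_mult, (Rabs_pos_eq (Rpower _ _)) by (apply Rlt_le, Rpower_pos).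
    apply Rmult_le_compat_l; [apply Rabs_pos|]. apply HB; lra.
Qed.

(** For [q <= 1] this tends to [zeta(-q)] as [K] grows. *)
Definition em_rest (K : nat) (q : R) : R :=
  trap_sum K q - Rpower (INR K) (q + 1) / (q + 1) - q / 12 * Rpower (INR K) (q - 1).

Lemma em_rest_S K q : q <> -1 ->
  em_rest (S K) q = em_rest K q + em_err q (INR K).
Proof.
  intros Hq. unfold em_rest, trap_sum, em_err.
  cbn [bigsum]. rewrite (S_INR K). field. lra.
Qed.

Lemma em_rest_1 q : q <> -1 -> em_rest 1 q = 1 / 2 - / (q + 1) - q / 12.
Proof.
  intros Hq. unfold em_rest, trap_sum; simpl bigsum; simpl INR.
  rewrite !Rpower_base1. field. lra.
Qed.

Lemma em_rest_add K q n : q <> -1 ->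
  em_rest (K + n) q = em_rest K q + bigsum (fun i => em_err q (INR (K + i))) n.
Proof.
  intros Hq; induction n as [|n IH].
  - rewrite Nat.add_0_r; simpl; ring.
  - rewrite Nat.add_succ_r, em_rest_S, IH by assumption. simpl; ring.
Qed.

Lemma Rpower_m2 x : 0 < x -> Rpower x (- (2)) = / x ^ 2.
Proof.
  intros Hx. replace 2 with (INR 2) by (simpl; ring).
  rewrite Rpower_Ropp, Rpower_pow by assumption. reflexivity.
Qed.

Lemma bigsum_inv_sq_shift K n : (0 < K)%nat ->
  bigsum (fun i => / INR (K + i) ^ 2) n <= 2.
Proof.
  intros HK. eapply Rle_trans; [|apply (bigsum_inv_sq_le2 n)].
  apply bigsum_le; intros i _. apply Rinv_le_contravar.
  - apply pow_lt, lt_0_INR; lia.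
  - apply pow_incr; split; [apply pos_INR|]. apply le_INR; lia.
Qed.

Lemma em_const_nonneg q : 0 <= em_const q.
Proof. unfold em_const; apply Rdiv_le_0_compat; [apply Rabs_pos | lra]. Qed.

Lemma INR_ge1 K : (0 < K)%nat -> 1 <= INR K.
Proof. intros HK. replace 1 with (INR 1) by reflexivity. apply le_INR; lia. Qed.

Lemma em_err_sum_bound K n q M : (0 < K)%nat -> q <> -1 ->
  (forall x, INR K <= x <= INR (K + n) -> Rpower x (q - 2) <= M) ->
  Rabs (bigsum (fun i => em_err q (INR (K + i))) n) <= 2 * em_const q * M.
Proof.
  intros HK Hq HM.
  pose proof (em_const_nonneg q) as HC. pose proof (INR_ge1 K HK) as HK1.
  assert (HM0 : 0 <= M).
  { eapply Rle_trans; [apply Rlt_le, (Rpower_pos (INR K) (q - 2))|].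
    apply HM; split; [lra|]. apply le_INR; lia. }
  eapply Rle_trans; [apply bigsum_Rabs|].
  apply Rle_trans with (em_const q * M * bigsum (fun i => / INR (K + i) ^ 2) n).
  - rewrite <- bigsum_scal. apply bigsum_le; intros i Hi.
    pose proof (INR_ge1 (K + i) ltac:(lia)) as Hx.
    rewrite (Rmult_assoc (em_const q)).
    apply em_err_bound; [lra|exact Hq|].
    intros x Hx'. replace (q - 4) with (q - 2 + - (2)) by ring.
    rewrite Rpower_plus, Rpower_m2 by lra.
    apply Rmult_le_compat; [apply Rlt_le, Rpower_pos| | |].
    + apply Rlt_le, Rinv_0_lt_compat, pow_lt; lra.
    + apply HM; split.
      * apply Rle_trans with (INR (K + i)); [apply le_INR; lia | lra].
      * rewrite <- S_INR in Hx'. eapply Rle_trans; [apply Hx'|].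
        apply le_INR; lia.
    + apply Rinv_le_contravar; [apply pow_lt; lra|]. apply pow_incr; lra.
  - pose proof (bigsum_inv_sq_shift K n HK).
    assert (0 <= em_const q * M) by (apply Rmult_le_pos; assumption). nra.
Qed.

(** The error committed on [[k, k+1]] is of order [k^(q-4)], which is at most
    [K^(q-1-d) / k^2] when [k <= K]. *)
Lemma em_rest_growing K q d : (0 < K)%nat -> 0 < d <= 1 -> 1 + d <= q ->
  Rabs (em_rest K q) <= (1 + q + 2 * em_const q) * Rpower (INR K) (q - 1 - d).
Proof.
  intros HK Hd Hq.
  pose proof (em_const_nonneg q) as HC. pose proof (INR_ge1 K HK) as HK1.
  assert (P1 : 1 <= Rpower (INR K) (q - 1 - d)).
  { apply Rpower_ge1; lra. }
  replace (em_rest K q) with (em_rest (1 + (K - 1)) q) by (f_equal; lia).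
  rewrite em_rest_add by lra.
  eapply Rle_trans; [apply Rabs_triang|].
  rewrite Rmult_plus_distr_r. apply Rplus_le_compat.
  - rewrite em_rest_1 by lra.
    assert (0 < / (q + 1) <= 1).
    { split; [apply Rinv_0_lt_compat; lra|].
      apply Rle_trans with (/ 1); [|rewrite Rinv_1; lra].
      apply Rinv_le_contravar; lra. }
    apply Rle_trans with (1 + q); [apply Rabs_le; lra | nra].
  - apply em_err_sum_bound; [lia|lra|].
    intros x Hx. replace (1 + (K - 1))%nat with K in Hx by lia. simpl in Hx.
    replace (q - 2) with (q - 1 - d + (d - 1)) by ring.
    rewrite Rpower_plus. replace (Rpower (INR K) (q - 1 - d)) with (Rpower (INR K) (q - 1 - d) * 1) by ring.
    apply Rmult_le_compat; try (apply Rlt_le, Rpower_pos).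
    + apply Rpower_le_base; lra.
    + apply Rpower_le1; lra.
Qed.

(** The errors committed beyond [K] are of order [k^(q-4)], which is at most
    [K^(q-2) / k^2] when [k >= K]. *)
Lemma em_rest_limit K q (Z : R) : (0 < K)%nat -> q <= 1 -> q <> -1 ->
  is_lim_seq (fun n => em_rest (S n) q) Z ->
  Rabs (em_rest K q - Z) <= 2 * em_const q * Rpower (INR K) (q - 2).
Proof.
  intros HK Hq Hq1 HZ.
  pose proof (INR_ge1 K HK) as HK1.
  rewrite Rabs_minus_sym.
  apply (is_lim_seq_le (fun n => Rabs (em_rest (K + n) q - em_rest K q))
    (fun _ => 2 * em_const q * Rpower (INR K) (q - 2)) (Rabs (Z - em_rest K q))
    (2 * em_const q * Rpower (INR K) (q - 2))).
  - intros n. rewrite em_rest_add by assumption.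
    replace (_ + _ - _) with (bigsum (fun i => em_err q (INR (K + i))) n) by ring.
    apply em_err_sum_bound; [assumption..|].
    intros x Hx. apply Rpower_le_base_neg; lra.
  - apply (is_lim_seq_abs _ (Finite (Z - em_rest K q))).
    apply is_lim_seq_minus'; [|apply is_lim_seq_const].
    apply (is_lim_seq_incr_n _ (K - 1)) in HZ.
    eapply is_lim_seq_ext; [|exact HZ]. intros n; cbv beta; f_equal; lia.
  - apply is_lim_seq_const.
Qed.

Lemma abs_analytic_lipschitz F z0 r A w : 0 < r -> Cmod w <= r ->
  abs_analytic F z0 r A -> Cmod (F (z0 + w)%C - F z0) <= Cmod w / r * A.
Proof.
  intros Hr Hw [c [HA HF]].
  assert (E0 : F z0 = c O).
  { replace (F z0) with (F (z0 + RtoC 0)%C) by (f_equal; ring).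
    apply (Ccv_unique (Csum (fun k => c k * RtoC 0 ^ k)%C)).
    - apply HF; rewrite Cmod_0; lra.
    - apply Ccv_S_inv. apply (Ccv_ext (fun _ => c O)); [|apply Ccv_const].
      intros n; rewrite Csum_Sl, Csum_0; [simpl; ring|].
      intros; rewrite Cpow_S; ring. }
  apply (Ccv_Cmod_le (fun n => Csum (fun k => c k * w ^ k) (S n) + - c O)%C).
  - intros n. rewrite Csum_Sl.
    replace (c O * w ^ 0 + _ + - c O)%C with
      (Csum (fun i => c (S i) * w ^ S i) n)%C by (simpl; ring).
    eapply Rle_trans; [apply Cmod_Csum_le|].
    assert (0 <= Cmod w / r) by (apply Rdiv_le_0_compat; [apply Cmod_ge_0|lra]).
    eapply Rle_trans; [|apply Rmult_le_compat_l; [assumption|apply (HA (S n))]].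
    rewrite bigsum_Sl, Rmult_plus_distr_l, <- bigsum_scal.
    pose proof (Cmod_ge_0 (c O)).
    assert (0 <= Cmod w / r * (Cmod (c O) * r ^ 0)) by (simpl; nra).
    match goal with |- ?x <= _ + ?y => assert (x <= y); [|lra] end.
    apply bigsum_le; intros i _. rewrite Cmod_mult, Cmod_pow.
    replace (Cmod w / r * (Cmod (c (S i)) * r ^ S i)) with
      (Cmod (c (S i)) * (Cmod w * r ^ i)) by (simpl; field; lra).
    apply Rmult_le_compat_l; [apply Cmod_ge_0|]. simpl.
    apply Rmult_le_compat_l; [apply Cmod_ge_0|].
    apply pow_incr; split; [apply Cmod_ge_0 | exact Hw].
  - rewrite E0. apply Ccv_plus; [|apply Ccv_const].
    apply (Ccv_S _ _ (HF w Hw)).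
Qed.

Lemma em_rest_zeta_open zeta t : is_riemann_zeta zeta -> -1 < t -> t <> 1 ->
  is_lim_seq (fun n => em_rest (S n) (- t)) (Re (zeta (RtoC t))).
Proof.
  intros Hz Ht Ht1.
  replace (Finite (Re (zeta (RtoC t)))) with
    (Finite (Re (zeta (RtoC t)) - - t / 12 * 0)) by (f_equal; ring).
  apply (is_lim_seq_ext (fun n => (trap_sum (S n) (- t) -
            Rpower (INR (S n)) (1 - t) / (1 - t)) -
            - t / 12 * Rpower (INR (S n)) (- (t + 1)))).
  - intros n. unfold em_rest.
    replace (- t + 1) with (1 - t) by ring.
    replace (- t - 1) with (- (t + 1)) by ring. reflexivity.
  - apply is_lim_seq_minus'; [now apply zeta_limit|].
    apply (is_lim_seq_scal_l _ (- t / 12) (Finite 0)), is_lim_seq_Rpower_neg; lra.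
Qed.

(** The error terms of [em_rest _ q] carry the factor [q - 1], so letting [q]
    tend to 1 only the first term of the expansion survives. *)
Lemma zeta_minus_one zeta : is_riemann_zeta zeta ->
  Re (zeta (RtoC (-1))) = - (1 / 12).
Proof.
  intros Hz.
  assert (Hne : RtoC (-1) <> RtoC 1) by (intros E; apply RtoC_inj in E; lra).
  destruct (analytic_at_abs_analytic _ _ (proj1 Hz _ Hne)) as [r [A [Hr HA]]].
  assert (HA0 : 0 <= A) by (destruct HA as [c [Hc _]]; apply (Hc O)).
  assert (B : forall e, 0 < e <= Rmin r (1 / 2) ->
    Rabs (Re (zeta (RtoC (-1))) - - (1 / 12)) <= e * (A / r + 2)).
  { intros e [He1 He2].
    assert (He3 : e <= r) by (eapply Rle_trans; [exact He2|apply Rmin_l]).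
    assert (He4 : e <= 1 / 2) by (eapply Rle_trans; [exact He2|apply Rmin_r]).
    assert (L1 : Rabs (Re (zeta (RtoC (-1 + e))) - Re (zeta (RtoC (-1)))) <= e / r * A).
    { rewrite RtoC_plus.
      pose proof (abs_analytic_lipschitz zeta (RtoC (-1)) r A (RtoC e) Hr) as Q.
      rewrite Cmod_R, Rabs_pos_eq in Q by lra. specialize (Q ltac:(lra) HA).
      eapply Rle_trans; [|exact Q]. eapply Rle_trans; [|apply re_le_Cmod].
      right; f_equal. }
    assert (L2 := em_rest_limit 1 (- (-1 + e)) _ ltac:(lia) ltac:(lra) ltac:(lra)
                    (em_rest_zeta_open zeta (-1 + e) Hz ltac:(lra) ltac:(lra))).
    rewrite em_rest_1 in L2 by lra. simpl INR in L2. rewrite Rpower_base1 in L2.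
    set (q := - (-1 + e)) in *.
    assert (L3 : em_const q <= e / 2).
    { unfold em_const. replace (q * (q - 1) * (q - 2) * (q - 3)) with
        (- (e * ((1 - e) * (1 + e) * (2 + e)))) by (unfold q; ring).
      assert (0 <= (1 - e) * (1 + e) * (2 + e) <= 6) by (split; nra).
      rewrite Rabs_Ropp, Rabs_pos_eq by nra. nra. }
    assert (L4 : Rabs (1 / 2 - / (q + 1) - q / 12 - - (1 / 12)) <= e).
    { replace (1 / 2 - / (q + 1) - q / 12 - - (1 / 12)) with
        (e * (1 / 12 - / (2 * (2 - e)))) by (unfold q; field; lra).
      rewrite Rabs_mult, (Rabs_pos_eq e) by lra.
      assert (0 < / (2 * (2 - e)) <= 1).
      { split; [apply Rinv_0_lt_compat; lra|].
        apply Rle_trans with (/ 1); [|rewrite Rinv_1; lra].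
        apply Rinv_le_contravar; lra. }
      assert (Rabs (1 / 12 - / (2 * (2 - e))) <= 1) by (apply Rabs_le; lra).
      nra. }
    replace (e * (A / r + 2)) with (e / r * A + e + e) by (field; lra).
    apply Rabs_le_between in L1; apply Rabs_le_between in L2;
      apply Rabs_le_between in L4. apply Rabs_le; lra. }
  apply Rminus_diag_uniq.
  set (x := Re (zeta (RtoC (-1))) - - (1 / 12)) in *.
  destruct (Req_dec x 0) as [E|E]; [exact E|exfalso].
  apply Rabs_pos_lt in E.
  assert (0 <= A / r) by (apply Rdiv_le_0_compat; lra).
  set (e := Rmin (Rmin r (1 / 2)) (Rabs x / (2 * (A / r + 2)))).
  assert (He : 0 < e) by (repeat apply Rmin_pos; try lra;
    apply Rdiv_lt_0_compat; lra).
  assert (He1 : e <= Rmin r (1 / 2)) by apply Rmin_l.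
  assert (He2 : e <= Rabs x / (2 * (A / r + 2))) by apply Rmin_r.
  specialize (B e (conj He He1)).
  apply (Rmult_le_compat_r (A / r + 2)) in He2; [|lra].
  replace (Rabs x / (2 * (A / r + 2)) * (A / r + 2)) with (Rabs x / 2) in He2
    by (field; lra).
  lra.
Qed.

(** At [t = -1] the errors vanish identically and the limit is [-1/12]. *)
Lemma em_rest_zeta zeta t : is_riemann_zeta zeta -> -1 <= t -> t <> 1 ->
  is_lim_seq (fun n => em_rest (S n) (- t)) (Re (zeta (RtoC t))).
Proof.
  intros Hz [Ht|<-] Ht1; [now apply em_rest_zeta_open|].
  rewrite zeta_minus_one by assumption.
  apply (is_lim_seq_ext (fun _ => - (1 / 12))); [|apply is_lim_seq_const].
  intros n. replace (S n) with (1 + n)%nat by lia.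
  rewrite em_rest_add, em_rest_1 by lra.
  replace (bigsum _ n) with 0; [field|].
  symmetry; apply bigsum_0; intros i _.
  assert (Q : Rabs (em_err (- -1) (INR (1 + i))) <= em_const (- -1) *
            Rpower (INR (1 + i)) (- -1 - 4)).
  { apply em_err_bound; [apply lt_0_INR; lia | lra|].
    intros x Hx. apply Rpower_le_base_neg; [lra|]. split; [apply lt_0_INR; lia|lra]. }
  unfold em_const in Q.
  replace (- -1 * (- -1 - 1) * (- -1 - 2) * (- -1 - 3)) with 0 in Q by ring.
  rewrite Rabs_R0 in Q. unfold Rdiv in Q. rewrite !Rmult_0_l in Q.
  pose proof (Rabs_pos (em_err (- -1) (INR (1 + i)))).
  destruct (Req_dec (em_err (- -1) (INR (1 + i))) 0) as [|N]; [assumption|].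
  apply Rabs_pos_lt in N. lra.
Qed.

(** * Powers of sinc as power series *)

Definition sinc (x : R) : R := sin (PI * x) / (PI * x).

(** The power series is taken in the variable [x^2], as [sinc] is even. *)
Definition sinc_power_series (s : R) (b : nat -> R) : Prop :=
  Rbar_le 1 (CV_radius b) /\
  forall x, 0 < x < 1 -> PSeries b (x ^ 2) = Rpower (sinc x) (- s).

Lemma sinc_pos x : 0 < x < 1 -> 0 < sinc x.
Proof.
  intros Hx. pose proof PI_RGT_0.
  apply Rdiv_lt_0_compat; [apply sin_gt_0|]; nra.
Qed.

Lemma is_series_bigsum a l : is_series a l <-> is_lim_seq (bigsum a) l.
Proof.
  unfold is_series. split; intros L.
  - apply is_lim_seq_incr_1. eapply is_lim_seq_ext; [|exact L].
    intros n; apply bigsum_sum_n.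
  - apply is_lim_seq_incr_1 in L.
    assert (is_lim_seq (sum_n a) l) by (eapply is_lim_seq_ext; [|exact L];
      intros n; symmetry; apply bigsum_sum_n).
    assumption.
Qed.

Lemma is_pseries_bigsum a x l :
  is_pseries a x l <-> is_lim_seq (bigsum (fun k => a k * x ^ k)) l.
Proof.
  rewrite is_pseries_R. apply is_series_bigsum.
Qed.

Lemma CV_radius_ge a x : 0 <= x -> ex_pseries a x -> Rbar_le x (CV_radius a).
Proof.
  intros Hx [l Hl].
  destruct (CV_radius_bounded a) as [Hub _]. apply Hub.
  assert (L : is_lim_seq (fun n => a n * x ^ n) 0).
  { apply ex_series_lim_0. exists l. now apply is_pseries_R. }
  destruct (filterlim_bounded (K := R_AbsRing) (V := R_NormedModule)
              (fun n => a n * x ^ n)) as [M HM].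
  - exists 0; exact L.
  - exists M; exact HM.
Qed.

Lemma radius_ge_1 b : (forall r, 0 < r < 1 -> ex_pseries b r) ->
  Rbar_le 1 (CV_radius b).
Proof.
  intros E.
  assert (R : forall r, 0 < r < 1 -> Rbar_le r (CV_radius b))
    by (intros; apply CV_radius_ge; [lra | auto]).
  destruct (CV_radius b) as [c| |] eqn:Ec; simpl.
  - apply le_epsilon; intros eps Heps.
    destruct (Rle_lt_dec 1 eps).
    + pose proof (R (1 / 2) ltac:(lra)) as Q; simpl in Q; lra.
    + pose proof (R (1 - eps) ltac:(lra)) as Q; simpl in Q; lra.
  - exact I.
  - exact (R (1 / 2) ltac:(lra)).
Qed.

Lemma CV_radius_dominated a b C :
  (forall n, Rabs (b n) <= C * Rabs (a n)) ->
  Rbar_le (CV_radius a) (CV_radius b).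
Proof.
  intros Hab.
  destruct (CV_radius_bounded a) as [_ Ha].
  destruct (CV_radius_bounded b) as [Hb _].
  apply Ha. intros r [M HM]. apply Hb. exists (Rabs C * M). intros n.
  rewrite Rabs_mult.
  eapply Rle_trans; [apply Rmult_le_compat_r; [apply Rabs_pos | apply Hab]|].
  rewrite Rmult_assoc, <- Rabs_mult.
  apply Rle_trans with (Rabs C * Rabs (a n * r ^ n)).
  - apply Rmult_le_compat_r; [apply Rabs_pos | apply Rle_abs].
  - apply Rmult_le_compat_l; [apply Rabs_pos | apply HM].
Qed.

(** A linear factor in the coefficients amounts to one differentiation. *)
Lemma CV_radius_linear a b C :
  (forall n, Rabs (b n) <= C * (INR n + 1) * Rabs (a n)) ->
  Rbar_le (CV_radius a) (CV_radius b).
Proof.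
  intros Hab. rewrite <- (CV_radius_incr_1 a), <- CV_radius_derive.
  apply (CV_radius_dominated _ _ C). intros n.
  unfold PS_derive, PS_incr_1.
  rewrite Rabs_mult, (Rabs_pos_eq (INR (S n))) by apply pos_INR.
  rewrite S_INR, <- Rmult_assoc. apply Hab.
Qed.

Lemma Rbar_lt_radius b y : Rbar_le 1 (CV_radius b) -> Rabs y < 1 ->
  Rbar_lt (Rabs y) (CV_radius b).
Proof. intros Hb Hy. eapply Rbar_lt_le_trans; [|exact Hb]. exact Hy. Qed.

Lemma PSeries_abs_bound b y : Rbar_le 1 (CV_radius b) -> 0 <= y < 1 ->
  exists M, forall n, bigsum (fun j => Rabs (b j) * y ^ j) n <= M.
Proof.
  intros Hb Hy.
  destruct (CV_disk_inside b y) as [M HM].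
  { apply Rbar_lt_radius; [exact Hb|]. rewrite Rabs_pos_eq; lra. }
  exists M. intros n. apply is_series_bigsum in HM.
  rewrite (bigsum_ext _ (fun j => Rabs (b j * y ^ j))).
  - apply (is_lim_seq_incr_compare _ _ HM). intros k; simpl.
    pose proof (Rabs_pos (b k * y ^ k)); lra.
  - intros i _. rewrite Rabs_mult, (Rabs_pos_eq (y ^ i)) by (apply pow_le; lra).
    reflexivity.
Qed.

(** Termwise differentiation of a series with the real exponents [2j + p]: the
    factor [x^p] is taken out, and the rest is a power series in [x^2]. *)
Lemma is_derive_power_PSeries c p x :
  Rbar_le 1 (CV_radius c) -> 0 < x < 1 ->
  is_derive (fun x => Rpower x p * PSeries c (x ^ 2)) x
    (Rpower x (p - 1) * PSeries (fun j => (2 * INR j + p) * c j) (x ^ 2)).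
Proof.
  intros Hc Hx.
  assert (Hy : Rabs (x ^ 2) < 1) by (rewrite Rabs_pos_eq; nra).
  assert (Hr := Rbar_lt_radius c (x ^ 2) Hc Hy).
  assert (E : PSeries (fun j => (2 * INR j + p) * c j) (x ^ 2) =
              p * PSeries c (x ^ 2) + 2 * (x ^ 2 * PSeries (PS_derive c) (x ^ 2))).
  { apply is_pseries_unique.
    assert (P1 : is_pseries (PS_scal p c) (x ^ 2) (p * PSeries c (x ^ 2))).
    { apply (is_pseries_scal (K := R_AbsRing) (V := R_NormedModule));
        [apply Rmult_comm|]. apply PSeries_correct, CV_radius_inside, Hr. }
    assert (P2 : is_pseries (PS_scal 2 (PS_incr_1 (PS_derive c))) (x ^ 2)
                   (2 * (x ^ 2 * PSeries (PS_derive c) (x ^ 2)))).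
    { apply (is_pseries_scal (K := R_AbsRing) (V := R_NormedModule));
        [apply Rmult_comm|].
      apply (is_pseries_incr_1 (K := R_AbsRing) (V := R_NormedModule)).
      apply PSeries_correct, CV_radius_inside. rewrite CV_radius_derive. exact Hr. }
    eapply is_pseries_ext; [|apply (is_pseries_plus _ _ _ _ _ P1 P2)].
    intros [|n]; unfold PS_plus, PS_scal, PS_incr_1, PS_derive, scal, plus;
      simpl; unfold mult; simpl; try ring. unfold zero; simpl; ring. }
  rewrite E.
  assert (D1 := is_derive_Rpower x p ltac:(lra)).
  assert (D2 : is_derive (fun x => PSeries c (x ^ 2)) x
                 (2 * x * PSeries (PS_derive c) (x ^ 2))).
  { apply (is_derive_comp (V := R_NormedModule) (PSeries c) (fun x => x ^ 2)).
    - apply is_derive_PSeries, Hr.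
    - auto_derive; [exact I|ring]. }
  replace (Rpower x (p - 1) * _) with
    (p * Rpower x (p - 1) * PSeries c (x ^ 2) +
     Rpower x p * (2 * x * PSeries (PS_derive c) (x ^ 2))).
  - apply (is_derive_mult (K := R_AbsRing) (fun x => Rpower x p)
             (fun x => PSeries c (x ^ 2))); [exact D1|exact D2|].
    intros; apply Rmult_comm.
  - replace (Rpower x p) with (Rpower x (p - 1) * x).
    + ring.
    + rewrite <- (Rpower_1 x) at 2 by lra. rewrite <- Rpower_plus.
      f_equal; ring.
Qed.

Lemma Csin_RtoC x : Csin (RtoC x) = RtoC (sin x).
Proof.
  unfold Csin.
  replace (Cexp (Ci * RtoC x) - Cexp (- (Ci * RtoC x)))%C with
    ((RtoC 2 * Ci) * RtoC (sin x))%C.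
  - field. exact Ci_nz.
  - unfold Cexp, Ci; apply injective_projections; simpl;
      repeat (rewrite ?Rmult_0_l, ?Rmult_0_r, ?Rmult_1_l, ?Rminus_0_r, ?Ropp_0,
        ?Rplus_0_l, ?Rplus_0_r, ?exp_0, ?cos_neg, ?sin_neg, ?Rminus_diag); try ring.
Qed.

(** On the real segment the logarithm is real: its imaginary part takes only
    values at which sine vanishes and cosine is positive, and it starts at 0. *)
Lemma log_sinc_real L x : is_log_sinc L -> 0 < x < 1 ->
  L (RtoC x) = RtoC (ln (sinc x)).
Proof.
  intros [Lc [L0 Le]] Hx.
  assert (Q : forall y, 0 < y < 1 ->
            exp (Re (L (RtoC y))) * cos (Im (L (RtoC y))) = sinc y /\
            sin (Im (L (RtoC y))) = 0).
  { intros y Hy.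
    assert (Hn : RtoC y <> RtoC 0) by (intros E; apply RtoC_inj in E; lra).
    assert (HC : Cmod (RtoC y) < 1) by (rewrite Cmod_R, Rabs_pos_eq; lra).
    specialize (Le _ HC Hn).
    rewrite <- RtoC_mult, Csin_RtoC, <- RtoC_div in Le.
    2:{ pose proof PI_RGT_0; nra. }
    fold (sinc y) in Le. unfold Cexp in Le. injection Le as E1 E2.
    split; [exact E1|].
    pose proof (exp_pos (Re (L (RtoC y)))). nra. }
  assert (Hpos : forall y, 0 < y < 1 -> 0 < cos (Im (L (RtoC y)))).
  { intros y Hy. destruct (Q y Hy) as [E _]. pose proof (sinc_pos y Hy).
    pose proof (exp_pos (Re (L (RtoC y)))).
    destruct (Rlt_le_dec 0 (cos (Im (L (RtoC y))))); [assumption|nra]. }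
  assert (HIm : Im (L (RtoC x)) = 0).
  { destruct (Req_dec (Im (L (RtoC x))) 0) as [E|E]; [exact E|exfalso].
    set (g := fun y => Im (L (RtoC y)) ^ 2 - (PI / 2) ^ 2).
    pose proof PI_RGT_0 as HPI.
    assert (Cg : forall y, 0 <= y <= x -> continuity_pt g y).
    { intros y Hy. apply continuity_pt_minus; [|apply continuity_pt_const;
        unfold constant; reflexivity].
      assert (Ci : continuity_pt (fun y => Im (L (RtoC y))) y).
      { apply continuity_pt_filterlim.
        apply (continuous_comp (fun y => RtoC y) (fun z => Im (L z))).
        - intros P [eps HP]. exists eps. intros u Hu. apply HP.
          split; [exact Hu | apply ball_center].
        - apply (continuous_comp L (fun z => snd z)).
          + apply Lc. rewrite Cmod_R, Rabs_pos_eq; lra.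
          + apply continuous_snd. }
      apply continuity_pt_mult; [exact Ci|].
      apply continuity_pt_mult; [exact Ci|].
      apply continuity_pt_const; unfold constant; reflexivity. }
    destruct (IVT_interv g 0 x Cg) as [z [Hz Ez]].
    - lra.
    - unfold g. rewrite L0. simpl. nra.
    - destruct (Q x Hx) as [_ Sx]. unfold g.
      assert (PI <= Rabs (Im (L (RtoC x)))).
      { destruct (Rle_lt_dec PI (Rabs (Im (L (RtoC x))))) as [|Hlt];
          [assumption|exfalso].
        set (u := Im (L (RtoC x))) in *.
        destruct (Rlt_le_dec 0 u).
        - rewrite Rabs_pos_eq in Hlt by lra.
          pose proof (sin_gt_0 u). lra.
        - rewrite Rabs_left1 in Hlt by lra.
          pose proof (sin_gt_0 (- u)). rewrite sin_neg in *. lra. }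
      rewrite <- (pow2_abs (Im (L (RtoC x)))). nra.
    - unfold g in Ez.
      assert (Hz0 : z <> 0) by (intros ->; rewrite L0 in Ez; simpl in Ez; nra).
      specialize (Hpos z ltac:(lra)). set (u := Im (L (RtoC z))) in *.
      assert (u = PI / 2 \/ u = - (PI / 2)) as [E1|E1].
      { assert (F : (u - PI / 2) * (u + PI / 2) = 0) by nra.
        apply Rmult_integral in F. destruct F; [left|right]; lra. }
      + rewrite E1, cos_PI2 in Hpos; lra.
      + rewrite E1, cos_neg, cos_PI2 in Hpos; lra. }
  destruct (Q x Hx) as [E _]. rewrite HIm, cos_0, Rmult_1_r in E.
  apply injective_projections; [|exact HIm].
  simpl. rewrite <- E, ln_exp. reflexivity.
Qed.

Lemma sinc_coeffs_power_series s beta :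
  is_sinc_coeffs s beta -> sinc_power_series s beta.
Proof.
  intros [L [HL Hb]].
  assert (P : forall x, 0 < x < 1 ->
            is_pseries beta (x ^ 2) (Rpower (sinc x) (- s))).
  { intros x Hx.
    assert (HC : Cmod (RtoC x) < 1) by (rewrite Cmod_R, Rabs_pos_eq; lra).
    specialize (Hb _ HC). apply is_series_Ccv, Ccv_Re in Hb.
    rewrite (log_sinc_real L x HL Hx), <- RtoC_opp, <- RtoC_mult, Cexp_RtoC,
      re_RtoC in Hb.
    apply is_pseries_bigsum. eapply is_lim_seq_ext; [|exact Hb].
    intros n; cbv beta.
    rewrite (Csum_ext _ (fun k => RtoC (beta k * (x ^ 2) ^ k))).
    - rewrite Csum_RtoC. apply re_RtoC.
    - intros k _. rewrite RtoC_mult, <- pow_mult, RtoC_pow. reflexivity. }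
  split; [|intros; apply is_pseries_unique; auto].
  apply radius_ge_1. intros r Hr.
  replace r with (sqrt r ^ 2) by (rewrite pow2_sqrt; lra).
  eexists; apply P. split; [apply sqrt_lt_R0; lra|].
  rewrite <- sqrt_1. apply sqrt_lt_1; lra.
Qed.

(** * Asymptotics of the potential of the roots of unity *)

(** The potential at a root of unity of order [M] of all the other ones. *)
Definition root_sum (s : R) (M : nat) : R :=
  bigsum (fun i => Rpower (2 * sin (PI * INR (S i) / INR M)) (- s)) (M - 1).

Ltac at_type_R := match goal with |- @eq _ ?x ?y => change (@eq R x y) end.

Definition not_odd (s : R) : Prop := forall j : nat, 2 * INR j + 1 - s <> 0.

(** Coefficients of the termwise antiderivative of [x^(-s) (b_0 + b_1 x^2 + ...)],
    in which no logarithm occurs unless [s] is an odd positive integer. *)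
Definition antider_coef (s : R) (b : nat -> R) (j : nat) : R :=
  / (2 * INR j + 1 - s) * b j.

(** The finite part of the integral over [[0,1/2]] of
    [x^(-s) (b_0 + b_1 x^2 + ...)]. *)
Definition half_integral (s : R) (b : nat -> R) : R :=
  Rpower (1 / 2) (1 - s) * PSeries (antider_coef s b) ((1 / 2) ^ 2).

(** The coefficient of [M] in the asymptotics; for [s < 1] it is the mean of
    [(2 sin (PI x))^(-s)] over [[0,1]]. *)
Definition mean_potential (s : R) (b : nat -> R) : R :=
  2 / Rpower (2 * PI) s * half_integral s b.

(** With the largest [p] such that [2p <= s + 1], the terms of the expansion of
    [root_sum s M] that do not tend to 0 faster than [1/M]. *)
Definition root_main (s : R) (b : nat -> R) (zeta : C -> C) (p : nat) (M : R) : R :=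
  mean_potential s b * M +
  2 / Rpower (2 * PI) s *
    bigsum (fun j => b j * Re (zeta (RtoC (s - 2 * INR j))) *
                     Rpower M (s - 2 * INR j)) (S p).

(** The points at angles [t] and [2 PI - t] contribute equally, and the antipodal
    point is its own mirror image. *)
Lemma root_sum_half s K : (0 < K)%nat ->
  root_sum s (2 * K) =
  2 * bigsum (fun i => Rpower (2 * sin (PI * INR (S i) / INR (2 * K))) (- s)) K
  - Rpower (2 * sin (PI * INR K / INR (2 * K))) (- s).
Proof.
  intros HK. unfold root_sum.
  set (g := fun k => Rpower (2 * sin (PI * INR k / INR (2 * K))) (- s)).
  change (bigsum (fun i => g (S i)) (2 * K - 1) =
          2 * bigsum (fun i => g (S i)) K - g K).
  replace (2 * K - 1)%nat with ((K - 1) + 1 + (K - 1))%nat by lia.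
  rewrite !bigsum_add.
  replace (bigsum (fun i => g (S i)) K) with
    (bigsum (fun i => g (S i)) (K - 1) + g K).
  2:{ destruct K; [lia|]. simpl. rewrite Nat.sub_0_r. reflexivity. }
  simpl (bigsum _ 1). rewrite Nat.add_0_r.
  replace (S (K - 1)) with K by lia.
  replace (bigsum (fun i => g (S (K - 1 + 1 + i))) (K - 1)) with
    (bigsum (fun i => g (S i)) (K - 1)); [ring|].
  rewrite <- bigsum_rev. apply bigsum_ext; intros i Hi. unfold g.
  assert (Hn : INR (2 * K) <> 0) by (apply not_0_INR; lia).
  replace (S (K - 1 - 1 - i)) with (2 * K - S (K - 1 + 1 + i))%nat by lia.
  rewrite minus_INR by lia.
  replace (PI * (INR (2 * K) - INR (S (K - 1 + 1 + i))) / INR (2 * K)) with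
    (PI - PI * INR (S (K - 1 + 1 + i)) / INR (2 * K)) by (field; exact Hn).
  rewrite sin_minus, sin_PI, cos_PI. do 2 f_equal. ring.
Qed.

Lemma Rpower_mult_base x y q : 0 < x -> 0 < y ->
  Rpower (x * y) q = Rpower x q * Rpower y q.
Proof. intros. symmetry. apply Rpower_mult_distr; assumption. Qed.

Lemma Rpower_2j x j s : 0 < x ->
  Rpower x (2 * INR j - s) = (x ^ 2) ^ j * Rpower x (- s).
Proof.
  intros Hx. unfold Rminus; rewrite Rpower_plus, <- pow_mult, <- Rpower_pow,
    mult_INR by assumption. simpl INR. reflexivity.
Qed.

(** Because [2 sin (PI x) = 2 PI x sinc x]. *)
Lemma kernel_series s b x : sinc_power_series s b -> 0 < x < 1 ->
  is_series (fun j => b j * Rpower x (2 * INR j - s))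
    (Rpower (2 * PI) s * Rpower (2 * sin (PI * x)) (- s)).
Proof.
  intros [Hr Hb] Hx. pose proof PI_RGT_0 as HPI.
  assert (P : is_pseries b (x ^ 2) (Rpower (sinc x) (- s))).
  { rewrite <- Hb by assumption. apply PSeries_correct, CV_radius_inside.
    apply Rbar_lt_radius; [exact Hr|]. rewrite Rabs_pos_eq; nra. }
  apply is_pseries_R in P.
  apply (is_series_scal_r (Rpower x (- s))) in P.
  replace (Rpower (2 * PI) s * _) with (Rpower (sinc x) (- s) * Rpower x (- s)).
  - eapply is_series_ext; [|exact P]. intros j; cbv beta.
    rewrite Rpower_2j by lra. apply Rmult_assoc.
  - replace (2 * sin (PI * x)) with ((2 * PI) * (x * sinc x))
      by (unfold sinc; field; split; lra).
    pose proof (sinc_pos x Hx).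
    rewrite (Rpower_mult_base (2 * PI)), (Rpower_mult_base x) by nra.
    rewrite <- (Rmult_assoc (Rpower (2 * PI) s)), <- Rpower_plus.
    rewrite Rplus_opp_r, Rpower_O by lra. ring.
Qed.

Lemma is_series_bigsum_fin (a : nat -> nat -> R) (l : nat -> R) K :
  (forall k, (k < K)%nat -> is_series (a k) (l k)) ->
  is_series (fun j => bigsum (fun k => a k j) K) (bigsum l K).
Proof.
  intros Ha. induction K as [|K IH]; simpl.
  - apply is_series_bigsum. eapply is_lim_seq_ext; [|apply is_lim_seq_const].
    intros n; symmetry; apply bigsum_0; auto.
  - apply (is_series_plus (fun j => bigsum (fun k => a k j) K) (a K));
      [apply IH; auto | apply Ha; lia].
Qed.

(** Only arguments [x = k/M <= 1/2] occur, well inside the disc of convergence of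
    the sinc series, so the finite sum over [k] may be taken term by term. *)
Lemma root_sum_series s b K : sinc_power_series s b -> (0 < K)%nat ->
  is_series (fun j => b j * Rpower (INR (2 * K)) (- (2 * INR j - s)) *
                      trap_sum K (2 * INR j - s))
    (Rpower (2 * PI) s * root_sum s (2 * K) / 2).
Proof.
  intros Hb HK.
  assert (HM : 0 < INR (2 * K)) by (apply lt_0_INR; lia).
  assert (Hx : forall k, (1 <= k <= K)%nat -> 0 < INR k / INR (2 * K) < 1).
  { intros k Hk. split; [apply Rdiv_lt_0_compat; [apply lt_0_INR; lia|lra]|].
    apply Rmult_lt_reg_r with (INR (2 * K)); [lra|].
    unfold Rdiv; rewrite Rmult_assoc, Rinv_l, Rmult_1_r, Rmult_1_l by lra.
    apply lt_INR; lia. }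
  assert (S1 := is_series_bigsum_fin
    (fun k j => b j * Rpower (INR (S k) / INR (2 * K)) (2 * INR j - s)) _ K
    (fun k Hk => kernel_series s b _ Hb (Hx (S k) ltac:(lia)))).
  assert (S2 := kernel_series s b _ Hb (Hx K ltac:(lia))).
  apply (is_series_scal_r (- (1 / 2))) in S2.
  assert (S3 := is_series_plus _ _ _ _ S1 S2). clear S1 S2.
  rewrite root_sum_half by assumption.
  replace (Rpower (2 * PI) s * _ / 2) with
    (plus (bigsum (fun k => Rpower (2 * PI) s *
             Rpower (2 * sin (PI * (INR (S k) / INR (2 * K)))) (- s)) K)
          (Rpower (2 * PI) s * Rpower (2 * sin (PI * (INR K / INR (2 * K)))) (- s)
             * - (1 / 2))).
  - eapply is_series_ext; [|exact S3]. intros j; cbv beta.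
    change (plus ?x ?y) with (x + y). unfold trap_sum.
    set (q := 2 * INR j - s).
    assert (E : forall k, (1 <= k)%nat -> Rpower (INR k / INR (2 * K)) q =
                Rpower (INR (2 * K)) (- q) * Rpower (INR k) q).
    { intros k Hk. unfold Rdiv. rewrite Rpower_mult_base.
      - rewrite Rpower_Ropp. rewrite Rmult_comm. f_equal.
        unfold Rpower. rewrite ln_Rinv by lra.
        rewrite <- exp_Ropp. f_equal. ring.
      - apply lt_0_INR; lia.
      - apply Rinv_0_lt_compat; lra. }
    rewrite (bigsum_ext _ (fun k => (b j * Rpower (INR (2 * K)) (- q)) *
                             Rpower (INR (S k)) q)).
    + rewrite bigsum_scal, E by lia. at_type_R. field.
    + intros i _. rewrite E by lia. ring.
  - change (plus ?x ?y) with (x + y). rewrite bigsum_scal.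
    rewrite (bigsum_ext (fun i => Rpower (2 * sin (PI * (INR (S i) / INR (2 * K)))) (- s))
      (fun i => Rpower (2 * sin (PI * INR (S i) / INR (2 * K))) (- s))).
    + replace (PI * (INR K / INR (2 * K))) with (PI * INR K / INR (2 * K))
        by (field; lra). at_type_R. field.
    + intros i _. do 3 f_equal. field; lra.
Qed.

(** The function [(sin (PI x) / PI)^(-s)] has a critical point at [1/2]. *)
Lemma sinc_series_critical s b : sinc_power_series s b ->
  PSeries (fun j => (2 * INR j - s) * b j) ((1 / 2) ^ 2) = 0.
Proof.
  intros [Hr Hb]. pose proof PI_RGT_0 as HPI.
  assert (D1 := is_derive_power_PSeries b (- s) (1 / 2) Hr ltac:(lra)).
  assert (D2 : is_derive (fun x => Rpower x (- s) * PSeries b (x ^ 2)) (1 / 2) 0).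
  { apply (is_derive_ext_loc (V := R_NormedModule)
             (fun x => Rpower (sin (PI * x) / PI) (- s))).
    - exists (mkposreal (1 / 2) ltac:(lra)). intros x Hx.
      assert (Hx' : 0 < x < 1).
      { change (Rabs (x - 1 / 2) < 1 / 2) in Hx. apply Rabs_lt_between in Hx. lra. }
      rewrite Hb by assumption. rewrite <- Rpower_mult_base;
        [|lra|apply sinc_pos; lra].
      f_equal. unfold sinc. field. lra.
    - replace 0 with (scal 0 (- s * Rpower (sin (PI * (1 / 2)) / PI) (- s - 1)))
        by (unfold scal; simpl; unfold mult; simpl; ring).
      apply (is_derive_comp (V := R_NormedModule) (fun y => Rpower y (- s))
               (fun x => sin (PI * x) / PI)).
      + apply is_derive_Rpower. replace (PI * (1 / 2)) with (PI / 2) by field.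
        rewrite sin_PI2. apply Rdiv_lt_0_compat; lra.
      + auto_derive; [exact I|]. replace (PI * (1 / 2)) with (PI / 2) by field.
        rewrite cos_PI2. ring. }
  apply is_derive_unique in D1. apply is_derive_unique in D2.
  rewrite D1 in D2. apply Rmult_integral in D2. destruct D2 as [D2|D2].
  - pose proof (Rpower_pos (1 / 2) (- s - 1)). lra.
  - rewrite <- D2. reflexivity.
Qed.

Lemma antider_factor_bounded s : not_odd s ->
  exists C, forall j : nat, Rabs (/ (2 * INR j + 1 - s)) <= C.
Proof.
  intros Hs. destruct (INR_unbounded (Rabs s)) as [J HJ].
  exists (1 + bigsum (fun j => Rabs (/ (2 * INR j + 1 - s))) J). intros j.
  destruct (le_lt_dec J j) as [Hj|Hj].
  - apply le_INR in Hj. pose proof (Rle_abs s). pose proof (pos_INR J).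
    assert (0 < / (2 * INR j + 1 - s) <= 1).
    { split; [apply Rinv_0_lt_compat; lra|]. apply Rle_trans with (/ 1).
      - apply Rinv_le_contravar; lra.
      - rewrite Rinv_1; lra. }
    rewrite Rabs_pos_eq by lra.
    pose proof (bigsum_nonneg (fun j => Rabs (/ (2 * INR j + 1 - s))) J
                  (fun i _ => Rabs_pos _)). lra.
  - assert (Rabs (/ (2 * INR j + 1 - s)) <=
            bigsum (fun j => Rabs (/ (2 * INR j + 1 - s))) J); [|lra].
    replace J with (S j + (J - S j))%nat by lia. rewrite bigsum_add. simpl.
    pose proof (bigsum_nonneg (fun j => Rabs (/ (2 * INR j + 1 - s))) j
                  (fun i _ => Rabs_pos _)).
    match goal with |- _ <= _ + _ + ?x => assert (0 <= x); [|lra] end.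
    apply bigsum_nonneg; intros; apply Rabs_pos.
Qed.

Lemma antider_radius s b : not_odd s -> Rbar_le 1 (CV_radius b) ->
  Rbar_le 1 (CV_radius (antider_coef s b)).
Proof.
  intros Hs Hb. destruct (antider_factor_bounded s Hs) as [C HC].
  eapply Rbar_le_trans; [exact Hb|]. apply (CV_radius_dominated _ _ C).
  intros j. unfold antider_coef. rewrite Rabs_mult.
  apply Rmult_le_compat_r; [apply Rabs_pos | apply HC].
Qed.

Lemma is_series_half s c y (k : nat -> R) : Rbar_le 1 (CV_radius c) ->
  PSeries c ((1 / 2) ^ 2) = y ->
  (forall j, k j = Rpower (1 / 2) (- s) * (c j * ((1 / 2) ^ 2) ^ j)) ->
  is_series k (Rpower (1 / 2) (- s) * y).
Proof.
  intros Hc <- Hk. eapply is_series_ext; [intros j; symmetry; apply Hk|].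
  apply (is_series_scal_l (Rpower (1 / 2) (- s)) (fun j => c j * ((1/2)^2)^j)).
  apply is_pseries_R, PSeries_correct, CV_radius_inside, Rbar_lt_radius;
    [exact Hc|]. rewrite Rabs_pos_eq; lra.
Qed.

(** Inserting the Euler-Maclaurin expansion of [trap_sum], the terms in [K]
    add up to [half_integral] and those in [1/K] cancel. *)
Lemma root_sum_rest_series s b K : not_odd s -> sinc_power_series s b ->
  (0 < K)%nat ->
  is_series (fun j => b j * Rpower (INR (2 * K)) (- (2 * INR j - s)) *
                      em_rest K (2 * INR j - s))
    (Rpower (2 * PI) s * root_sum s (2 * K) / 2 - INR (2 * K) * half_integral s b).
Proof.
  intros Hs Hb HK. assert (Hb' := Hb). destruct Hb' as [Hr _].
  assert (HK0 : 0 < INR K) by (apply lt_0_INR; lia).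
  assert (EM : INR (2 * K) = 2 * INR K) by (rewrite mult_INR; simpl INR; ring).
  assert (S1 := root_sum_series s b K Hb HK).
  assert (SA : is_series (fun j => Rpower (1 / 2) (2 * INR j - s) * antider_coef s b j)
                 (2 * half_integral s b)).
  { replace (2 * half_integral s b) with (Rpower (1 / 2) (- s) *
      PSeries (antider_coef s b) ((1 / 2) ^ 2)).
    - apply (is_series_half s (antider_coef s b)); [now apply antider_radius|reflexivity|].
      intros j. rewrite Rpower_2j by lra. ring.
    - unfold half_integral, Rminus. rewrite Rpower_plus, Rpower_1 by lra. field. }
  assert (SB : is_series (fun j => Rpower (1 / 2) (2 * INR j - s) *
                             ((2 * INR j - s) * b j)) 0).
  { replace 0 with (Rpower (1 / 2) (- s) * 0) by ring.
    apply (is_series_half s (fun j => (2 * INR j - s) * b j)).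
    - eapply Rbar_le_trans; [exact Hr|]. apply (CV_radius_linear _ _ (2 + Rabs s)).
      intros j. rewrite Rabs_mult. apply Rmult_le_compat_r; [apply Rabs_pos|].
      pose proof (Rle_abs s). pose proof (Rle_abs (- s)). rewrite Rabs_Ropp in *.
      pose proof (pos_INR j). pose proof (Rabs_pos s). apply Rabs_le; nra.
    - now apply sinc_series_critical.
    - intros j. rewrite Rpower_2j by lra. ring. }
  apply (is_series_scal_l (- INR K)) in SA.
  apply (is_series_scal_l (- / (12 * INR K))) in SB.
  assert (S2 := is_series_plus _ _ _ _ S1 (is_series_plus _ _ _ _ SA SB)).
  replace (_ - _) with
    (plus (Rpower (2 * PI) s * root_sum s (2 * K) / 2)
       (plus (- INR K * (2 * half_integral s b)) (- / (12 * INR K) * 0))).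
  - eapply is_series_ext; [|exact S2]. intros j. cbv beta.
    repeat change (plus ?x ?y) with (x + y).
    unfold em_rest. set (q := 2 * INR j - s).
    assert (E1 : Rpower (INR K) (q + 1) = Rpower (INR K) q * INR K)
      by (rewrite Rpower_plus, Rpower_1 by assumption; reflexivity).
    assert (E2 : Rpower (INR K) (q - 1) = Rpower (INR K) q / INR K).
    { unfold Rminus; rewrite Rpower_plus, Rpower_Ropp, Rpower_1 by assumption.
      reflexivity. }
    assert (E3 : Rpower (1 / 2) q = Rpower (INR (2 * K)) (- q) * Rpower (INR K) q).
    { rewrite EM, Rpower_mult_base, Rmult_assoc, <- Rpower_plus, Rplus_opp_l,
        Rpower_O by lra.
      unfold Rdiv. rewrite Rmult_1_l. unfold Rpower. rewrite ln_Rinv by lra.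
      rewrite Rmult_1_r. f_equal. ring. }
    rewrite E1, E2, E3. unfold antider_coef.
    assert (Hq : q + 1 <> 0) by (unfold q; specialize (Hs j); lra).
    replace (2 * INR j + 1 - s) with (q + 1) by (unfold q; ring).
    repeat change (scal ?x ?y) with (x * y). at_type_R. field. split; lra.
  - repeat change (plus ?x ?y) with (x + y). rewrite EM. at_type_R. ring.
Qed.

Lemma em_const_poly s : exists C, 0 <= C /\ forall j : nat,
  let q := 2 * INR j - s in
  1 + Rabs q + 2 * em_const q <= C * (INR j + 1) ^ 4.
Proof.
  set (D := Rabs s + 3).
  assert (HD : 3 <= D) by (unfold D; pose proof (Rabs_pos s); lra).
  exists (1 + D + D ^ 4). split; [nra|]. intros j q.
  set (x := INR j + 1). assert (Hx : 1 <= x) by (unfold x; pose proof (pos_INR j); lra).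
  assert (B : forall c, 0 <= c <= 3 -> Rabs (q - c) <= D * x).
  { intros c Hc. unfold q, x, D. pose proof (pos_INR j). pose proof (Rabs_pos s).
    pose proof (Rle_abs s). pose proof (Rle_abs (- s)). rewrite Rabs_Ropp in *.
    apply Rabs_le; nra. }
  pose proof (B 0 ltac:(lra)) as B0. rewrite Rminus_0_r in B0.
  pose proof (B 1 ltac:(lra)) as B1. pose proof (B 2 ltac:(lra)) as B2.
  pose proof (B 3 ltac:(lra)) as B3.
  assert (E : Rabs (q * (q - 1) * (q - 2) * (q - 3)) <= (D * x) * (D * x) * (D * x) * (D * x)).
  { rewrite !Rabs_mult. assert (0 <= D * x) by nra.
    repeat apply Rmult_le_compat; try assumption;
      repeat apply Rmult_le_pos; try apply Rabs_pos. }
  replace ((D * x) * (D * x) * (D * x) * (D * x)) with (D ^ 4 * x ^ 4) in E by ring.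
  assert (Hx4 : x <= x ^ 4).
  { replace (x ^ 4) with (x * x ^ 3) by ring.
    assert (1 <= x ^ 3) by (apply pow_R1_Rle; lra). nra. }
  assert (0 < D ^ 4) by (apply pow_lt; lra).
  unfold em_const. nra.
Qed.

Lemma radius_poly4 b : Rbar_le 1 (CV_radius b) ->
  Rbar_le 1 (CV_radius (fun j => (INR j + 1) ^ 4 * b j)).
Proof.
  intros Hb.
  assert (Q : forall m, Rbar_le 1 (CV_radius (fun j => (INR j + 1) ^ m * b j))).
  { induction m as [|m IH].
    - rewrite (CV_radius_ext _ b); [exact Hb|]. intros; simpl; ring.
    - eapply Rbar_le_trans; [exact IH|]. apply (CV_radius_linear _ _ 1).
      intros j. pose proof (pos_INR j). rewrite Rmult_1_l.
      simpl pow at 1. rewrite Rmult_assoc, Rabs_mult, (Rabs_pos_eq (INR j + 1)) by lra.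
      apply Rle_refl. }
  apply Q.
Qed.

(** The terms up to order [p] converge to the zeta values with an error
    [O(K^(-2))], the others are already [O(K^(-1-d))], uniformly summable in
    [j] because [1/2 < 1]. *)
Lemma root_sum_asymptotic s b zeta p d :
  not_odd s -> sinc_power_series s b -> is_riemann_zeta zeta -> 0 < d <= 1 ->
  (forall j, (j <= p)%nat -> -1 <= s - 2 * INR j) ->
  (forall j, (p < j)%nat -> 1 + d <= 2 * INR j - s) ->
  exists W, forall K, (0 < K)%nat ->
    Rabs (root_sum s (2 * K) - root_main s b zeta p (INR (2 * K)))
    <= W * Rpower (INR K) (- (1 + d)).
Proof.
  intros Hs Hb Hz Hd Hp1 Hp2. assert (Hb' := Hb). destruct Hb' as [Hr _].
  destruct (em_const_poly s) as [C [HC0 HC]].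
  destruct (PSeries_abs_bound _ (1 / 4) (radius_poly4 b Hr) ltac:(lra)) as [A HA].
  assert (HA0 : 0 <= A) by apply (HA O).
  pose (W0 := Rpower (1 / 2) (- s) * C * A).
  exists (2 / Rpower (2 * PI) s * W0). intros K HK.
  assert (HK1 := INR_ge1 K HK).
  assert (EM : INR (2 * K) = 2 * INR K) by (rewrite mult_INR; simpl INR; ring).
  set (M := INR (2 * K)) in *.
  pose (term := fun j => b j * Rpower M (- (2 * INR j - s)) * em_rest K (2 * INR j - s)).
  pose (main := fun j => b j * Re (zeta (RtoC (s - 2 * INR j))) *
                         Rpower M (s - 2 * INR j)).
  assert (TB : forall j, Rabs (term j - (if le_lt_dec j p then main j else 0)) <=
    Rpower (1 / 2) (- s) * C * Rpower (INR K) (- (1 + d)) *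
      (Rabs ((INR j + 1) ^ 4 * b j) * (1 / 4) ^ j)).
  { intros j. set (q := 2 * INR j - s).
    assert (G : forall x, Rabs x <= (1 + Rabs q + 2 * em_const q) *
                  Rpower (INR K) (q - 1 - d) ->
              Rabs (b j * Rpower M (- q) * x) <=
              Rpower (1 / 2) (- s) * C * Rpower (INR K) (- (1 + d)) *
                (Rabs ((INR j + 1) ^ 4 * b j) * (1 / 4) ^ j)).
    { intros x Hx. rewrite !Rabs_mult, (Rabs_pos_eq (Rpower _ _))
        by (apply Rlt_le, Rpower_pos).
      assert (E : Rpower M (- q) * Rpower (INR K) (q - 1 - d) =
                  Rpower (1 / 2) (- s) * (1 / 4) ^ j * Rpower (INR K) (- (1 + d))).
      { replace ((1 / 4) ^ j) with (((1 / 2) ^ 2) ^ j) by (f_equal; field).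
        rewrite (Rmult_comm (Rpower (1 / 2) (- s))), <- Rpower_2j by lra. fold q.
        rewrite EM, Rpower_mult_base, Rmult_assoc, <- Rpower_plus by lra.
        f_equal.
        - unfold Rdiv; rewrite Rmult_1_l. unfold Rpower. rewrite ln_Rinv by lra.
          f_equal; ring.
        - f_equal; ring. }
      rewrite Rmult_assoc.
      apply Rle_trans with (Rabs (b j) * (C * (INR j + 1) ^ 4 *
        (Rpower M (- q) * Rpower (INR K) (q - 1 - d)))).
      - apply Rmult_le_compat_l; [apply Rabs_pos|].
        rewrite <- Rmult_assoc, (Rmult_comm (C * _)), Rmult_assoc.
        apply Rmult_le_compat_l; [apply Rlt_le, Rpower_pos|].
        eapply Rle_trans; [exact Hx|].
        apply Rmult_le_compat_r; [apply Rlt_le, Rpower_pos|]. apply HC.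
      - rewrite E. right. rewrite (Rabs_pos_eq ((INR j + 1) ^ 4)).
        + ring.
        + apply pow_le. pose proof (pos_INR j); lra. }
    assert (HC1 := em_const_nonneg q).
    destruct (le_lt_dec j p) as [Hj|Hj].
    - assert (Hq1 : -1 <= s - 2 * INR j) by auto.
      assert (Hq2 : s - 2 * INR j <> 1) by (specialize (Hs j); lra).
      unfold term, main. fold q. replace (s - 2 * INR j) with (- q) by (unfold q; ring).
      replace (b j * Rpower M (- q) * em_rest K q -
        b j * Re (zeta (RtoC (- q))) * Rpower M (- q)) with
        (b j * Rpower M (- q) * (em_rest K q - Re (zeta (RtoC (- q))))) by ring.
      apply G.
      assert (L := em_rest_zeta zeta _ Hz Hq1 Hq2).
      replace (- (s - 2 * INR j)) with q in L by (unfold q; ring).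
      replace (s - 2 * INR j) with (- q) in L by (unfold q; ring).
      assert (Hq3 : q <= 1) by (unfold q; lra).
      eapply Rle_trans; [apply (em_rest_limit K q _ HK Hq3); [unfold q; lra|exact L]|].
      apply Rmult_le_compat; try (apply Rlt_le, Rpower_pos); try nra.
      + pose proof (Rabs_pos q); lra.
      + apply Rle_Rpower; lra.
    - rewrite Rminus_0_r. apply G.
      eapply Rle_trans; [apply (em_rest_growing K q d HK Hd (Hp2 j Hj))|].
      apply Rmult_le_compat_r; [apply Rlt_le, Rpower_pos|].
      pose proof (Rle_abs q); lra. }
  assert (PB : forall n, Rabs (bigsum term (S p + n) - bigsum main (S p)) <=
                 W0 * Rpower (INR K) (- (1 + d))).
  { intros n.
    replace (bigsum main (S p)) with
      (bigsum (fun j => if le_lt_dec j p then main j else 0) (S p + n)).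
    2:{ rewrite bigsum_add, (bigsum_0 _ n).
        - rewrite Rplus_0_r. apply bigsum_ext; intros i Hi.
          destruct (le_lt_dec i p); [reflexivity|lia].
        - intros i Hi. destruct (le_lt_dec (S p + i) p); [lia|reflexivity]. }
    rewrite <- bigsum_minus. eapply Rle_trans; [apply bigsum_Rabs|].
    eapply Rle_trans; [apply bigsum_le; intros i _; apply TB|].
    rewrite bigsum_scal. unfold W0.
    replace (Rpower (1 / 2) (- s) * C * A * Rpower (INR K) (- (1 + d))) with
      (Rpower (1 / 2) (- s) * C * Rpower (INR K) (- (1 + d)) * A) by ring.
    apply Rmult_le_compat_l; [|apply HA].
    repeat apply Rmult_le_pos; try (apply Rlt_le, Rpower_pos); assumption. }
  assert (L := root_sum_rest_series s b K Hs Hb HK). fold M in L.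
  apply is_series_bigsum in L. fold term in L.
  apply (is_lim_seq_incr_n _ (S p)) in L.
  set (X := Rpower (2 * PI) s * root_sum s (2 * K) / 2 - M * half_integral s b) in L.
  assert (Q : Rabs (X - bigsum main (S p)) <= W0 * Rpower (INR K) (- (1 + d))).
  { apply (is_lim_seq_le (fun n => Rabs (bigsum term (n + S p) - bigsum main (S p)))
      (fun _ => W0 * Rpower (INR K) (- (1 + d))) (Rabs (X - bigsum main (S p)))
      (W0 * Rpower (INR K) (- (1 + d)))).
    - intros n. rewrite Nat.add_comm. apply PB.
    - apply (is_lim_seq_abs _ (Finite (X - bigsum main (S p)))).
      apply is_lim_seq_minus'; [exact L|apply is_lim_seq_const].
    - apply is_lim_seq_const. }
  assert (HP : 0 < Rpower (2 * PI) s) by apply Rpower_pos.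
  replace (_ - _) with (2 / Rpower (2 * PI) s * (X - bigsum main (S p))).
  - rewrite Rabs_mult, Rabs_pos_eq by (apply Rlt_le, Rdiv_lt_0_compat; lra).
    rewrite Rmult_assoc. apply Rmult_le_compat_l; [|exact Q].
    apply Rlt_le, Rdiv_lt_0_compat; lra.
  - unfold X, root_main, mean_potential. fold main. field. lra.
Qed.

(** * Recursion and monotonicity of the mean potential *)

Definition sinc_coef (j : nat) : R := sin_n j * (PI ^ 2) ^ j.
Definition cos_coef (j : nat) : R := cos_n j * (PI ^ 2) ^ j.

Lemma is_pseries_sinc_coef x : 0 < x ->
  is_pseries sinc_coef (x ^ 2) (sinc x).
Proof.
  intros Hx. pose proof PI_RGT_0 as HPI. apply is_pseries_R.
  unfold sinc, sin. destruct (exist_sin (Rsqr (PI * x))) as [l Hl].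
  replace (PI * x * l / (PI * x)) with l by (field; lra).
  unfold sin_in in Hl. apply is_series_Reals in Hl.
  eapply is_series_ext; [|exact Hl]. intros n; cbv beta. unfold sinc_coef.
  rewrite Rmult_assoc, <- Rpow_mult_distr. do 2 f_equal. unfold Rsqr. ring.
Qed.

Lemma is_pseries_cos_coef x : is_pseries cos_coef (x ^ 2) (cos (PI * x)).
Proof.
  apply is_pseries_R.
  unfold cos. destruct (exist_cos (Rsqr (PI * x))) as [l Hl].
  unfold cos_in in Hl. apply is_series_Reals in Hl.
  eapply is_series_ext; [|exact Hl]. intros n; cbv beta. unfold cos_coef.
  rewrite Rmult_assoc, <- Rpow_mult_distr. do 2 f_equal. unfold Rsqr. ring.
Qed.

Lemma sqrt_sq_eq r : 0 < r -> r = sqrt r ^ 2.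
Proof. intros; rewrite pow2_sqrt; lra. Qed.

Lemma radius_sinc_coef : Rbar_le 1 (CV_radius sinc_coef).
Proof.
  apply radius_ge_1. intros r Hr. rewrite (sqrt_sq_eq r) by lra.
  eexists; apply is_pseries_sinc_coef, sqrt_lt_R0; lra.
Qed.

Lemma radius_cos_coef : Rbar_le 1 (CV_radius cos_coef).
Proof.
  apply radius_ge_1. intros r Hr. rewrite (sqrt_sq_eq r) by lra.
  eexists; apply is_pseries_cos_coef.
Qed.

Lemma radius_PS_mult a b : Rbar_le 1 (CV_radius a) -> Rbar_le 1 (CV_radius b) ->
  Rbar_le 1 (CV_radius (PS_mult a b)).
Proof.
  intros Ha Hb. apply radius_ge_1. intros r Hr.
  apply ex_pseries_mult; apply Rbar_lt_radius; auto; rewrite Rabs_pos_eq; lra.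
Qed.

Lemma PSeries_PS_mult a b y : Rbar_le 1 (CV_radius a) ->
  Rbar_le 1 (CV_radius b) -> Rabs y < 1 ->
  PSeries (PS_mult a b) y = PSeries a y * PSeries b y.
Proof. intros. apply PSeries_mult; now apply Rbar_lt_radius. Qed.

Lemma sinc_power_series_pred s b : sinc_power_series s b ->
  sinc_power_series (s - 1) (PS_mult b sinc_coef).
Proof.
  intros [Hr Hb]. split; [apply radius_PS_mult; [exact Hr|apply radius_sinc_coef]|].
  intros x Hx.
  rewrite PSeries_PS_mult; [|exact Hr|apply radius_sinc_coef|rewrite Rabs_pos_eq; nra].
  rewrite Hb, (is_pseries_unique _ _ _ (is_pseries_sinc_coef x ltac:(lra)))
    by assumption.
  pose proof (sinc_pos x Hx).
  replace (- (s - 1)) with (- s + 1) by ring.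
  rewrite Rpower_plus, Rpower_1 by assumption. reflexivity.
Qed.

(** A power series that vanishes to the right of 0 vanishes: its value at 0 is
    the constant term, which can then be divided out. *)
Lemma PSeries_zero_right a : Rbar_le 1 (CV_radius a) ->
  (forall y, 0 < y < 1 -> PSeries a y = 0) -> forall n, a n = 0.
Proof.
  assert (Zero : forall a, Rbar_le 1 (CV_radius a) ->
            (forall y, 0 < y < 1 -> PSeries a y = 0) -> a O = 0).
  { clear a; intros a Hr Hz. rewrite <- PSeries_0.
    assert (L : is_lim_seq (fun n => PSeries a (/ INR (S (S n)))) (PSeries a 0)).
    { apply is_lim_seq_continuous.
      - apply PSeries_continuity, Rbar_lt_radius; [exact Hr|].
        rewrite Rabs_R0; lra.
      - apply (is_lim_seq_ext (fun n => Rpower (INR (S (S n))) (- (1)))).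
        + intros k. rewrite Rpower_Ropp, Rpower_1; [reflexivity|].
          apply lt_0_INR; lia.
        + assert (Q := is_lim_seq_Rpower_neg 1 Rlt_0_1).
          apply is_lim_seq_incr_1 in Q. exact Q. }
    assert (L0 : is_lim_seq (fun n => PSeries a (/ INR (S (S n)))) 0).
    { eapply is_lim_seq_ext; [|apply is_lim_seq_const].
      intros k; symmetry; apply Hz. assert (1 < INR (S (S k))).
      { replace 1 with (INR 1) by reflexivity; apply lt_INR; lia. }
      split; [apply Rinv_0_lt_compat; lra|].
      apply Rlt_le_trans with (/ 1); [apply Rinv_lt_contravar; lra|].
      rewrite Rinv_1; lra. }
    apply is_lim_seq_unique in L. apply is_lim_seq_unique in L0.
    rewrite L in L0. injection L0; auto. }
  intros Hr Hz n. revert a Hr Hz. induction n as [|n IH]; intros a Hr Hz;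
    [now apply Zero|].
  apply (IH (PS_decr_1 a)).
  - rewrite CV_radius_decr_1; exact Hr.
  - intros y Hy. apply Rmult_eq_reg_l with y; [|lra].
    rewrite Rmult_0_r, <- (Hz y Hy).
    rewrite (PSeries_decr_1 a y), (Zero a Hr Hz); [ring|].
    apply CV_radius_inside, Rbar_lt_radius; [exact Hr|].
    rewrite Rabs_pos_eq; lra.
Qed.

(** Integrating the derivative of [sin^(1-s) cos] over [[0,1/2]] in the finite
    part sense, which can be read off the coefficients. *)
Lemma half_integral_rec s b : not_odd s -> sinc_power_series s b ->
  (1 - s) * half_integral s b =
  (2 - s) * PI ^ 2 *
    half_integral (s - 2) (PS_mult (PS_mult b sinc_coef) sinc_coef).
Proof.
  intros Hs Hb. assert (Hb1 := sinc_power_series_pred _ _ Hb).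
  assert (Hb2 := sinc_power_series_pred _ _ Hb1).
  replace (s - 1 - 1) with (s - 2) in Hb2 by ring.
  set (b1 := PS_mult b sinc_coef) in *. set (g := PS_mult b1 sinc_coef) in *.
  pose proof PI_RGT_0 as HPI.
  destruct Hb as [Hr Hb]. destruct Hb1 as [Hr1 Hb1]. destruct Hb2 as [Hr2 Hb2].
  (* x^(1-s) k(x^2) is (sin (PI x) / PI)^(1-s) cos (PI x); comparing its derivative
     with its expansion gives the coefficients rhs, and its value at 1/2 is 0. *)
  set (k := PS_mult b1 cos_coef).
  assert (Hrk : Rbar_le 1 (CV_radius k))
    by (apply radius_PS_mult; [exact Hr1 | apply radius_cos_coef]).
  assert (Hk : forall x, 0 < x < 1 ->
            PSeries k (x ^ 2) = Rpower (sinc x) (1 - s) * cos (PI * x)).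
  { intros x Hx. unfold k.
    rewrite PSeries_PS_mult; [|exact Hr1|apply radius_cos_coef|rewrite Rabs_pos_eq; nra].
    rewrite Hb1, (is_pseries_unique _ _ _ (is_pseries_cos_coef x)) by assumption.
    do 2 f_equal. ring. }
  pose (rhs := fun j => (1 - s) * b j - (2 - s) * PI ^ 2 * PS_incr_1 g j).
  assert (Sum : forall y, Rabs y < 1 -> is_pseries rhs y
            ((1 - s) * PSeries b y - (2 - s) * PI ^ 2 * (y * PSeries g y))).
  { intros y Hy.
    apply (is_pseries_minus (K := R_AbsRing) (V := R_NormedModule)
             (PS_scal (1 - s) b) (PS_scal ((2 - s) * PI ^ 2) (PS_incr_1 g))).
    - apply (is_pseries_scal (K := R_AbsRing) (V := R_NormedModule));
        [apply Rmult_comm|].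
      apply PSeries_correct, CV_radius_inside, Rbar_lt_radius; assumption.
    - apply (is_pseries_scal (K := R_AbsRing) (V := R_NormedModule));
        [apply Rmult_comm|].
      apply (is_pseries_incr_1 (K := R_AbsRing) (V := R_NormedModule)).
      apply PSeries_correct, CV_radius_inside, Rbar_lt_radius; assumption. }
  assert (Hrr : Rbar_le 1 (CV_radius rhs)).
  { apply radius_ge_1. intros r Hr'. eexists; apply Sum.
    rewrite Rabs_pos_eq; lra. }
  assert (Hrl : Rbar_le 1 (CV_radius (fun j => (2 * INR j + (1 - s)) * k j))).
  { eapply Rbar_le_trans; [exact Hrk|]. apply (CV_radius_linear _ _ (2 + Rabs (1 - s))).
    intros j. rewrite Rabs_mult. apply Rmult_le_compat_r; [apply Rabs_pos|].
    pose proof (Rle_abs (1 - s)). pose proof (Rle_abs (- (1 - s))).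
    rewrite Rabs_Ropp in *. pose proof (pos_INR j). pose proof (Rabs_pos (1 - s)).
    apply Rabs_le; nra. }
  assert (Eq : forall x, 0 < x < 1 ->
            PSeries (fun j => (2 * INR j + (1 - s)) * k j) (x ^ 2) = PSeries rhs (x ^ 2)).
  { intros x Hx.
    assert (Hy : Rabs (x ^ 2) < 1) by (rewrite Rabs_pos_eq; nra).
    rewrite (is_pseries_unique _ _ _ (Sum _ Hy)), Hb, Hb2 by assumption.
    assert (Hsx := sinc_pos x Hx).
    assert (Hsin : 0 < sin (PI * x)) by (apply sin_gt_0; nra).
    assert (D1 := is_derive_power_PSeries k (1 - s) x Hrk Hx).
    replace (1 - s - 1) with (- s) in D1 by ring.
    assert (D2 : is_derive (fun x => Rpower x (1 - s) * PSeries k (x ^ 2)) x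
              ((1 - s) * Rpower (sin (PI * x) / PI) (1 - s - 1) * cos (PI * x)
                 * cos (PI * x)
               + Rpower (sin (PI * x) / PI) (1 - s) * - (PI * sin (PI * x)))).
    { apply (is_derive_ext_loc (V := R_NormedModule)
               (fun x => Rpower (sin (PI * x) / PI) (1 - s) * cos (PI * x))).
      - exists (mkposreal (Rmin x (1 - x)) ltac:(apply Rmin_pos; lra)). intros u Hu.
        assert (Hu' : 0 < u < 1).
        { change (Rabs (u - x) < Rmin x (1 - x)) in Hu.
          pose proof (Rmin_l x (1 - x)). pose proof (Rmin_r x (1 - x)).
          apply Rabs_lt_between in Hu. lra. }
        rewrite Hk by assumption.
        rewrite <- Rmult_assoc, <- Rpower_mult_base;
          [|lra|apply sinc_pos; lra].
        f_equal. f_equal. unfold sinc. field. lra.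
      - apply (is_derive_mult (K := R_AbsRing)
                 (fun x => Rpower (sin (PI * x) / PI) (1 - s)) (fun x => cos (PI * x)));
          [| |intros; apply Rmult_comm].
        + replace (_ * cos (PI * x)) with (scal (cos (PI * x))
            ((1 - s) * Rpower (sin (PI * x) / PI) (1 - s - 1)))
            by (unfold scal; simpl; unfold mult; simpl; ring).
          apply (is_derive_comp (V := R_NormedModule) (fun y => Rpower y (1 - s))
                   (fun x => sin (PI * x) / PI)).
          * apply is_derive_Rpower, Rdiv_lt_0_compat; lra.
          * auto_derive; [exact I|]. field. lra.
        + auto_derive; [exact I|]. ring. }
    apply is_derive_unique in D1. apply is_derive_unique in D2.
    rewrite D1 in D2. clear D1.
    replace (1 - s - 1) with (- s) in D2 by ring.
    replace (Rpower (sin (PI * x) / PI) (1 - s)) with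
      (Rpower (sin (PI * x) / PI) (- s) * (sin (PI * x) / PI)) in D2.
    2:{ rewrite <- (Rpower_1 (sin (PI * x) / PI)) at 2 by (apply Rdiv_lt_0_compat; lra).
        rewrite <- Rpower_plus. f_equal; ring. }
    replace (Rpower (sin (PI * x) / PI) (- s)) with
      (Rpower x (- s) * Rpower (sinc x) (- s)) in D2.
    2:{ rewrite <- Rpower_mult_base by lra. f_equal. unfold sinc; field; lra. }
    replace (Rpower (sinc x) (- (s - 2))) with
      (Rpower (sinc x) (- s) * sinc x ^ 2).
    2:{ rewrite <- (Rpower_pow 2) by assumption. rewrite <- Rpower_plus.
        f_equal. simpl. ring. }
    apply Rmult_eq_reg_l with (Rpower x (- s));
      [|apply Rgt_not_eq, Rpower_pos].
    rewrite D2.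
    replace (x ^ 2 * (Rpower (sinc x) (- s) * sinc x ^ 2)) with
      (Rpower (sinc x) (- s) * (sin (PI * x) / PI) ^ 2)
      by (unfold sinc; field; lra).
    assert (SC : cos (PI * x) * cos (PI * x) = 1 - sin (PI * x) ^ 2).
    { pose proof (sin2_cos2 (PI * x)) as Q. unfold Rsqr in Q. lra. }
    rewrite Rmult_assoc, SC. field. lra. }
  assert (Coef : forall j, (2 * INR j + (1 - s)) * k j = rhs j).
  { intros j. apply Rminus_diag_uniq.
    apply (PSeries_zero_right
             (fun j => (2 * INR j + (1 - s)) * k j - rhs j)).
    - apply radius_ge_1. intros r Hr'.
      apply (ex_pseries_minus (K := R_AbsRing) (V := R_NormedModule)
        (fun j => (2 * INR j + (1 - s)) * k j) rhs);
        apply CV_radius_inside, Rbar_lt_radius; auto; rewrite Rabs_pos_eq; lra.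
    - intros y Hy. assert (Hy' : 0 < sqrt y < 1).
      { split; [apply sqrt_lt_R0; lra|]. rewrite <- sqrt_1. apply sqrt_lt_1; lra. }
      specialize (Eq _ Hy'). rewrite <- sqrt_sq_eq in Eq by lra.
      rewrite (PSeries_minus (fun j => (2 * INR j + (1 - s)) * k j) rhs);
        [rewrite Eq; ring| |];
        apply CV_radius_inside, Rbar_lt_radius; auto; rewrite Rabs_pos_eq; lra. }
  assert (Rs : Rbar_le 1 (CV_radius (antider_coef s b))) by now apply antider_radius.
  assert (Hs2 : not_odd (s - 2)).
  { intros j. specialize (Hs (S j)). rewrite S_INR in Hs. lra. }
  assert (Rg : Rbar_le 1 (CV_radius (antider_coef (s - 2) g))) by now apply antider_radius.
  assert (Hq : Rabs ((1 / 2) ^ 2) < 1) by (rewrite Rabs_pos_eq; lra).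
  assert (Fin : (1 - s) * PSeries (antider_coef s b) ((1 / 2) ^ 2) =
          (2 - s) * PI ^ 2 * ((1 / 2) ^ 2 *
             PSeries (antider_coef (s - 2) g) ((1 / 2) ^ 2))).
  { apply Rminus_diag_uniq.
    transitivity (PSeries k ((1 / 2) ^ 2)).
    - symmetry. apply is_pseries_unique.
      eapply is_pseries_ext;
        [|apply (is_pseries_minus (K := R_AbsRing) (V := R_NormedModule)
             (PS_scal (1 - s) (antider_coef s b))
             (PS_scal ((2 - s) * PI ^ 2) (PS_incr_1 (antider_coef (s - 2) g))))].
      + intros j. apply Rmult_eq_reg_l with (2 * INR j + 1 - s); [|apply Hs].
        replace (2 * INR j + 1 - s) with (2 * INR j + (1 - s)) by ring.
        rewrite Coef. unfold rhs, PS_minus, PS_plus, PS_opp, PS_scal, antider_coef.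
        assert (Q := Hs j). destruct j as [|j].
        * unfold PS_incr_1. unfold plus, opp, scal, zero; simpl.
          unfold mult; simpl. simpl in Q. field. lra.
        * change ((2 * INR (S j) + (1 - s)) *
            ((1 - s) * (/ (2 * INR (S j) + 1 - s) * b (S j)) -
             (2 - s) * PI ^ 2 * (/ (2 * INR j + 1 - (s - 2)) * g j)) =
            (1 - s) * b (S j) - (2 - s) * PI ^ 2 * g j).
          replace (2 * INR j + 1 - (s - 2)) with (2 * INR (S j) + 1 - s)
            by (rewrite S_INR; ring).
          field. exact Q.
      + apply (is_pseries_scal (K := R_AbsRing) (V := R_NormedModule));
          [apply Rmult_comm|].
        apply PSeries_correct, CV_radius_inside, Rbar_lt_radius; assumption.
      + apply (is_pseries_scal (K := R_AbsRing) (V := R_NormedModule));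
          [apply Rmult_comm|].
        apply (is_pseries_incr_1 (K := R_AbsRing) (V := R_NormedModule)).
        apply PSeries_correct, CV_radius_inside, Rbar_lt_radius; assumption.
    - rewrite Hk by lra. replace (PI * (1 / 2)) with (PI / 2) by field.
      rewrite cos_PI2. ring. }
  unfold half_integral.
  replace (1 - (s - 2)) with (1 - s + INR 2) by (simpl; ring).
  rewrite Rpower_plus, Rpower_pow by lra.
  replace ((1 - s) * (Rpower (1 / 2) (1 - s) * PSeries (antider_coef s b) ((1 / 2) ^ 2)))
    with (Rpower (1 / 2) (1 - s) *
          ((1 - s) * PSeries (antider_coef s b) ((1 / 2) ^ 2))) by ring.
  rewrite Fin. ring.
Qed.

(** For [s < 1], the mean of [sin^(-s)] over [[0, PI]]. *)
Definition mean_sin (s : R) (b : nat -> R) : R :=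
  2 * Rpower PI (- s) * half_integral s b.

Lemma mean_potential_sin s b :
  mean_potential s b = Rpower 2 (- s) * mean_sin s b.
Proof.
  unfold mean_potential, mean_sin. pose proof PI_RGT_0.
  rewrite Rpower_mult_base, !Rpower_Ropp by lra.
  pose proof (Rpower_pos 2 s). pose proof (Rpower_pos PI s). field. lra.
Qed.

(** The recursion of the integrals of [sin^(-s)], in a form that survives analytic
    continuation in [s]. *)
Lemma mean_sin_rec s b : not_odd s -> sinc_power_series s b ->
  (1 - s) * mean_sin s b =
  (2 - s) * mean_sin (s - 2) (PS_mult (PS_mult b sinc_coef) sinc_coef).
Proof.
  intros Hs Hb. unfold mean_sin. pose proof PI_RGT_0.
  replace (- (s - 2)) with (- s + INR 2) by (simpl; ring).
  rewrite (Rpower_plus (- s)), Rpower_pow by assumption.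
  replace ((1 - s) * (2 * Rpower PI (- s) * half_integral s b)) with
    (2 * Rpower PI (- s) * ((1 - s) * half_integral s b)) by ring.
  rewrite half_integral_rec by assumption. ring.
Qed.

(** Compare the antiderivatives of the two powers of [sin] that vanish at 0. *)
Lemma mean_sin_mono s s' b b' : s' <= s -> s < 1 ->
  sinc_power_series s b -> sinc_power_series s' b' ->
  mean_sin s' b' <= mean_sin s b.
Proof.
  intros Hss Hs1 Hb Hb'. pose proof PI_RGT_0 as HPI.
  pose (A := fun s b x => Rpower PI (- s) *
               (Rpower x (1 - s) * PSeries (antider_coef s b) (x ^ 2))).
  assert (Odd : forall s, s < 1 -> not_odd s).
  { intros u Hu j. pose proof (pos_INR j). lra. }
  assert (DA : forall s b x, s < 1 -> sinc_power_series s b -> 0 < x < 1 ->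
            is_derive (A s b) x (Rpower (sin (PI * x)) (- s))).
  { clear - HPI Odd. intros s b x Hs [Hr Hb] Hx.
    assert (D := is_derive_power_PSeries (antider_coef s b) (1 - s) x
                   (antider_radius s b (Odd s Hs) Hr) Hx).
    apply (is_derive_scal_R (Rpower PI (- s))) in D.
    replace (Rpower (sin (PI * x)) (- s)) with (Rpower PI (- s) *
      (Rpower x (1 - s - 1) *
       PSeries (fun j => (2 * INR j + (1 - s)) * antider_coef s b j) (x ^ 2)));
      [exact D|].
    rewrite (PSeries_ext _ b), Hb by
      (try assumption; intros n; unfold antider_coef; specialize (Odd s Hs n);
       field; lra).
    replace (1 - s - 1) with (- s) by ring.
    rewrite <- !Rpower_mult_base; try apply sinc_pos; try lra.
    - f_equal. unfold sinc; field; lra.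
    - apply Rmult_lt_0_compat; [lra|]. apply sinc_pos; lra. }
  assert (A0 : forall s b, s < 1 -> sinc_power_series s b ->
            is_lim_seq (fun n => A s b (/ INR (S (S n)))) 0).
  { clear - HPI Odd. intros s b Hs [Hr Hb]. unfold A.
    replace (Finite 0) with (Finite (Rpower PI (- s) *
      (0 * PSeries (antider_coef s b) 0))) by (f_equal; ring).
    apply (is_lim_seq_scal_l _ _ (Finite (0 * PSeries (antider_coef s b) 0))).
    apply is_lim_seq_mult'.
    - assert (Q := is_lim_seq_Rpower_neg (1 - s) ltac:(lra)).
      apply is_lim_seq_incr_1 in Q. eapply is_lim_seq_ext; [|exact Q].
      intros n; cbv beta. unfold Rpower. rewrite ln_Rinv by (apply lt_0_INR; lia).
      f_equal; ring.
    - apply is_lim_seq_continuous.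
      + apply PSeries_continuity, Rbar_lt_radius; [now apply antider_radius; auto|].
        rewrite Rabs_R0; lra.
      + assert (Q := is_lim_seq_Rpower_neg 2 ltac:(lra)).
        apply is_lim_seq_incr_1 in Q. eapply is_lim_seq_ext; [|exact Q].
        intros n; cbv beta. rewrite Rpower_m2 by (apply lt_0_INR; lia).
        rewrite pow_inv. reflexivity. }
  assert (Hs' : s' < 1) by lra.
  assert (Inc : forall e, 0 < e <= 1 / 2 ->
            A s b e - A s' b' e <= A s b (1 / 2) - A s' b' (1 / 2)).
  { intros e He.
    apply (derive_incr (fun x => A s b x - A s' b' x)
      (fun x => Rpower (sin (PI * x)) (- s) - Rpower (sin (PI * x)) (- s'))); [lra| |].
    - intros x Hx. apply (is_derive_minus (V := R_NormedModule) (A s b) (A s' b'));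
        apply DA; auto; lra.
    - intros x Hx. assert (0 < sin (PI * x)) by (apply sin_gt_0; nra).
      pose proof (SIN_bound (PI * x)).
      assert (Rpower (sin (PI * x)) (- s') <= Rpower (sin (PI * x)) (- s)); [|lra].
      replace (- s') with (- s + (s - s')) by ring. rewrite Rpower_plus.
      assert (Rpower (sin (PI * x)) (s - s') <= 1).
      { rewrite <- (Rpower_base1 (s - s')). apply Rpower_le_base; lra. }
      pose proof (Rpower_pos (sin (PI * x)) (- s)). nra. }
  assert (L : 0 - 0 <= A s b (1 / 2) - A s' b' (1 / 2)).
  { apply (is_lim_seq_le (fun n => A s b (/ INR (S (S n))) - A s' b' (/ INR (S (S n))))
      (fun _ => A s b (1 / 2) - A s' b' (1 / 2)) (Finite (0 - 0))
      (Finite (A s b (1 / 2) - A s' b' (1 / 2)))).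
    - intros n. apply Inc. assert (2 <= INR (S (S n))).
      { replace 2 with (INR 2) by (simpl; ring). apply le_INR; lia. }
      split; [apply Rinv_0_lt_compat; lra|].
      replace (1 / 2) with (/ 2) by field. apply Rinv_le_contravar; lra.
    - apply is_lim_seq_minus'; apply A0; assumption.
    - apply is_lim_seq_const. }
  unfold mean_sin, half_integral. unfold A in L. lra.
Qed.

(** * The Gamma function *)

Definition gint (x t : R) : R := Rpower t (x - 1) * exp (- t).

Lemma gint_pos x t : 0 < gint x t.
Proof. apply Rmult_lt_0_compat; [apply Rpower_pos | apply exp_pos]. Qed.

Lemma is_derive_pow_exp x t : 0 < t ->
  is_derive (fun t => Rpower t x * exp (- t)) t (x * gint x t - gint (x + 1) t).
Proof.
  intros Ht.
  replace (x * gint x t - gint (x + 1) t) with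
    (x * Rpower t (x - 1) * exp (- t) + Rpower t x * (- exp (- t))).
  - apply (is_derive_mult (K := R_AbsRing) (fun t => Rpower t x) (fun t => exp (- t)));
      [now apply is_derive_Rpower | | intros; apply Rmult_comm].
    auto_derive; [exact I|ring].
  - unfold gint. replace (x + 1 - 1) with x by ring. ring.
Qed.

Lemma continuous_gint x t : 0 < t -> continuous (gint x) t.
Proof.
  intros Ht. apply (ex_derive_continuous (K := R_AbsRing) (V := R_NormedModule)).
  eexists. apply (is_derive_pow_exp (x - 1)), Ht.
Qed.

Lemma ex_RInt_gint x a b : 0 < a -> a <= b -> ex_RInt (gint x) a b.
Proof.
  intros Ha Hab. apply (ex_RInt_continuous (V := R_CompleteNormedModule)).
  intros z Hz. apply continuous_gint.
  rewrite Rmin_left in Hz by lra. lra.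
Qed.

Lemma RInt_gint_nonneg x a b : 0 < a -> a <= b -> 0 <= RInt (gint x) a b.
Proof.
  intros Ha Hab. apply RInt_ge_0; [exact Hab|now apply ex_RInt_gint|].
  intros; apply Rlt_le, gint_pos.
Qed.

Lemma RInt_gint_Chasles x a b c : 0 < a -> a <= b -> b <= c ->
  RInt (gint x) a c = RInt (gint x) a b + RInt (gint x) b c.
Proof.
  intros. symmetry. apply (RInt_Chasles (V := R_CompleteNormedModule));
    apply ex_RInt_gint; lra.
Qed.

Lemma RInt_gint_mono x a b a' b' : 0 < a' -> a' <= a -> a <= b -> b <= b' ->
  RInt (gint x) a b <= RInt (gint x) a' b'.
Proof.
  intros. rewrite (RInt_gint_Chasles x a' a b'), (RInt_gint_Chasles x a b b') by lra.
  pose proof (RInt_gint_nonneg x a' a). pose proof (RInt_gint_nonneg x b b'). lra.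
Qed.

Lemma Rpower_le_exp c t : 0 < c -> 0 < t ->
  Rpower t c <= exp (c * ln c) * exp t.
Proof.
  intros Hc Ht. rewrite <- exp_plus. unfold Rpower. apply exp_le.
  assert (0 < t / c) by (apply Rdiv_lt_0_compat; lra).
  pose proof (exp_ineq1_le (ln (t / c))) as Q. rewrite exp_ln in Q by assumption.
  rewrite ln_div in Q by assumption.
  apply (Rmult_le_compat_l c) in Q; [|lra].
  replace (c * (t / c)) with t in Q by (field; lra). lra.
Qed.

(** The integrand is at most [t^(x-1)] on [(0,1]] and at most a multiple of
    [t^(-2)] on [[1, oo)]. *)
Lemma RInt_gint_bound x : 0 < x -> exists B, forall a b, 0 < a <= 1 -> 1 <= b ->
  RInt (gint x) a b <= B.
Proof.
  intros Hx. set (D := exp ((x + 1) * ln (x + 1))).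
  assert (HD : 0 < D) by apply exp_pos.
  exists (/ x + D). intros a b Ha Hb.
  rewrite (RInt_gint_Chasles x a 1 b) by lra. apply Rplus_le_compat.
  - assert (I1 : is_RInt (fun t => Rpower t (x - 1)) a 1
             (/ x * Rpower 1 x - / x * Rpower a x)).
    { apply (is_RInt_derive (V := R_CompleteNormedModule) (fun t => / x * Rpower t x)).
      - intros t Ht. rewrite Rmin_left in Ht by lra.
        replace (Rpower t (x - 1)) with (/ x * (x * Rpower t (x - 1))) by (field; lra).
        apply is_derive_scal_R, is_derive_Rpower; lra.
      - intros t Ht. rewrite Rmin_left in Ht by lra.
        apply (ex_derive_continuous (K := R_AbsRing) (V := R_NormedModule)).
        eexists; apply is_derive_Rpower; lra. }
    apply Rle_trans with (RInt (fun t => Rpower t (x - 1)) a 1).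
    + apply RInt_le; [lra|apply ex_RInt_gint; lra|eexists; exact I1|].
      intros t Ht. unfold gint. pose proof (Rpower_pos t (x - 1)).
      assert (exp (- t) <= 1) by (rewrite <- exp_0; apply exp_le; lra). nra.
    + rewrite (is_RInt_unique _ _ _ _ I1), Rpower_base1.
      assert (0 < / x) by (apply Rinv_0_lt_compat; lra).
      pose proof (Rpower_pos a x). nra.
  - assert (I1 : is_RInt (fun t => D * / t ^ 2) 1 b (- D * / b - - D * / 1)).
    { apply (is_RInt_derive (V := R_CompleteNormedModule) (fun t => - D * / t)).
      - intros t Ht. rewrite Rmin_left in Ht by lra.
        auto_derive; [lra|field; lra].
      - intros t Ht. rewrite Rmin_left in Ht by lra.
        apply (ex_derive_continuous (K := R_AbsRing) (V := R_NormedModule)).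
        auto_derive; nra. }
    apply Rle_trans with (RInt (fun t => D * / t ^ 2) 1 b).
    + apply RInt_le; [lra|apply ex_RInt_gint; lra|eexists; exact I1|].
      intros t Ht. unfold gint.
      pose proof (Rpower_le_exp (x + 1) t ltac:(lra) ltac:(lra)) as Q. fold D in Q.
      replace (Rpower t (x - 1)) with (Rpower t (x + 1) * / t ^ 2).
      2:{ rewrite <- Rpower_m2, <- Rpower_plus by lra. f_equal; ring. }
      assert (0 < / t ^ 2) by (apply Rinv_0_lt_compat, pow_lt; lra).
      assert (Rpower t (x + 1) * exp (- t) <= D).
      { apply Rle_trans with (D * exp t * exp (- t)).
        - apply Rmult_le_compat_r; [apply Rlt_le, exp_pos | exact Q].
        - rewrite Rmult_assoc, <- exp_plus, Rplus_opp_r, exp_0. lra. }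
      nra.
    + rewrite (is_RInt_unique _ _ _ _ I1), Rinv_1.
      assert (0 < / b) by (apply Rinv_0_lt_compat; lra). nra.
Qed.

Definition gint_seq (x : R) (n : nat) : R :=
  RInt (gint x) (/ INR (S n)) (INR (S n)).

Lemma inv_INR_S n : 0 < / INR (S n) <= 1 /\ 1 <= INR (S n).
Proof.
  assert (1 <= INR (S n)) by (apply INR_ge1; lia).
  split; [|assumption]. split; [apply Rinv_0_lt_compat; lra|].
  apply Rle_trans with (/ 1); [apply Rinv_le_contravar; lra | rewrite Rinv_1; lra].
Qed.

Lemma gint_seq_incr x n m : (n <= m)%nat -> gint_seq x n <= gint_seq x m.
Proof.
  intros Hnm. destruct (inv_INR_S n), (inv_INR_S m).
  assert (INR (S n) <= INR (S m)) by (apply le_INR; lia).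
  apply RInt_gint_mono; try lra. apply Rinv_le_contravar; lra.
Qed.

(** As the integrand is positive, the improper integral is the limit along any
    exhausting sequence of intervals. *)
Lemma Gamma_int_lim x : 0 < x -> is_lim_seq (gint_seq x) (Gamma_int x).
Proof.
  intros Hx. destruct (RInt_gint_bound x Hx) as [B HB].
  destruct (ex_finite_lim_seq_incr (gint_seq x) B) as [l Hl].
  - intros n; apply gint_seq_incr; lia.
  - intros n. apply HB; apply inv_INR_S.
  - assert (Hle : forall n, gint_seq x n <= l).
    { apply (is_lim_seq_incr_compare _ _ Hl). intros n; apply gint_seq_incr; lia. }
    replace (Gamma_int x) with l; [exact Hl|]. symmetry.
    assert (G : is_RInt_gen (gint x) (at_right 0) (Rbar_locally p_infty) l).
    2:{ unfold Gamma_int. exact (is_RInt_gen_unique (gint x) l G). }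
    intros P [eps HP].
    apply is_lim_seq_spec in Hl. destruct (Hl eps) as [N HN].
    specialize (HN N (le_n N)). destruct (inv_INR_S N) as [H1 H2].
    exists (fun a => 0 < a < / INR (S N)) (fun b => INR (S N) < b).
    + exists (mkposreal (/ INR (S N)) ltac:(lra)). intros a Ha Ha0.
      change (Rabs (a - 0) < / INR (S N)) in Ha. apply Rabs_lt_between in Ha. lra.
    + exists (INR (S N)); auto.
    + intros a b Ha Hb. exists (RInt (gint x) a b). split.
      * apply (RInt_correct (V := R_CompleteNormedModule)), ex_RInt_gint; simpl; lra.
      * apply HP. change (Rabs (RInt (gint x) a b - l) < eps).
        assert (L1 : gint_seq x N <= RInt (gint x) a b)
          by (apply RInt_gint_mono; lra).
        assert (L2 : RInt (gint x) a b <= l).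
        { destruct (INR_unbounded (b + / a)) as [m Hm].
          eapply Rle_trans; [|apply (Hle m)].
          assert (0 < / a) by (apply Rinv_0_lt_compat; lra).
          assert (b + / a < INR (S m)) by (rewrite S_INR; lra).
          apply RInt_gint_mono; try lra.
          - apply inv_INR_S.
          - rewrite <- (Rinv_inv a). apply Rinv_le_contravar; lra. }
        apply Rabs_lt_between in HN. apply Rabs_lt_between. lra.
Qed.

Lemma Gamma_int_pos x : 0 < x -> 0 < Gamma_int x.
Proof.
  intros Hx. apply Rlt_le_trans with (gint_seq x 1).
  - apply RInt_gt_0; simpl.
    + lra.
    + intros; apply gint_pos.
    + intros; apply continuous_gint; lra.
  - apply (is_lim_seq_incr_compare _ _ (Gamma_int_lim x Hx)).
    intros n; apply gint_seq_incr; lia.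
Qed.

Lemma Gamma_int_rec x : 0 < x -> Gamma_int (x + 1) = x * Gamma_int x.
Proof.
  intros Hx.
  pose (bd := fun t => Rpower t x * exp (- t)).
  assert (E : forall n, gint_seq (x + 1) n =
            x * gint_seq x n - (bd (INR (S n)) - bd (/ INR (S n)))).
  { intros n. destruct (inv_INR_S n) as [H1 H2]. unfold gint_seq.
    assert (I1 : is_RInt (fun t => x * gint x t - gint (x + 1) t)
              (/ INR (S n)) (INR (S n)) (bd (INR (S n)) - bd (/ INR (S n)))).
    { apply (is_RInt_derive (V := R_CompleteNormedModule) bd).
      - intros t Ht. rewrite Rmin_left in Ht by lra. apply is_derive_pow_exp; lra.
      - intros t Ht. rewrite Rmin_left in Ht by lra.
        apply (continuous_minus (V := R_NormedModule)
                 (fun t => x * gint x t) (gint (x + 1))).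
        + apply (continuous_scal_r (V := R_NormedModule) x (gint x)).
          apply continuous_gint; lra.
        + apply continuous_gint; lra. }
    assert (X0 := ex_RInt_gint x (/ INR (S n)) (INR (S n)) ltac:(lra) ltac:(lra)).
    assert (X1 := ex_RInt_gint (x + 1) (/ INR (S n)) (INR (S n)) ltac:(lra) ltac:(lra)).
    apply (RInt_correct (V := R_CompleteNormedModule)) in X0.
    apply (RInt_correct (V := R_CompleteNormedModule)) in X1.
    assert (I2 := is_RInt_minus _ _ _ _ _ _
                    (is_RInt_scal (V := R_NormedModule) _ _ _ x _ X0) X1).
    apply (is_RInt_unique (V := R_CompleteNormedModule)) in I1.
    apply (is_RInt_unique (V := R_CompleteNormedModule)) in I2.
    assert (Q : bd (INR (S n)) - bd (/ INR (S n)) =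
       x * RInt (gint x) (/ INR (S n)) (INR (S n)) -
       RInt (gint (x + 1)) (/ INR (S n)) (INR (S n))).
    { rewrite <- I1. exact I2. }
    lra. }
  assert (L0 : is_lim_seq (fun n => bd (INR (S n))) 0).
  { set (D := exp ((x + 1) * ln (x + 1))).
    apply (is_lim_seq_le_le (fun _ => 0) _ (fun n => D * Rpower (INR (S n)) (- (1)))).
    - intros n. destruct (inv_INR_S n) as [H1 H2]. unfold bd. split.
      + apply Rlt_le, Rmult_lt_0_compat; [apply Rpower_pos | apply exp_pos].
      + pose proof (Rpower_le_exp (x + 1) (INR (S n)) ltac:(lra) ltac:(lra)) as Q.
        fold D in Q.
        replace (Rpower (INR (S n)) x) with
          (Rpower (INR (S n)) (x + 1) * Rpower (INR (S n)) (- (1)))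
          by (rewrite <- Rpower_plus; f_equal; ring).
        pose proof (Rpower_pos (INR (S n)) (- (1))).
        assert (Rpower (INR (S n)) (x + 1) * exp (- INR (S n)) <= D); [|nra].
        apply Rle_trans with (D * exp (INR (S n)) * exp (- INR (S n))).
        * apply Rmult_le_compat_r; [apply Rlt_le, exp_pos | exact Q].
        * rewrite Rmult_assoc, <- exp_plus, Rplus_opp_r, exp_0. lra.
    - apply is_lim_seq_const.
    - replace (Finite 0) with (Finite (D * 0)) by (f_equal; ring).
      apply (is_lim_seq_scal_l _ D (Finite 0)), is_lim_seq_Rpower_neg; lra. }
  assert (L1 : is_lim_seq (fun n => bd (/ INR (S n))) 0).
  { apply (is_lim_seq_le_le (fun _ => 0) _ (fun n => Rpower (INR (S n)) (- x))).
    - intros n. destruct (inv_INR_S n) as [H1 H2]. unfold bd. split.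
      + apply Rlt_le, Rmult_lt_0_compat; [apply Rpower_pos | apply exp_pos].
      + replace (Rpower (/ INR (S n)) x) with (Rpower (INR (S n)) (- x)).
        2:{ unfold Rpower; rewrite ln_Rinv by lra. f_equal; ring. }
        pose proof (Rpower_pos (INR (S n)) (- x)).
        assert (exp (- / INR (S n)) <= 1) by (rewrite <- exp_0; apply exp_le; lra).
        nra.
    - apply is_lim_seq_const.
    - apply is_lim_seq_Rpower_neg; lra. }
  assert (L2 : is_lim_seq (gint_seq (x + 1)) (x * Gamma_int x - (0 - 0))).
  { eapply is_lim_seq_ext; [intros n; symmetry; apply E|].
    apply is_lim_seq_minus'.
    - apply (is_lim_seq_scal_l _ x (Finite (Gamma_int x))), Gamma_int_lim, Hx.
    - apply is_lim_seq_minus'; assumption. }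
  assert (L3 := Gamma_int_lim (x + 1) ltac:(lra)).
  apply is_lim_seq_unique in L2. apply is_lim_seq_unique in L3.
  rewrite L2 in L3. injection L3. intros <-. ring.
Qed.

(** Integrate [sqrt t <= (l + t/l)/2] with the best choice [l = sqrt x]. *)
Lemma Gamma_int_half x : 0 < x -> Gamma_int (x + 1 / 2) <= sqrt x * Gamma_int x.
Proof.
  intros Hx. set (l := sqrt x). assert (Hl : 0 < l) by (apply sqrt_lt_R0, Hx).
  assert (Hll : l * l = x) by (apply sqrt_def; lra).
  assert (Q : Gamma_int (x + 1 / 2) <= l / 2 * Gamma_int x + / (2 * l) * Gamma_int (x + 1)).
  { apply (is_lim_seq_le (gint_seq (x + 1 / 2))
      (fun n => l / 2 * gint_seq x n + / (2 * l) * gint_seq (x + 1) n)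
      (Finite (Gamma_int (x + 1 / 2)))
      (Finite (l / 2 * Gamma_int x + / (2 * l) * Gamma_int (x + 1)))).
    - intros n. destruct (inv_INR_S n) as [H1 H2]. unfold gint_seq.
      assert (X0 := ex_RInt_gint x (/ INR (S n)) (INR (S n)) ltac:(lra) ltac:(lra)).
      assert (X1 := ex_RInt_gint (x + 1) (/ INR (S n)) (INR (S n)) ltac:(lra) ltac:(lra)).
      apply (RInt_correct (V := R_CompleteNormedModule)) in X0.
      apply (RInt_correct (V := R_CompleteNormedModule)) in X1.
      assert (I2 := is_RInt_plus _ _ _ _ _ _
        (is_RInt_scal (V := R_NormedModule) _ _ _ (l / 2) _ X0)
        (is_RInt_scal (V := R_NormedModule) _ _ _ (/ (2 * l)) _ X1)).
      apply Rle_trans with (RInt (fun t => l / 2 * gint x t + / (2 * l) * gint (x + 1) t)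
                              (/ INR (S n)) (INR (S n))).
      + apply RInt_le; [lra|apply ex_RInt_gint; lra|eexists; exact I2|].
        intros t Ht. unfold gint.
        set (r := Rpower t (1 / 2)).
        assert (Hr : r * r = t).
        { unfold r. rewrite <- Rpower_plus. replace (1 / 2 + 1 / 2) with 1 by field.
          apply Rpower_1; lra. }
        replace (Rpower t (x + 1 / 2 - 1)) with (Rpower t (x - 1) * r)
          by (unfold r; rewrite <- Rpower_plus; f_equal; ring).
        replace (Rpower t (x + 1 - 1)) with (Rpower t (x - 1) * (r * r)).
        2:{ unfold r; rewrite <- !Rpower_plus; f_equal; field. }
        assert (0 < Rpower t (x - 1) * exp (- t)) by apply gint_pos.
        replace (l / 2 * (Rpower t (x - 1) * exp (- t)) +
          / (2 * l) * (Rpower t (x - 1) * (r * r) * exp (- t))) with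
          (Rpower t (x - 1) * exp (- t) * (r + (l - r) ^ 2 * / (2 * l)))
          by (field; lra).
        assert (0 <= (l - r) ^ 2 * / (2 * l)).
        { apply Rmult_le_pos; [apply pow2_ge_0|].
          apply Rlt_le, Rinv_0_lt_compat; lra. }
        nra.
      + right. apply (is_RInt_unique _ _ _ _ I2).
    - apply Gamma_int_lim; lra.
    - apply is_lim_seq_plus'.
      + apply (is_lim_seq_scal_l _ (l / 2) (Finite (Gamma_int x))), Gamma_int_lim, Hx.
      + apply (is_lim_seq_scal_l _ (/ (2 * l)) (Finite (Gamma_int (x + 1)))),
          Gamma_int_lim; lra. }
  rewrite Gamma_int_rec in Q by assumption. rewrite <- Hll in Q at 3.
  replace (l / 2 * Gamma_int x + / (2 * l) * (l * l * Gamma_int x)) with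
    (l * Gamma_int x) in Q by (field; lra).
  exact Q.
Qed.

Lemma Gamma_shift_pos x : 0 < x -> Gamma_shift x = O.
Proof.
  intros Hx. unfold Gamma_shift. destruct (archimed (- x)) as [_ A].
  assert (up (- x) < 1)%Z by (apply lt_IZR; lra).
  destruct (up (- x)); try reflexivity. lia.
Qed.

Lemma Gamma_shift_neg x : x <= 0 -> Gamma_shift x = S (Gamma_shift (x + 1)).
Proof.
  intros Hx. unfold Gamma_shift. destruct (archimed (- x)) as [A B].
  assert (0 < up (- x))%Z by (apply lt_IZR; lra).
  rewrite <- (tech_up (- (x + 1)) (up (- x) - 1)).
  - rewrite <- Z2Nat.inj_succ by lia. f_equal. lia.
  - rewrite minus_IZR. lra.
  - rewrite minus_IZR. lra.
Qed.

Lemma rising_S x m : rising x (S m) = x * rising (x + 1) m.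
Proof.
  unfold rising. simpl. rewrite <- seq_shift, map_map. rewrite Rplus_0_r.
  f_equal. f_equal. apply map_ext. intros k. rewrite S_INR. ring.
Qed.

Lemma Gamma_of_pos x : 0 < x -> Gamma x = Gamma_int x.
Proof.
  intros Hx. unfold Gamma. rewrite Gamma_shift_pos by assumption.
  unfold rising; simpl. rewrite Rplus_0_r. field.
Qed.

Lemma inv_Gamma_of_pos x : 0 < x -> inv_Gamma x = / Gamma_int x.
Proof.
  intros Hx. unfold inv_Gamma. rewrite Gamma_shift_pos by assumption.
  unfold rising; simpl. rewrite Rplus_0_r. field.
  apply Rgt_not_eq, Gamma_int_pos, Hx.
Qed.

(** To the left of 0 this is how [Gamma] is extended; to the right it is the
    functional equation of the integral. *)
Lemma Gamma_rec x : x <> 0 -> Gamma (x + 1) = x * Gamma x.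
Proof.
  intros Hx. destruct (Rlt_le_dec 0 x) as [Hp|Hn].
  - rewrite !Gamma_of_pos by lra. apply Gamma_int_rec, Hp.
  - unfold Gamma. rewrite (Gamma_shift_neg x Hn), rising_S, S_INR.
    replace (x + (INR (Gamma_shift (x + 1)) + 1)) with
      (x + 1 + INR (Gamma_shift (x + 1))) by ring.
    unfold Rdiv. rewrite Rinv_mult.
    replace (x * _) with (x * / x * (Gamma_int (x + 1 + INR (Gamma_shift (x + 1))) *
      / rising (x + 1) (Gamma_shift (x + 1)))) by ring.
    rewrite Rinv_r by assumption. ring.
Qed.

Lemma inv_Gamma_rec x : inv_Gamma x = x * inv_Gamma (x + 1).
Proof.
  destruct (Rlt_le_dec 0 x) as [Hp|Hn].
  - rewrite !inv_Gamma_of_pos, Gamma_int_rec by lra.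
    pose proof (Gamma_int_pos x Hp). field. lra.
  - unfold inv_Gamma. rewrite (Gamma_shift_neg x Hn), rising_S, S_INR.
    replace (x + (INR (Gamma_shift (x + 1)) + 1)) with
      (x + 1 + INR (Gamma_shift (x + 1))) by ring.
    unfold Rdiv. ring.
Qed.

Lemma inv_Gamma_pole k : inv_Gamma (- INR k) = 0.
Proof.
  induction k as [|k IH]; rewrite inv_Gamma_rec.
  - simpl. ring.
  - replace (- INR (S k) + 1) with (- INR k) by (rewrite S_INR; ring).
    rewrite IH. ring.
Qed.

Lemma v_even m : (1 <= m)%nat -> v (INR (2 * m)) = 0.
Proof.
  intros Hm. unfold v.
  replace (1 - INR (2 * m) / 2) with (- INR (m - 1)).
  - rewrite inv_Gamma_pole. ring.
  - rewrite minus_INR, mult_INR by assumption. simpl INR. field.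
Qed.

(** The same recursion as that of [mean_potential]. *)
Lemma v_rec s : s <> 1 -> 4 * (s - 1) * v s = (s - 2) * v (s - 2).
Proof.
  intros Hs. unfold v.
  assert (HPI : 0 < sqrt PI) by apply sqrt_lt_R0, PI_RGT_0.
  replace ((1 - (s - 2)) / 2) with ((1 - s) / 2 + 1) by field.
  rewrite (Gamma_rec ((1 - s) / 2)) by lra.
  rewrite (inv_Gamma_rec (1 - s / 2)).
  replace (1 - s / 2 + 1) with (1 - (s - 2) / 2) by field.
  replace (- (s - 2)) with (- s + INR 2) by (simpl; ring).
  rewrite (Rpower_plus (- s)), Rpower_pow by lra.
  field. lra.
Qed.

(** * The mean potential in terms of the Gamma function *)

(** Built two factors at a time, as in the recursion for [mean_sin]. *)
Fixpoint sinc_nat_coef (m : nat) : nat -> R :=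
  match m with
  | O => fun j => match j with O => 1 | S _ => 0 end
  | S O => sinc_coef
  | S (S m) => PS_mult (PS_mult (sinc_nat_coef m) sinc_coef) sinc_coef
  end.

Lemma sinc_power_series_pred2 s b : sinc_power_series s b ->
  sinc_power_series (s - 2) (PS_mult (PS_mult b sinc_coef) sinc_coef).
Proof.
  intros Hb. replace (s - 2) with (s - 1 - 1) by ring.
  now apply sinc_power_series_pred, sinc_power_series_pred.
Qed.

Lemma PSeries_delta y : is_pseries (sinc_nat_coef 0) y 1.
Proof.
  apply is_pseries_bigsum. apply is_lim_seq_incr_1.
  eapply is_lim_seq_ext; [|apply is_lim_seq_const]. intros n; cbv beta.
  rewrite bigsum_Sl, bigsum_0; simpl; [ring|]. intros; ring.
Qed.

Lemma sinc_nat_power_series m : sinc_power_series (- INR m) (sinc_nat_coef m).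
Proof.
  assert (P : sinc_power_series (- INR m) (sinc_nat_coef m) /\
              sinc_power_series (- INR (S m)) (sinc_nat_coef (S m))).
  { induction m as [|m [IH1 IH2]].
    - split; split.
      + apply radius_ge_1. intros; eexists; apply PSeries_delta.
      + intros x Hx. rewrite (is_pseries_unique _ _ _ (PSeries_delta _)).
        replace (- - INR 0) with 0 by (simpl; ring).
        rewrite Rpower_O; [reflexivity|]. apply sinc_pos, Hx.
      + apply radius_sinc_coef.
      + intros x Hx. simpl sinc_nat_coef.
        rewrite (is_pseries_unique _ _ _ (is_pseries_sinc_coef x ltac:(lra))).
        simpl. rewrite Ropp_involutive, Rpower_1; [reflexivity|].
        apply sinc_pos, Hx.
    - split; [exact IH2|].
      replace (- INR (S (S m))) with (- INR m - 2) by (rewrite !S_INR; ring).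
      now apply sinc_power_series_pred2. }
  apply P.
Qed.

(** The mean of [sin^m] over a half-period: Wallis' integral divided by PI. *)
Definition wallis (m : nat) : R := mean_sin (- INR m) (sinc_nat_coef m).

Lemma not_odd_lt1 s : s < 1 -> not_odd s.
Proof. intros Hs j. pose proof (pos_INR j). lra. Qed.

Lemma wallis_rec m : (INR m + 1) * wallis m = (INR m + 2) * wallis (S (S m)).
Proof.
  unfold wallis. pose proof (pos_INR m).
  assert (R := mean_sin_rec _ _ (not_odd_lt1 (- INR m) ltac:(lra))
                 (sinc_nat_power_series m)).
  replace (- INR (S (S m))) with (- INR m - 2) by (rewrite !S_INR; ring).
  cbn [sinc_nat_coef]. lra.
Qed.

Lemma wallis_0 : wallis 0 = 1.
Proof.
  unfold wallis, mean_sin, half_integral. simpl INR.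
  rewrite Ropp_0, Ropp_0, Rpower_O by apply PI_RGT_0.
  rewrite Rminus_0_r, Rpower_1 by lra.
  rewrite (PSeries_ext _ (sinc_nat_coef 0)).
  - rewrite (is_pseries_unique _ _ _ (PSeries_delta _)). field.
  - intros [|n]; unfold antider_coef; cbn [sinc_nat_coef]; [simpl; field | ring].
Qed.

(** Integrating the sine series gives the cosine series, which vanishes at
    [PI / 2]. *)
Lemma wallis_1 : wallis 1 = 2 / PI.
Proof.
  unfold wallis, mean_sin, half_integral. pose proof PI_RGT_0 as HPI.
  simpl sinc_nat_coef. replace (INR 1) with 1 by reflexivity.
  rewrite Ropp_involutive, Rpower_1 by assumption.
  replace (1 - - (1)) with (INR 2) by (simpl; ring). rewrite Rpower_pow by lra.
  assert (Hc : PSeries cos_coef ((1 / 2) ^ 2) = 0).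
  { rewrite (is_pseries_unique _ _ _ (is_pseries_cos_coef (1 / 2))).
    replace (PI * (1 / 2)) with (PI / 2) by field. apply cos_PI2. }
  rewrite PSeries_decr_1 in Hc.
  2:{ eexists; apply is_pseries_cos_coef. }
  replace (PSeries (PS_decr_1 cos_coef) ((1 / 2) ^ 2)) with
    (- PI ^ 2 * PSeries (antider_coef (- (1)) sinc_coef) ((1 / 2) ^ 2)) in Hc.
  - replace (cos_coef 0) with 1 in Hc by (unfold cos_coef, cos_n; simpl; field).
    set (X := PSeries (antider_coef (- (1)) sinc_coef) ((1 / 2) ^ 2)) in *.
    replace (2 * PI * ((1 / 2) ^ 2 * X)) with
      (2 / PI * ((1 / 2) ^ 2 * (PI ^ 2 * X))) by (field; lra).
    replace ((1 / 2) ^ 2 * (PI ^ 2 * X)) with 1 by lra. ring.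
  - rewrite <- PSeries_scal. apply PSeries_ext. intros n.
    unfold PS_scal, PS_decr_1, antider_coef, cos_coef, sinc_coef, cos_n, sin_n.
    change (scal ?x ?y) with (x * y).
    replace (2 * S n)%nat with (S (2 * n + 1)) by lia.
    rewrite (fact_simpl (2 * n + 1)), mult_INR.
    rewrite S_INR, plus_INR, mult_INR. simpl INR. simpl pow.
    assert (F := INR_fact_neq_0 (2 * n + 1)). pose proof (pos_INR n).
    field. split; [exact F|]. lra.
Qed.

Lemma wallis_pos m : 0 < wallis m.
Proof.
  assert (P : 0 < wallis m /\ 0 < wallis (S m)).
  { induction m as [|m [IH1 IH2]].
    - rewrite wallis_0, wallis_1. pose proof PI_RGT_0.
      split; [lra|]. apply Rdiv_lt_0_compat; lra.
    - split; [exact IH2|]. pose proof (wallis_rec m). pose proof (pos_INR m).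
      apply Rmult_lt_reg_l with (INR m + 2); [lra|]. nra. }
  apply P.
Qed.

Lemma wallis_product m : (INR m + 1) * (wallis m * wallis (S m)) = 2 / PI.
Proof.
  induction m as [|m IH].
  - rewrite wallis_0, wallis_1. simpl INR. ring.
  - rewrite <- IH, S_INR. pose proof (wallis_rec m) as E.
    replace ((INR m + 1 + 1) * (wallis (S m) * wallis (S (S m)))) with
      (wallis (S m) * ((INR m + 2) * wallis (S (S m)))) by ring.
    rewrite <- E. ring.
Qed.

Lemma wallis_decr m : wallis (S m) <= wallis m.
Proof.
  apply mean_sin_mono; try apply sinc_nat_power_series.
  - rewrite S_INR; lra.
  - pose proof (pos_INR m); lra.
Qed.

(** Monotonicity in the exponent squeezes [mean_sin] between consecutive
    Wallis integrals, whose products are known. *)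
Lemma mean_sin_bounds T b : 2 <= T -> sinc_power_series (- T) b ->
  2 / PI / (T + 2) <= mean_sin (- T) b ^ 2 <= 2 / PI / (T - 1).
Proof.
  intros HT Hb. pose proof PI_RGT_0 as HPI.
  destruct (nfloor_ex T ltac:(lra)) as [m [Hm1 Hm2]].
  destruct m as [|m]; [simpl in Hm2; lra|].
  assert (U : mean_sin (- T) b <= wallis (S m)).
  { apply mean_sin_mono; try assumption; try apply sinc_nat_power_series.
    - lra.
    - pose proof (pos_INR (S m)); lra. }
  assert (L : wallis (S (S m)) <= mean_sin (- T) b).
  { apply mean_sin_mono; try assumption; try apply sinc_nat_power_series.
    - rewrite (S_INR (S m)); lra.
    - lra. }
  pose proof (wallis_pos (S m)). pose proof (wallis_pos (S (S m))).
  pose proof (wallis_pos (S (S (S m)))).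
  pose proof (wallis_decr m). pose proof (wallis_decr (S (S m))).
  pose proof (wallis_product m) as P1. pose proof (wallis_product (S (S m))) as P2.
  assert (E : 0 < 2 / PI) by (apply Rdiv_lt_0_compat; lra).
  rewrite !S_INR in *. pose proof (pos_INR m).
  split.
  - apply Rle_trans with (wallis (S (S m)) * wallis (S (S (S m)))); [|nra].
    apply Rmult_le_reg_r with (T + 2); [lra|].
    replace (2 / PI / (T + 2) * (T + 2)) with (2 / PI) by (field; lra).
    rewrite <- P2.
    assert (0 < wallis (S (S m)) * wallis (S (S (S m)))) by nra. nra.
  - apply Rle_trans with (wallis m * wallis (S m)); [nra|].
    apply Rmult_le_reg_r with (T - 1); [lra|].
    replace (2 / PI / (T - 1) * (T - 1)) with (2 / PI) by (field; lra).
    rewrite <- P1.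
    assert (0 < wallis m * wallis (S m)) by (pose proof (wallis_pos m); nra). nra.
Qed.

(** [Gamma((1+T)/2) / (sqrt PI Gamma(1+T/2))], the value of Wallis' integral
    at a real exponent [T]. *)
Definition gamma_ratio (T : R) : R :=
  Gamma_int ((1 + T) / 2) / (sqrt PI * Gamma_int (1 + T / 2)).

Lemma gamma_ratio_rec T : -1 < T ->
  (T + 1) * gamma_ratio T = (T + 2) * gamma_ratio (T + 2).
Proof.
  intros HT. unfold gamma_ratio. pose proof PI_RGT_0.
  assert (0 < sqrt PI) by (apply sqrt_lt_R0; lra).
  replace ((1 + (T + 2)) / 2) with ((1 + T) / 2 + 1) by field.
  replace (1 + (T + 2) / 2) with (1 + T / 2 + 1) by field.
  rewrite !Gamma_int_rec by lra.
  pose proof (Gamma_int_pos (1 + T / 2) ltac:(lra)).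
  field. repeat split; lra.
Qed.

Lemma gamma_ratio_pos T : -1 < T -> 0 < gamma_ratio T.
Proof.
  intros HT. pose proof PI_RGT_0.
  apply Rdiv_lt_0_compat; [apply Gamma_int_pos; lra|].
  apply Rmult_lt_0_compat; [apply sqrt_lt_R0; lra | apply Gamma_int_pos; lra].
Qed.

(** Two applications of [Gamma_int_half] enclose [Gamma(x + 1/2) / Gamma(x)]. *)
Lemma gamma_ratio_bounds T : -1 < T ->
  2 / PI / (T + 1) <= gamma_ratio T ^ 2 <= 2 / PI * (T + 2) / (T + 1) ^ 2.
Proof.
  intros HT. pose proof PI_RGT_0 as HPI. unfold gamma_ratio.
  set (x := (1 + T) / 2). assert (Hx : 0 < x) by (unfold x; lra).
  replace (1 + T / 2) with (x + 1 / 2) by (unfold x; field).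
  assert (G1 := Gamma_int_half x Hx).
  assert (G2 := Gamma_int_half (x + 1 / 2) ltac:(lra)).
  replace (x + 1 / 2 + 1 / 2) with (x + 1) in G2 by field.
  rewrite Gamma_int_rec in G2 by assumption.
  assert (P1 := Gamma_int_pos x Hx). assert (P2 := Gamma_int_pos (x + 1 / 2) ltac:(lra)).
  set (a := Gamma_int x) in *. set (c := Gamma_int (x + 1 / 2)) in *.
  assert (S1 := sqrt_sqrt PI ltac:(lra)). assert (S2 := sqrt_sqrt x ltac:(lra)).
  assert (S3 := sqrt_sqrt (x + 1 / 2) ltac:(lra)).
  assert (Q1 : c ^ 2 <= x * a ^ 2).
  { replace (x * a ^ 2) with ((sqrt x * a) ^ 2) by (rewrite <- S2 at 2; ring).
    apply pow_incr; lra. }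
  assert (Q2 : x ^ 2 * a ^ 2 <= (x + 1 / 2) * c ^ 2).
  { replace ((x + 1 / 2) * c ^ 2) with ((sqrt (x + 1 / 2) * c) ^ 2)
      by (rewrite <- S3 at 2; ring).
    rewrite <- Rpow_mult_distr. apply pow_incr; split; [nra|exact G2]. }
  assert (E : (a / (sqrt PI * c)) ^ 2 = a ^ 2 / (PI * c ^ 2)).
  { rewrite <- S1 at 2. field. split; [lra|].
    apply Rgt_not_eq, sqrt_lt_R0; lra. }
  rewrite E.
  assert (Hc2 : 0 < c ^ 2) by (apply pow_lt; lra).
  assert (HPc : 0 < PI * c ^ 2) by (apply Rmult_lt_0_compat; lra).
  replace (T + 1) with (2 * x) by (unfold x; field).
  replace (T + 2) with (2 * x + 1) by (unfold x; field).
  split; apply Rmult_le_reg_r with (PI * c ^ 2 * x ^ 2);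
    try (apply Rmult_lt_0_compat; [exact HPc | apply pow_lt; lra]).
  - replace (2 / PI / (2 * x) * (PI * c ^ 2 * x ^ 2)) with (x * c ^ 2) by (field; lra).
    replace (a ^ 2 / (PI * c ^ 2) * (PI * c ^ 2 * x ^ 2)) with (x * (x * a ^ 2))
      by (field; lra). nra.
  - replace (a ^ 2 / (PI * c ^ 2) * (PI * c ^ 2 * x ^ 2)) with (x ^ 2 * a ^ 2)
      by (field; lra).
    replace (2 / PI * (2 * x + 1) / (2 * x) ^ 2 * (PI * c ^ 2 * x ^ 2)) with
      ((x + 1 / 2) * c ^ 2) by (field; lra). exact Q2.
Qed.

Fixpoint sinc_sq_iter (b : nat -> R) (n : nat) : nat -> R :=
  match n with
  | O => b
  | S n => PS_mult (PS_mult (sinc_sq_iter b n) sinc_coef) sinc_coef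
  end.

(** Both sides satisfy the same recursion [T -> T + 2], so their quotient is
    constant along [T, T + 2, T + 4, ...]; both are asymptotic to
    [sqrt (2 / (PI T))], so the quotient is 1. *)
Lemma mean_sin_gamma T b : -1 < T -> sinc_power_series (- T) b ->
  mean_sin (- T) b = gamma_ratio T.
Proof.
  intros HT Hb.
  pose (Tn := fun n => T + 2 * INR n).
  pose (w := fun n => mean_sin (- Tn n) (sinc_sq_iter b n)).
  pose (g := fun n => gamma_ratio (Tn n)).
  assert (Hbn : forall n, sinc_power_series (- Tn n) (sinc_sq_iter b n)).
  { induction n as [|n IH].
    - unfold Tn; simpl. replace (T + 2 * 0) with T by ring. exact Hb.
    - unfold Tn in *. rewrite S_INR.
      replace (- (T + 2 * (INR n + 1))) with (- (T + 2 * INR n) - 2) by ring.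
      now apply sinc_power_series_pred2. }
  assert (HTn : forall n, -1 < Tn n) by (intros n; unfold Tn;
    pose proof (pos_INR n); lra).
  assert (Const : forall n, w n * g O = w O * g n).
  { induction n as [|n IH]; [reflexivity|].
    assert (W : (Tn n + 1) * w n = (Tn n + 2) * w (S n)).
    { assert (R := mean_sin_rec _ _ (not_odd_lt1 (- Tn n) ltac:(specialize (HTn n); lra))
                     (Hbn n)).
      unfold w. replace (- Tn (S n)) with (- Tn n - 2)
        by (unfold Tn; rewrite S_INR; ring).
      cbn [sinc_sq_iter]. lra. }
    assert (G : (Tn n + 1) * g n = (Tn n + 2) * g (S n)).
    { unfold g. replace (Tn (S n)) with (Tn n + 2) by (unfold Tn; rewrite S_INR; ring).
      apply gamma_ratio_rec, HTn. }
    specialize (HTn n).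
    apply Rmult_eq_reg_l with (Tn n + 2); [|lra].
    rewrite <- !Rmult_assoc, <- W, Rmult_assoc, IH, (Rmult_comm _ (w O)),
      (Rmult_assoc (w O)), <- G. ring. }
  assert (Hg0 : 0 < g O) by (apply gamma_ratio_pos, HTn).
  assert (Hw0 : 0 < w O).
  { destruct (INR_unbounded T) as [m Hm].
    apply Rlt_le_trans with (wallis m); [apply wallis_pos|].
    unfold w, Tn. simpl. replace (T + 2 * 0) with T by ring.
    apply mean_sin_mono; [lra|lra|exact Hb|apply sinc_nat_power_series]. }
  assert (Sq : w O ^ 2 = g O ^ 2).
  { (* Both enclosures are 2/(PI T) up to a factor 1 + O(1/T); dividing them at
       Tn n bounds the constant quotient w/g from both sides. *)
    assert (B : forall n, 2 <= Tn n ->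
      g O ^ 2 * (Tn n + 1) ^ 2 <= w O ^ 2 * (Tn n + 2) ^ 2 /\
      w O ^ 2 * (Tn n - 1) <= g O ^ 2 * (Tn n + 1)).
    { intros n Hn. set (t := Tn n) in *. pose proof PI_RGT_0 as HPI.
      destruct (mean_sin_bounds t _ Hn (Hbn n)) as [M1 M2].
      change (mean_sin (- t) (sinc_sq_iter b n)) with (w n) in M1, M2.
      destruct (gamma_ratio_bounds t ltac:(lra)) as [G1 G2].
      change (gamma_ratio t) with (g n) in G1, G2.
      assert (C2 : w n ^ 2 * g O ^ 2 = w O ^ 2 * g n ^ 2).
      { rewrite <- !Rpow_mult_distr, Const. reflexivity. }
      assert (E : 0 < 2 / PI) by (apply Rdiv_lt_0_compat; lra).
      assert (Hw2 : 0 < w O ^ 2) by (apply pow_lt; lra).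
      assert (Hg2 : 0 < g O ^ 2) by (apply pow_lt; lra).
      split.
      - assert (Q : 2 / PI / (t + 2) * g O ^ 2 <=
                    w O ^ 2 * (2 / PI * (t + 2) / (t + 1) ^ 2)).
        { apply Rle_trans with (w n ^ 2 * g O ^ 2).
          - apply Rmult_le_compat_r; lra.
          - rewrite C2. apply Rmult_le_compat_l; lra. }
        apply (Rmult_le_compat_r (PI / 2 * (t + 2) * (t + 1) ^ 2)) in Q.
        + replace (2 / PI / (t + 2) * g O ^ 2 * (PI / 2 * (t + 2) * (t + 1) ^ 2))
            with (g O ^ 2 * (t + 1) ^ 2) in Q by (field; lra).
          replace (w O ^ 2 * (2 / PI * (t + 2) / (t + 1) ^ 2) *
                   (PI / 2 * (t + 2) * (t + 1) ^ 2)) with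
            (w O ^ 2 * (t + 2) ^ 2) in Q by (field; lra). exact Q.
        + apply Rmult_le_pos; [nra|apply pow_le; lra].
      - assert (Q : w O ^ 2 * (2 / PI / (t + 1)) <= 2 / PI / (t - 1) * g O ^ 2).
        { apply Rle_trans with (w n ^ 2 * g O ^ 2).
          - rewrite C2. apply Rmult_le_compat_l; lra.
          - apply Rmult_le_compat_r; lra. }
        apply (Rmult_le_compat_r (PI / 2 * (t - 1) * (t + 1))) in Q; 
          [|apply Rmult_le_pos; [apply Rmult_le_pos|]; lra].
        replace (w O ^ 2 * (2 / PI / (t + 1)) * (PI / 2 * (t - 1) * (t + 1))) with
          (w O ^ 2 * (t - 1)) in Q by (field; lra).
        replace (2 / PI / (t - 1) * g O ^ 2 * (PI / 2 * (t - 1) * (t + 1))) with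
          (g O ^ 2 * (t + 1)) in Q by (field; lra). exact Q. }
    set (W := w O ^ 2) in *. set (G := g O ^ 2) in *.
    assert (HW : 0 < W) by (apply pow_lt; lra).
    assert (HG : 0 < G) by (apply pow_lt; lra).
    assert (Big : forall X, exists n, X < Tn n /\ 2 <= Tn n).
    { intros X. destruct (INR_unbounded (Rabs X + 3)) as [n Hn]. exists n.
      unfold Tn. pose proof (Rle_abs X). pose proof (Rabs_pos X). lra. }
    destruct (Rtotal_order W G) as [Hlt|[E|Hlt]]; [exfalso|exact E|exfalso].
    - destruct (Big (3 * W / (G - W))) as [n [Hn Hn2]].
      destruct (B n Hn2) as [B1 _].
      apply (Rmult_lt_compat_r (G - W)) in Hn; [|lra].
      replace (3 * W / (G - W) * (G - W)) with (3 * W) in Hn by (field; lra).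
      set (t := Tn n) in *. nra.
    - destruct (Big (3 * (W + G) / (W - G))) as [n [Hn Hn2]].
      destruct (B n Hn2) as [_ B1].
      apply (Rmult_lt_compat_r (W - G)) in Hn; [|lra].
      replace (3 * (W + G) / (W - G) * (W - G)) with (3 * (W + G)) in Hn
        by (field; lra).
      set (t := Tn n) in *. nra. }
  assert (Fin : w O = g O).
  { apply Rsqr_inj; try lra. unfold Rsqr. lra. }
  unfold w, g, Tn in Fin. simpl in Fin.
  replace (T + 2 * 0) with T in Fin by ring. exact Fin.
Qed.

Lemma mean_potential_base s b : s < 1 -> sinc_power_series s b ->
  mean_potential s b = v s.
Proof.
  intros Hs Hb. rewrite mean_potential_sin.
  assert (E := mean_sin_gamma (- s) b ltac:(lra)). rewrite Ropp_involutive in E.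
  rewrite (E Hb). unfold v, gamma_ratio.
  rewrite Gamma_of_pos, inv_Gamma_of_pos by lra.
  replace (1 + - s) with (1 - s) by ring. replace (1 + - s / 2) with (1 - s / 2) by field.
  pose proof (Gamma_int_pos (1 - s / 2) ltac:(lra)). pose proof PI_RGT_0.
  field. split; [lra|]. apply Rgt_not_eq, sqrt_lt_R0; lra.
Qed.

(** The common recursion in [s] reduces the claim to [s < 1]. *)
Lemma mean_potential_v s b : not_odd s -> sinc_power_series s b ->
  mean_potential s b = v s.
Proof.
  destruct (INR_unbounded s) as [n Hn].
  assert (Hn' : s < 2 * INR n + 1) by (pose proof (pos_INR n); lra).
  clear Hn. revert s b Hn'. induction n as [|n IH]; intros s b Hn Hs Hb.
  - apply mean_potential_base; [simpl in Hn; lra | exact Hb].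
  - destruct (Rlt_le_dec s 1) as [|Hs1]; [now apply mean_potential_base|].
    assert (Hne : s <> 1) by (specialize (Hs O); simpl in Hs; lra).
    assert (E : mean_potential (s - 2) (PS_mult (PS_mult b sinc_coef) sinc_coef) = v (s - 2)).
    { apply IH.
      - rewrite S_INR in Hn; lra.
      - intros j. specialize (Hs (S j)). rewrite S_INR in Hs. lra.
      - now apply sinc_power_series_pred2. }
    apply Rmult_eq_reg_l with (4 * (s - 1)); [|lra].
    rewrite v_rec by assumption. rewrite <- E, !mean_potential_sin.
    replace (- (s - 2)) with (- s + INR 2) by (simpl; ring).
    rewrite Rpower_plus, Rpower_pow by lra.
    assert (R := mean_sin_rec s b Hs Hb).
    replace (4 * (s - 1) * (Rpower 2 (- s) * mean_sin s b)) with
      (- 4 * Rpower 2 (- s) * ((1 - s) * mean_sin s b)) by ring.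
    rewrite R. ring.
Qed.

(** * Exactness for even exponents *)

(** Polynomials of degree below [K] in [4^n]. *)
Definition exp4_poly (K : nat) (x : nat -> R) : Prop :=
  exists e : nat -> R, forall n, x n = bigsum (fun j => e j * 4 ^ (j * n)) K.

Lemma exp4_poly_weaken K L x : (K <= L)%nat -> exp4_poly K x -> exp4_poly L x.
Proof.
  intros HKL [e He]. exists (fun j => if lt_dec j K then e j else 0). intros n.
  rewrite He. replace L with (K + (L - K))%nat by lia.
  rewrite bigsum_add, (bigsum_0 _ (L - K)).
  - rewrite Rplus_0_r. apply bigsum_ext; intros i Hi.
    destruct (lt_dec i K); [reflexivity|lia].
  - intros i Hi. destruct (lt_dec (K + i) K); [lia|ring].
Qed.

Lemma exp4_poly_plus K x y : exp4_poly K x -> exp4_poly K y ->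
  exp4_poly K (fun n => x n + y n).
Proof.
  intros [e He] [f Hf]. exists (fun j => e j + f j). intros n.
  rewrite He, Hf, <- bigsum_plus. apply bigsum_ext; intros; ring.
Qed.

Lemma exp4_poly_scal K c x : exp4_poly K x -> exp4_poly K (fun n => c * x n).
Proof.
  intros [e He]. exists (fun j => c * e j). intros n.
  rewrite He, <- bigsum_scal. apply bigsum_ext; intros; ring.
Qed.

Lemma exp4_poly_const K c : exp4_poly (S K) (fun _ => c).
Proof.
  exists (fun j => match j with O => c | S _ => 0 end). intros n.
  rewrite bigsum_Sl, (bigsum_0 _ K); simpl; [ring|]. intros; ring.
Qed.

Lemma exp4_poly_sum K (x : nat -> nat -> R) k :
  (forall i, (i < k)%nat -> exp4_poly (S K) (x i)) ->
  exp4_poly (S K) (fun n => bigsum (fun i => x i n) k).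
Proof.
  induction k as [|k IH]; intros Hx; simpl.
  - apply exp4_poly_const.
  - apply (exp4_poly_plus _ (fun n => bigsum (fun i => x i n) k)).
    + apply IH; intros; apply Hx; lia.
    + apply Hx; lia.
Qed.

Lemma pow4_neq j K : (j < K)%nat -> 4 ^ j - 4 ^ K <> 0.
Proof.
  intros Hj. assert (4 ^ j < 4 ^ K); [|lra]. apply Rlt_pow; [lra|exact Hj].
Qed.

(** As [4^j <> 4^K] for [j < K], some combination of the lower exponentials
    satisfies the recursion, and it can be corrected by a multiple of
    [4^(K n)]. *)
Lemma exp4_poly_rec K x d : exp4_poly K d ->
  (forall n, x (S n) = 4 ^ K * x n + d n) -> exp4_poly (S K) x.
Proof.
  intros [e He] Hx.
  pose (f := fun j => e j / (4 ^ j - 4 ^ K)).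
  exists (fun j => if lt_dec j K then f j else x O - bigsum f K).
  assert (E : forall n, x n = bigsum (fun j => f j * 4 ^ (j * n)) K +
                              (x O - bigsum f K) * 4 ^ (K * n)).
  { induction n as [|n IH].
    - rewrite Nat.mul_0_r, (bigsum_ext (fun j => f j * 4 ^ (j * 0)) f).
      + simpl; ring.
      + intros; rewrite Nat.mul_0_r; simpl; ring.
    - rewrite Hx, IH, He.
      rewrite (bigsum_ext (fun j => f j * 4 ^ (j * S n))
                 (fun j => 4 ^ K * (f j * 4 ^ (j * n)) + e j * 4 ^ (j * n))).
      + rewrite bigsum_plus, bigsum_scal.
        rewrite Nat.mul_succ_r, pow_add. ring.
      + intros j Hj. rewrite Nat.mul_succ_r, pow_add. unfold f. field.
        now apply pow4_neq. }
  intros n. rewrite E. simpl. destruct (lt_dec K K); [lia|]. f_equal.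
  apply bigsum_ext; intros j Hj. destruct (lt_dec j K); [reflexivity|lia].
Qed.

(** Differences in [n] remove the constant term; what is left is divisible by
    [4^n], and the quotient still tends to 0. *)
Lemma exp4_poly_lim0 K g :
  is_lim_seq (fun n => bigsum (fun j => g j * 4 ^ (j * n)) K) 0 ->
  forall j, (j < K)%nat -> g j = 0.
Proof.
  revert g. induction K as [|K IH]; intros g L; [intros; lia|].
  set (X := fun n => bigsum (fun j => g j * 4 ^ (j * n)) (S K)) in L.
  assert (Z : forall j, (j < K)%nat -> g (S j) * (4 ^ S j - 1) = 0).
  { apply (IH (fun j => g (S j) * (4 ^ S j - 1))).
    apply is_lim_seq_abs_0.
    apply (is_lim_seq_le_le (fun _ => 0) _ (fun n => Rabs (X (S n) - X n))).
    - intros n. split; [apply Rabs_pos|].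
      replace (X (S n) - X n) with
        (4 ^ n * bigsum (fun j => g (S j) * (4 ^ S j - 1) * 4 ^ (j * n)) K).
      + rewrite Rabs_mult, (Rabs_pos_eq (4 ^ n)) by (apply pow_le; lra).
        assert (1 <= 4 ^ n) by (apply pow_R1_Rle; lra).
        pose proof (Rabs_pos (bigsum (fun j => g (S j) * (4 ^ S j - 1) * 4 ^ (j * n)) K)).
        nra.
      + unfold X. rewrite !bigsum_Sl, <- bigsum_scal. simpl Nat.mul at 1.
        rewrite !Nat.mul_0_l.
        replace (g 0%nat * 4 ^ 0 + bigsum (fun i => g (S i) * 4 ^ (S i * S n)) K -
          (g 0%nat * 4 ^ 0 + bigsum (fun i => g (S i) * 4 ^ (S i * n)) K)) with
          (bigsum (fun i => g (S i) * 4 ^ (S i * S n)) K -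
           bigsum (fun i => g (S i) * 4 ^ (S i * n)) K) by ring.
        rewrite <- bigsum_minus. apply bigsum_ext; intros j _.
        replace (S j * S n)%nat with (S j + (n + j * n))%nat by lia.
        replace (S j * n)%nat with (n + j * n)%nat by lia.
        rewrite !pow_add. simpl. ring.
    - apply is_lim_seq_const.
    - apply (proj1 (is_lim_seq_abs_0 (fun n => X (S n) - X n))).
      replace (Finite 0) with (Finite (0 - 0)) by (f_equal; ring).
      apply is_lim_seq_minus'; [|exact L]. now apply is_lim_seq_incr_1 in L. }
  assert (G : forall j, (j < K)%nat -> g (S j) = 0).
  { intros j Hj. specialize (Z j Hj). apply Rmult_integral in Z.
    destruct Z as [Z|Z]; [exact Z|]. exfalso.
    assert (1 < 4 ^ S j) by (apply Rlt_pow_R1; [lra|lia]). lra. }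
  assert (G0 : g O = 0).
  { assert (L' : is_lim_seq X (g O)).
    { eapply is_lim_seq_ext; [|apply is_lim_seq_const]. intros n. unfold X.
      rewrite bigsum_Sl, (bigsum_0 _ K).
      - simpl; ring.
      - intros i Hi. rewrite G by assumption. ring. }
    apply is_lim_seq_unique in L. apply is_lim_seq_unique in L'.
    rewrite L in L'. injection L'; auto. }
  intros [|j] Hj; [exact G0|]. apply G; lia.
Qed.

(** The power sums [y1^m + y2^m] when [y1 + y2 = 4 y] and [y1 y2 = y]. *)
Fixpoint power_sum (m : nat) (y : R) : R :=
  match m with
  | O => 2
  | S O => 4 * y
  | S ((S m) as m1) => 4 * y * power_sum m1 y - y * power_sum m y
  end.

Lemma power_sum_correct y1 y2 y m : y1 + y2 = 4 * y -> y1 * y2 = y ->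
  y1 ^ m + y2 ^ m = power_sum m y.
Proof.
  intros Hs Hp.
  assert (P : y1 ^ m + y2 ^ m = power_sum m y /\
              y1 ^ S m + y2 ^ S m = power_sum (S m) y).
  { induction m as [|m [IH1 IH2]].
    - simpl. split; [ring|lra].
    - split; [exact IH2|].
      change (power_sum (S (S m)) y) with
        (4 * y * power_sum (S m) y - y * power_sum m y).
      rewrite <- IH1, <- IH2, <- Hs. rewrite <- Hp. simpl. ring. }
  apply P.
Qed.

(** The constant term vanishes, which matters because [csc_sum 0 (2^n) = 2^n - 1]
    is not a polynomial in [4^n]. *)
Lemma power_sum_leading k : exists c : nat -> R, forall y,
  power_sum (S k) y = 4 ^ S k * y ^ S k + bigsum (fun i => c i * y ^ S i) k.
Proof.
  assert (P : (exists c : nat -> R, forall y,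
      power_sum (S k) y = 4 ^ S k * y ^ S k + bigsum (fun i => c i * y ^ S i) k) /\
    (exists c : nat -> R, forall y,
      power_sum (S (S k)) y =
      4 ^ S (S k) * y ^ S (S k) + bigsum (fun i => c i * y ^ S i) (S k))).
  { induction k as [|k [[d Hd] [c Hc]]].
    - split.
      + exists (fun _ => 0). intros y. simpl. ring.
      + exists (fun _ => -2). intros y. simpl. ring.
    - split; [now exists c|].
      exists (fun i => match i with
                       | O => 0
                       | S i => 4 * c i - (if lt_dec i k then d i else 4 ^ S k)
                       end).
      intros y.
      change (power_sum (S (S (S k))) y) with
        (4 * y * power_sum (S (S k)) y - y * power_sum (S k) y).
      rewrite Hc, Hd, (bigsum_Sl _ (S k)). cbv beta iota.
      rewrite (bigsum_ext
        (fun i => (4 * c i - (if lt_dec i k then d i else 4 ^ S k)) * y ^ S (S i))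
        (fun i => 4 * y * (c i * y ^ S i) -
           y * ((if lt_dec i k then d i else 4 ^ S k) * y ^ S i)))
        by (intros; simpl; ring).
      rewrite bigsum_minus, !bigsum_scal.
      replace (bigsum (fun i => (if lt_dec i k then d i else 4 ^ S k) * y ^ S i) (S k))
        with (bigsum (fun i => d i * y ^ S i) k + 4 ^ S k * y ^ S k).
      + simpl. ring.
      + cbn [bigsum]. destruct (lt_dec k k); [lia|]. f_equal.
        apply bigsum_ext; intros i Hi. destruct (lt_dec i k); [reflexivity|lia]. }
  apply P.
Qed.

Definition csc_sum (m M : nat) : R :=
  bigsum (fun i => (/ (2 * sin (PI * INR (S i) / INR M)) ^ 2) ^ m) (M - 1).

(** Halving angles: [1/(2 sin t)^2] and [1/(2 cos t)^2] have sum [4 y] and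
    product [y], where [y = 1/(2 sin 2t)^2]. *)
Lemma csc_sum_double m M : (0 < M)%nat ->
  csc_sum m (2 * M) = (1 / 4) ^ m +
    bigsum (fun i => power_sum m (/ (2 * sin (PI * INR (S i) / INR M)) ^ 2)) (M - 1).
Proof.
  intros HM. unfold csc_sum. pose proof PI_RGT_0 as HPI.
  assert (HM0 : 0 < INR M) by (apply lt_0_INR; lia).
  assert (E2 : INR (2 * M) = 2 * INR M) by (rewrite mult_INR; simpl INR; ring).
  set (g := fun k => (/ (2 * sin (PI * INR k / INR (2 * M))) ^ 2) ^ m).
  change (bigsum (fun i => g (S i)) (2 * M - 1) = (1 / 4) ^ m +
    bigsum (fun i => power_sum m (/ (2 * sin (PI * INR (S i) / INR M)) ^ 2)) (M - 1)).
  replace (2 * M - 1)%nat with ((M - 1) + (1 + (M - 1)))%nat by lia.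
  rewrite !bigsum_add.
  replace (bigsum (fun i => g (S (M - 1 + i))) 1) with ((1 / 4) ^ m).
  2:{ simpl bigsum. rewrite Rplus_0_l. replace (S (M - 1 + 0)) with M by lia.
      unfold g. replace (PI * INR M / INR (2 * M)) with (PI / 2)
        by (rewrite E2; field; lra).
      rewrite sin_PI2. f_equal. field. }
  rewrite (bigsum_ext (fun i => power_sum m _)
    (fun i => g (S i) + g (S (M - 1 + (1 + i))))).
  - rewrite bigsum_plus. ring.
  - intros i Hi. unfold g.
    replace (S (M - 1 + (1 + i))) with (M + S i)%nat by lia.
    set (k := INR (S i)).
    assert (Hk : 0 < k < INR M).
    { split; [apply lt_0_INR; lia | apply lt_INR; lia]. }
    set (t := PI * k / INR (2 * M)).
    replace (PI * INR (M + S i) / INR (2 * M)) with (PI / 2 + t)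
      by (unfold t; rewrite plus_INR, E2; fold k; field; lra).
    replace (PI * k / INR M) with (2 * t) by (unfold t; rewrite E2; field; lra).
    assert (Ht : 0 < t < PI / 2).
    { unfold t; rewrite E2. split; [apply Rdiv_lt_0_compat; nra|].
      apply Rmult_lt_reg_r with (2 * INR M); [lra|].
      replace (PI * k / (2 * INR M) * (2 * INR M)) with (PI * k) by (field; lra).
      replace (PI / 2 * (2 * INR M)) with (PI * INR M) by field. nra. }
    assert (Hs : 0 < sin t) by (apply sin_gt_0; lra).
    assert (Hc : 0 < cos t) by (apply cos_gt_0; lra).
    rewrite sin_plus, sin_PI2, cos_PI2, Rmult_1_l, Rmult_0_l, Rplus_0_r, sin_2a.
    symmetry. apply power_sum_correct.
    + pose proof (sin2_cos2 t) as Q. unfold Rsqr in Q.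
      replace (/ (2 * sin t) ^ 2 + / (2 * cos t) ^ 2) with
        ((sin t * sin t + cos t * cos t) / (4 * sin t ^ 2 * cos t ^ 2))
        by (field; lra).
      rewrite Q. field. lra.
    + field. lra.
Qed.

Lemma csc_sum_exp4 k : exp4_poly (S (S k)) (fun n => csc_sum (S k) (2 ^ n)).
Proof.
  induction k as [k IH] using (well_founded_induction lt_wf).
  destruct (power_sum_leading k) as [c Hc].
  apply (exp4_poly_rec (S k) _ (fun n => (1 / 4) ^ S k +
           bigsum (fun i => c i * csc_sum (S i) (2 ^ n)) k)).
  - apply exp4_poly_plus; [apply exp4_poly_const|].
    apply (exp4_poly_sum k (fun i n => c i * csc_sum (S i) (2 ^ n))).
    intros i Hi. apply exp4_poly_scal.
    apply (exp4_poly_weaken (S (S i))); [lia|]. apply IH, Hi.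
  - intros n. change (2 ^ S n)%nat with (2 * 2 ^ n)%nat.
    rewrite csc_sum_double by (pose proof (Nat.pow_nonzero 2 n); lia).
    rewrite (bigsum_ext (fun i => power_sum (S k) _)
      (fun i => 4 ^ S k * (/ (2 * sin (PI * INR (S i) / INR (2 ^ n))) ^ 2) ^ S k +
         bigsum (fun j => c j * (/ (2 * sin (PI * INR (S i) / INR (2 ^ n))) ^ 2) ^ S j) k))
      by (intros; apply Hc).
    rewrite bigsum_plus, bigsum_scal. fold (csc_sum (S k) (2 ^ n)).
    replace (bigsum (fun i => bigsum _ k) (2 ^ n - 1)) with
      (bigsum (fun i => c i * csc_sum (S i) (2 ^ n)) k); [ring|].
    unfold csc_sum. generalize (2 ^ n - 1)%nat as N. intros N.
    induction N as [|N IHN]; cbn [bigsum].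
    + apply bigsum_0; intros; ring.
    + rewrite <- IHN, <- bigsum_plus. apply bigsum_ext; intros; ring.
Qed.

Lemma root_sum_csc m M : root_sum (INR (2 * m)) M = csc_sum m M.
Proof.
  unfold root_sum, csc_sum. apply bigsum_ext; intros i Hi.
  assert (HM : 0 < INR M) by (apply lt_0_INR; lia).
  assert (0 < sin (PI * INR (S i) / INR M)).
  { pose proof PI_RGT_0. assert (0 < INR (S i) < INR M).
    { split; [apply lt_0_INR; lia | apply lt_INR; lia]. }
    apply sin_gt_0.
    - apply Rdiv_lt_0_compat; nra.
    - apply Rmult_lt_reg_r with (INR M); [lra|].
      replace (PI * INR (S i) / INR M * INR M) with (PI * INR (S i)) by (field; lra).
      nra. }
  rewrite Rpower_Ropp, Rpower_pow, pow_mult, pow_inv by lra. reflexivity.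
Qed.

Lemma is_lim_seq_pow2_neg a : 0 < a ->
  is_lim_seq (fun n => Rpower (2 ^ n) (- a)) 0.
Proof.
  intros Ha. apply (is_lim_seq_ext (fun n => (Rpower 2 (- a)) ^ n)).
  - intros n. rewrite <- (Rpower_pow n (Rpower 2 (- a))) by apply Rpower_pos.
    rewrite <- (Rpower_pow n 2) by lra. rewrite !Rpower_mult. f_equal; ring.
  - apply is_lim_seq_geom. rewrite Rabs_pos_eq by (apply Rlt_le, Rpower_pos).
    rewrite Rpower_Ropp. rewrite <- Rinv_1. apply Rinv_lt_contravar.
    + rewrite Rmult_1_l; apply Rpower_pos.
    + rewrite <- (Rpower_O 2) by lra. apply Rpower_lt; lra.
Qed.

Lemma INR_pow2 n : INR (2 ^ n) = 2 ^ n.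
Proof. rewrite pow_INR. reflexivity. Qed.

(** Along powers of two both sides are polynomials in [4^n], and their
    difference tends to 0, so it vanishes. *)
Lemma root_sum_even m b zeta n : (1 <= m)%nat ->
  sinc_power_series (INR (2 * m)) b -> is_riemann_zeta zeta ->
  root_sum (INR (2 * m)) (2 ^ n) = root_main (INR (2 * m)) b zeta m (2 ^ n).
Proof.
  intros Hm Hb Hz. set (s := INR (2 * m)).
  assert (Es : s = 2 * INR m) by (unfold s; rewrite mult_INR; simpl INR; ring).
  assert (Hs : not_odd s).
  { intros j E. rewrite Es in E.
    assert (2 * INR j + 1 = 2 * INR m) as E' by lra.
    assert (INR (2 * j + 1) = INR (2 * m)) as E''.
    { rewrite plus_INR, !mult_INR. simpl INR. lra. }
    apply INR_eq in E''. lia. }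
  destruct (root_sum_asymptotic s b zeta m 1 Hs Hb Hz ltac:(lra)) as [W HW].
  { intros j Hj. apply le_INR in Hj. lra. }
  { intros j Hj. apply (le_INR (S m)) in Hj. rewrite S_INR in Hj. lra. }
  assert (Hv : mean_potential s b = 0).
  { rewrite mean_potential_v by assumption. now apply v_even. }
  destruct m as [|k]; [lia|].
  destruct (csc_sum_exp4 k) as [e He].
  pose (f := fun j => 2 / Rpower (2 * PI) s *
               (b (S k - j)%nat * Re (zeta (RtoC (s - 2 * INR (S k - j)))))).
  assert (Main : forall n, root_main s b zeta (S k) (2 ^ n) =
            bigsum (fun j => f j * 4 ^ (j * n)) (S (S k))).
  { intros i. unfold root_main. rewrite Hv, Rmult_0_l, Rplus_0_l.
    rewrite <- bigsum_rev, <- bigsum_scal. apply bigsum_ext; intros j Hj.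
    replace (S (S k) - 1 - j)%nat with (S k - j)%nat by lia.
    assert (Pw : Rpower (2 ^ i) (s - 2 * INR (S k - j)) = 4 ^ (j * i)).
    { replace (s - 2 * INR (S k - j)) with (INR (2 * j)).
      - rewrite Rpower_pow by (apply pow_lt; lra).
        rewrite <- pow_mult. replace 4 with (2 ^ 2) by ring. rewrite <- pow_mult.
        f_equal. lia.
      - rewrite minus_INR, mult_INR, Es by lia. simpl (INR 2). ring. }
    rewrite Pw. unfold f. ring. }
  assert (Diff : forall n, root_sum s (2 ^ n) - root_main s b zeta (S k) (2 ^ n) =
            bigsum (fun j => (e j - f j) * 4 ^ (j * n)) (S (S k))).
  { intros i. rewrite Main. unfold s. rewrite root_sum_csc, He, <- bigsum_minus.
    apply bigsum_ext; intros; ring. }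
  assert (Z : forall j, (j < S (S k))%nat -> e j - f j = 0).
  { apply (exp4_poly_lim0 (S (S k)) (fun j => e j - f j)).
    apply is_lim_seq_incr_1.
    apply (is_lim_seq_ext (fun n => root_sum s (2 ^ S n) -
             root_main s b zeta (S k) (2 ^ S n))); [intros; apply Diff|].
    apply is_lim_seq_abs_0.
    apply (is_lim_seq_le_le (fun _ => 0) _ (fun n => W * Rpower (2 ^ n) (- (1 + 1)))).
    - intros i. split; [apply Rabs_pos|].
      specialize (HW (2 ^ i)%nat ltac:(pose proof (Nat.pow_nonzero 2 i); lia)).
      change (2 * 2 ^ i)%nat with (2 ^ S i)%nat in HW.
      rewrite !INR_pow2 in HW. exact HW.
    - apply is_lim_seq_const.
    - replace (Finite 0) with (Finite (W * 0)) by (f_equal; ring).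
      apply (is_lim_seq_scal_l _ W (Finite 0)), is_lim_seq_pow2_neg; lra. }
  apply Rminus_diag_uniq. rewrite Diff. apply bigsum_0.
  intros j Hj. rewrite Z by assumption. ring.
Qed.

(** * Binary exponents *)

Lemma nat_pow2_pos n : (0 < 2 ^ n)%nat.
Proof. pose proof (Nat.pow_nonzero 2 n); lia. Qed.

(** Enlarging the range searched only adds digits equal to zero. *)
Lemma binary_exponents_bound B N : (N < 2 ^ B)%nat ->
  filter (Nat.testbit N) (rev (seq 0 B)) = binary_exponents N.
Proof.
  assert (Ext : forall B k, (N < 2 ^ B)%nat ->
            filter (Nat.testbit N) (rev (seq 0 (B + k))) =
            filter (Nat.testbit N) (rev (seq 0 B))).
  { clear B; intros B k HB. induction k as [|k IH]; [f_equal; f_equal; f_equal; lia|].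
    rewrite Nat.add_succ_r, seq_S, rev_app_distr. simpl.
    assert (Nat.testbit N (B + k) = false) as ->; [|exact IH].
    rewrite Nat.testbit_eqb, Nat.div_small; [reflexivity|].
    rewrite Nat.pow_add_r. pose proof (nat_pow2_pos k). nia. }
  intros HB. unfold binary_exponents.
  rewrite <- (Ext B N HB), <- (Ext N B), (Nat.add_comm N B); [reflexivity|].
  apply Nat.pow_gt_lin_r; lia.
Qed.

Lemma binary_exponents_add n j : (j < 2 ^ n)%nat ->
  binary_exponents (2 ^ n + j) = n :: binary_exponents j.
Proof.
  intros Hj. rewrite <- (binary_exponents_bound (S n)) by (simpl; lia).
  rewrite seq_S, rev_app_distr. simpl.
  pose proof (nat_pow2_pos n).
  assert (Nat.testbit (2 ^ n + j) n = true) as ->.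
  { rewrite Nat.testbit_eqb.
    replace (2 ^ n + j)%nat with (j + 1 * 2 ^ n)%nat by lia.
    rewrite Nat.div_add, Nat.div_small by lia. reflexivity. }
  f_equal. rewrite <- (binary_exponents_bound n j Hj).
  apply filter_ext_in. intros i Hi. apply in_rev, in_seq in Hi.
  rewrite !Nat.testbit_eqb.
  replace (2 ^ n + j)%nat with (j + (2 ^ (n - S i) * 2) * 2 ^ i)%nat.
  - rewrite Nat.div_add by (pose proof (nat_pow2_pos i); lia).
    rewrite Nat.Div0.mod_add. reflexivity.
  - rewrite <- Nat.mul_assoc, <- (Nat.pow_succ_r' 2 i), <- Nat.pow_add_r.
    replace (n - S i + S i)%nat with n by lia. lia.
Qed.

(** * The kernel on angles *)

Definition kern (s x : R) : R :=
  if Req_EM_T (sin (x / 2)) 0 then 0 else Rpower (2 * Rabs (sin (x / 2))) (- s).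

(** Indicator of coinciding points on the circle. *)
Definition zero_ind (x : R) : R := if Req_EM_T (sin (x / 2)) 0 then 1 else 0.

Definition periodic (F : R -> R) : Prop := forall x, F (x + 2 * PI) = F x.

Definition even_fun (F : R -> R) : Prop := forall x, F (- x) = F x.

Lemma kern_even s : even_fun (kern s).
Proof.
  intros x. unfold kern. replace (- x / 2) with (- (x / 2)) by field.
  rewrite sin_neg, Rabs_Ropp.
  destruct (Req_EM_T (sin (x / 2)) 0), (Req_EM_T (- sin (x / 2)) 0); try reflexivity; lra.
Qed.

Lemma zero_ind_even : even_fun zero_ind.
Proof.
  intros x. unfold zero_ind. replace (- x / 2) with (- (x / 2)) by field.
  rewrite sin_neg.
  destruct (Req_EM_T (sin (x / 2)) 0), (Req_EM_T (- sin (x / 2)) 0); try reflexivity; lra.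
Qed.

Lemma kern_periodic s : periodic (kern s).
Proof.
  intros x. unfold kern. replace ((x + 2 * PI) / 2) with (x / 2 + PI) by field.
  rewrite neg_sin, Rabs_Ropp.
  destruct (Req_EM_T (sin (x / 2)) 0), (Req_EM_T (- sin (x / 2)) 0); try reflexivity; lra.
Qed.

Lemma zero_ind_periodic : periodic zero_ind.
Proof.
  intros x. unfold zero_ind. replace ((x + 2 * PI) / 2) with (x / 2 + PI) by field.
  rewrite neg_sin.
  destruct (Req_EM_T (sin (x / 2)) 0), (Req_EM_T (- sin (x / 2)) 0); try reflexivity; lra.
Qed.

Lemma zero_ind_nonneg x : 0 <= zero_ind x.
Proof. unfold zero_ind; destruct (Req_EM_T _ _); lra. Qed.

(** For a periodic [F] this is a sum over a coset of the group of roots of unity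
    of order [M], acting by rotation. *)
Definition coset_sum (F : R -> R) (M : nat) (x : R) : R :=
  bigsum (fun l => F (x + 2 * PI * INR l / INR M)) M.

Lemma coset_sum_step F M x : periodic F -> (0 < M)%nat ->
  coset_sum F M (x + 2 * PI / INR M) = coset_sum F M x.
Proof.
  intros HF HM. assert (0 < INR M) by (apply lt_0_INR; lia).
  unfold coset_sum.
  rewrite (bigsum_ext _ (fun l => F (x + 2 * PI * INR (S l) / INR M))).
  2:{ intros; f_equal. rewrite S_INR. field. lra. }
  assert (E := bigsum_Sl (fun l => F (x + 2 * PI * INR l / INR M)) M).
  cbn [bigsum] in E.
  replace (x + 2 * PI * INR M / INR M) with (x + 2 * PI) in E by (field; lra).
  rewrite HF in E. change (INR 0) with 0 in E.
  replace (x + 2 * PI * 0 / INR M) with x in E by (field; lra). lra.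
Qed.

Lemma coset_sum_shift F M x (m : Z) : periodic F -> (0 < M)%nat ->
  coset_sum F M (x + 2 * PI * IZR m / INR M) = coset_sum F M x.
Proof.
  intros HF HM. assert (0 < INR M) by (apply lt_0_INR; lia).
  assert (Nat_shift : forall k x, coset_sum F M (x + 2 * PI * INR k / INR M) =
                                  coset_sum F M x).
  { induction k as [|k IH]; intros y.
    - f_equal. simpl. field. lra.
    - replace (y + 2 * PI * INR (S k) / INR M) with
        (y + 2 * PI * INR k / INR M + 2 * PI / INR M)
        by (rewrite S_INR; field; lra).
      rewrite coset_sum_step by assumption. apply IH. }
  destruct (Z_le_gt_dec 0 m) as [Hm|Hm].
  - rewrite <- (Z2Nat.id m Hm), <- INR_IZR_INZ. apply Nat_shift.
  - assert (E : INR (Z.to_nat (- m)) = - IZR m)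
      by (rewrite INR_IZR_INZ, Z2Nat.id, opp_IZR by lia; reflexivity).
    rewrite <- (Nat_shift (Z.to_nat (- m)) (x + 2 * PI * IZR m / INR M)), E.
    f_equal. field. lra.
Qed.

Lemma coset_sum_neg F M x : periodic F -> even_fun F -> (0 < M)%nat ->
  coset_sum F M (- x) = coset_sum F M x.
Proof.
  intros HF HE HM. assert (0 < INR M) by (apply lt_0_INR; lia).
  rewrite <- (coset_sum_step F M x) by assumption. unfold coset_sum.
  rewrite <- bigsum_rev. apply bigsum_ext; intros i Hi.
  rewrite <- HE, <- HF. f_equal.
  rewrite !minus_INR by lia. simpl (INR 1). field. lra.
Qed.

Lemma coset_sum_double F M x : (0 < M)%nat ->
  coset_sum F (2 * M) x = coset_sum F M x + coset_sum F M (x + PI / INR M).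
Proof.
  intros HM. assert (0 < INR M) by (apply lt_0_INR; lia).
  unfold coset_sum. rewrite bigsum_even_odd.
  f_equal; apply bigsum_ext; intros i _; f_equal;
    rewrite ?plus_INR, !mult_INR; simpl (INR 2); simpl (INR 1); field; lra.
Qed.

Lemma coset_reduce M x : (0 < M)%nat -> exists (m : Z) (y : R),
  x = y + 2 * PI * IZR m / INR M /\ 0 <= y < 2 * PI / INR M.
Proof.
  intros HM. assert (0 < INR M) by (apply lt_0_INR; lia).
  pose proof PI_RGT_0 as HPI.
  set (t := x * INR M / (2 * PI)). destruct (archimed t) as [A1 A2].
  exists (up t - 1)%Z, (x - 2 * PI * IZR (up t - 1) / INR M).
  split; [ring|]. rewrite minus_IZR.
  replace (x - 2 * PI * (IZR (up t) - 1) / INR M) with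
    ((t - (IZR (up t) - 1)) * (2 * PI / INR M)) by (unfold t; field; lra).
  assert (0 < 2 * PI / INR M) by (apply Rdiv_lt_0_compat; lra).
  split; [apply Rmult_le_pos; lra|].
  rewrite <- (Rmult_1_l (2 * PI / INR M)) at 2.
  apply Rmult_lt_compat_r; lra.
Qed.

(** * The potential of the roots of unity is extremal exactly midway *)

(** Greedy points minimize for [s > 0] and maximize for [s < 0]; multiplying
    by this sign turns both into minimization. *)
Definition sg (s : R) : R := if Rlt_dec s 0 then -1 else 1.

(** Weighted arithmetic-geometric mean, from [1 + x <= exp x]. *)
Lemma bernoulli_concave t u : 0 < t <= 1 -> 0 < u ->
  Rpower u t <= 1 - t + t * u.
Proof.
  intros Ht Hu. set (L := ln u).
  assert (E1 : 1 - t * L <= / Rpower u t).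
  { unfold Rpower. fold L. rewrite <- exp_Ropp. pose proof (exp_ineq1_le (- (t * L))). lra. }
  assert (E2 : 1 + (1 - t) * L <= u * / Rpower u t).
  { rewrite <- Rpower_Ropp. rewrite <- (Rpower_1 u Hu) at 1.
    rewrite <- Rpower_plus. unfold Rpower. fold L.
    pose proof (exp_ineq1_le ((1 + - t) * L)). lra. }
  assert (P := Rpower_pos u t).
  assert (Q : 1 <= (1 - t + t * u) * / Rpower u t).
  { replace ((1 - t + t * u) * / Rpower u t) with
      ((1 - t) * / Rpower u t + t * (u * / Rpower u t)) by ring. nra. }
  apply (Rmult_le_compat_r (Rpower u t)) in Q; [|lra].
  rewrite Rmult_assoc, Rinv_l in Q by lra. lra.
Qed.

Definition pw (t X : R) : R := if Req_EM_T X 0 then 0 else Rpower X t.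

Lemma pw_concave t X Y : 0 < t <= 1 -> 0 <= X -> 0 <= Y ->
  pw t X + pw t Y <= 2 * pw t ((X + Y) / 2).
Proof.
  assert (Half : forall Z, 0 < t <= 1 -> 0 < Z -> Rpower Z t <= 2 * Rpower (Z / 2) t).
  { intros Z Ht HZ. unfold Rdiv. rewrite Rpower_mult_base by lra.
    assert (/ 2 <= Rpower (/ 2) t).
    { unfold Rpower. rewrite ln_Rinv by lra.
      replace (/ 2) with (exp (- ln 2)) by (rewrite exp_Ropp, exp_ln by lra; reflexivity).
      apply exp_le. assert (0 < ln 2) by (rewrite <- ln_1; apply ln_increasing; lra).
      nra. }
    pose proof (Rpower_pos Z t). nra. }
  intros Ht HX HY. unfold pw.
  destruct HX as [HX|<-], HY as [HY|<-];
    repeat match goal with |- context [Req_EM_T ?u 0] =>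
      destruct (Req_EM_T u 0); try lra end.
  - set (m := (X + Y) / 2). assert (Hm : 0 < m) by (unfold m; lra).
    assert (EX : Rpower X t = Rpower m t * Rpower (X / m) t).
    { rewrite <- Rpower_mult_base; [|lra|apply Rdiv_lt_0_compat; lra].
      f_equal; field; lra. }
    assert (EY : Rpower Y t = Rpower m t * Rpower (Y / m) t).
    { rewrite <- Rpower_mult_base; [|lra|apply Rdiv_lt_0_compat; lra].
      f_equal; field; lra. }
    rewrite EX, EY.
    pose proof (bernoulli_concave t (X / m) Ht ltac:(apply Rdiv_lt_0_compat; lra)).
    pose proof (bernoulli_concave t (Y / m) Ht ltac:(apply Rdiv_lt_0_compat; lra)).
    assert (t * (X / m) + t * (Y / m) = 2 * t) by (unfold m; field; lra).
    rewrite <- Rmult_plus_distr_l, (Rmult_comm 2).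
    apply Rmult_le_compat_l; [apply Rlt_le, Rpower_pos | lra].
  - specialize (Half X Ht HX). rewrite !Rplus_0_r. lra.
  - specialize (Half Y Ht HY). rewrite !Rplus_0_l. lra.
Qed.

(** For [s > 0] this is [sin a sin b < sin^2 ((a+b)/2)] with the
    arithmetic-geometric mean inequality; for [-1 <= s < 0] it is concavity of
    [X^(-s)] with [sin a + sin b < 2 sin ((a+b)/2)]. *)
Lemma kern_midpoint s a b : -1 <= s -> s <> 0 ->
  0 <= a <= PI -> 0 <= b <= PI -> a <> b ->
  (0 < s -> 0 < a < PI /\ 0 < b < PI) ->
  sg s * (2 * kern s (a + b)) < sg s * (kern s (2 * a) + kern s (2 * b)).
Proof.
  intros Hs Hs0 Ha Hb Hab Hpos. pose proof PI_RGT_0 as HPI.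
  unfold kern. replace (2 * a / 2) with a by field. replace (2 * b / 2) with b by field.
  set (c := (a + b) / 2).
  assert (Hc : 0 < sin c) by (apply sin_gt_0; unfold c; lra).
  assert (Hsa : 0 <= sin a) by (apply sin_ge_0; lra).
  assert (Hsb : 0 <= sin b) by (apply sin_ge_0; lra).
  set (d := (a - b) / 2).
  assert (Hd : cos d < 1).
  { destruct (Rtotal_order d 0) as [Q|[Q|Q]].
    - rewrite <- cos_neg, <- cos_0. apply cos_decreasing_1; unfold d in *; lra.
    - unfold d in Q; lra.
    - rewrite <- cos_0. apply cos_decreasing_1; unfold d in *; lra. }
  assert (Hd0 : 0 <= cos d) by (apply cos_ge_0; unfold d; lra).
  assert (Ea : a = c + d) by (unfold c, d; field).
  assert (Eb : b = c - d) by (unfold c, d; field).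
  assert (Sum : sin a + sin b = 2 * sin c * cos d).
  { rewrite Ea, Eb, sin_plus, sin_minus. ring. }
  assert (Prod : sin a * sin b < sin c ^ 2).
  { rewrite Ea, Eb, sin_plus, sin_minus.
    replace ((sin c * cos d + cos c * sin d) * (sin c * cos d - cos c * sin d)) with
      ((sin c)^2 * cos d ^ 2 - (1 - (sin c) ^ 2) * (1 - cos d ^ 2)).
    - pose proof (SIN_bound c). nra.
    - pose proof (sin2_cos2 c) as Q1. pose proof (sin2_cos2 d) as Q2.
      unfold Rsqr in Q1, Q2.
      replace (1 - sin c ^ 2) with (cos c ^ 2) by nra.
      replace (1 - cos d ^ 2) with (sin d ^ 2) by nra. ring. }
  rewrite !Rabs_pos_eq by lra.
  destruct (Req_EM_T (sin c) 0); [lra|].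
  unfold sg. destruct (Rlt_dec s 0) as [Hneg|Hnn].
  - assert (E : forall X, (if Req_EM_T X 0 then 0 else Rpower (2 * X) (- s)) =
                          pw (- s) (2 * X)).
    { intros X. unfold pw. destruct (Req_EM_T X 0), (Req_EM_T (2 * X) 0);
        try reflexivity; lra. }
    rewrite !E.
    pose proof (pw_concave (- s) (2 * sin a) (2 * sin b) ltac:(lra) ltac:(lra) ltac:(lra)) as Q.
    assert (pw (- s) ((2 * sin a + 2 * sin b) / 2) < Rpower (2 * sin c) (- s)); [|lra].
    replace ((2 * sin a + 2 * sin b) / 2) with (2 * sin c * cos d) by lra.
    unfold pw. destruct (Req_EM_T _ 0); [apply Rpower_pos|].
    assert (0 < cos d) by (destruct Hd0 as [|E0]; [assumption|rewrite <- E0 in n0; lra]).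
    apply Rlt_Rpower_l; [lra|]. split; nra.
  - specialize (Hpos ltac:(lra)).
    assert (Pa : 0 < sin a) by (apply sin_gt_0; lra).
    assert (Pb : 0 < sin b) by (apply sin_gt_0; lra).
    destruct (Req_EM_T (sin a) 0); [lra|]. destruct (Req_EM_T (sin b) 0); [lra|].
    rewrite !Rmult_1_l.
    set (X := Rpower (2 * sin a) (- s / 2)). set (Y := Rpower (2 * sin b) (- s / 2)).
    assert (EX : Rpower (2 * sin a) (- s) = X * X)
      by (unfold X; rewrite <- Rpower_plus; f_equal; field).
    assert (EY : Rpower (2 * sin b) (- s) = Y * Y)
      by (unfold Y; rewrite <- Rpower_plus; f_equal; field).
    assert (EZ : Rpower (2 * sin c) (- s) = Rpower ((2 * sin c) * (2 * sin c)) (- s / 2)).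
    { rewrite (Rpower_mult_base (2 * sin c) (2 * sin c)), <- Rpower_plus by lra.
      f_equal; field. }
    assert (Q : Rpower ((2 * sin c) * (2 * sin c)) (- s / 2) < X * Y).
    { unfold X, Y. rewrite <- Rpower_mult_base by lra.
      replace (- s / 2) with (- (s / 2)) by field. rewrite !(Rpower_Ropp _ (s / 2)).
      apply Rinv_lt_contravar; [apply Rmult_lt_0_compat; apply Rpower_pos|].
      apply Rlt_Rpower_l; [lra|]. split; nra. }
    rewrite EX, EY, EZ. pose proof (pow2_ge_0 (X - Y)). nra.
Qed.

(** The potential takes the same value at [y] and at its mirror image
    [2 PI / M - y]; adding the two, [kern_midpoint] applies to each root of unity. *)
Lemma coset_kern_min s M y : -1 <= s -> s <> 0 -> (0 < M)%nat ->
  0 <= y < 2 * PI / INR M -> (0 < s -> 0 < y) -> y <> PI / INR M ->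
  sg s * coset_sum (kern s) M (PI / INR M) < sg s * coset_sum (kern s) M y.
Proof.
  intros Hs Hs0 HM Hy Hpos Hne. pose proof PI_RGT_0 as HPI.
  assert (HM0 : 0 < INR M) by (apply lt_0_INR; lia).
  assert (HM1 : 1 <= INR M) by (apply INR_ge1; lia).
  set (h := PI / INR M) in *.
  assert (Hh : 0 < h) by (apply Rdiv_lt_0_compat; lra).
  assert (Eh : PI = h * INR M) by (unfold h; field; lra).
  assert (E2 : 2 * PI / INR M = 2 * h) by (unfold h; field; lra).
  rewrite E2 in Hy.
  assert (El : forall l, 2 * PI * INR l / INR M = 2 * (h * INR l))
    by (intros; unfold h; field; lra).
  assert (R : coset_sum (kern s) M y = coset_sum (kern s) M (2 * h - y)).
  { rewrite <- (coset_sum_neg _ M y), <- (coset_sum_step _ M (- y));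
      try apply kern_periodic; try apply kern_even; try assumption.
    f_equal. rewrite E2. ring. }
  assert (D : 2 * (sg s * coset_sum (kern s) M h) < 2 * (sg s * coset_sum (kern s) M y)).
  { replace (2 * (sg s * coset_sum (kern s) M y)) with
      (sg s * (coset_sum (kern s) M y + coset_sum (kern s) M (2 * h - y)))
      by (rewrite <- R; ring).
    unfold coset_sum. rewrite <- bigsum_plus, <- !bigsum_scal.
    apply bigsum_lt; [exact HM|]. intros l Hl. rewrite !El.
    assert (Hl1 : INR l <= INR M - 1).
    { replace (INR M - 1) with (INR (M - 1)) by (rewrite minus_INR; [reflexivity|lia]).
      apply le_INR; lia. }
    pose proof (pos_INR l) as Hl0.
    assert (B : h * INR l <= PI - h) by (rewrite Eh; nra).
    assert (B0 : 0 <= h * INR l) by nra.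
    replace (y + 2 * (h * INR l)) with (2 * (y / 2 + h * INR l)) by field.
    replace (2 * h - y + 2 * (h * INR l)) with (2 * (h - y / 2 + h * INR l)) by field.
    replace (h + 2 * (h * INR l)) with ((y / 2 + h * INR l) + (h - y / 2 + h * INR l))
      by field.
    rewrite <- Rmult_assoc, (Rmult_comm 2 (sg s)), Rmult_assoc.
    apply kern_midpoint; try assumption; try lra. }
  lra.
Qed.

(** * Structure of greedy sequences *)

Definition pot (s : R) (th : nat -> R) (n : nat) (x : R) : R :=
  bigsum (fun i => kern s (x - th i)) n.

(** Where the potential is finite. *)
Definition adm (s : R) (th : nat -> R) (n : nat) (x : R) : Prop :=
  0 < s -> bigsum (fun i => zero_ind (x - th i)) n = 0.

Definition minimizes (s : R) (th : nat -> R) (n : nat) (z : R) : Prop :=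
  adm s th n z /\
  forall x, adm s th n x -> sg s * pot s th n z <= sg s * pot s th n x.

Definition greedy_upto (s : R) (th : nat -> R) (N : nat) : Prop :=
  forall k, (1 <= k < N)%nat -> minimizes s th k (th k).

(** The potential midway between neighbouring roots of unity of order [2^n]. *)
Definition mid_pot (s : R) (n : nat) : R :=
  coset_sum (kern s) (2 ^ n) (PI / INR (2 ^ n)).

(** The extremal value of the potential of the first [k] greedy points. *)
Definition min_pot (s : R) (k : nat) : R :=
  Rsum (map (mid_pot s) (binary_exponents k)).

Lemma min_pot_add s n j : (j < 2 ^ n)%nat ->
  min_pot s (2 ^ n + j) = mid_pot s n + min_pot s j.
Proof. intros Hj. unfold min_pot. now rewrite binary_exponents_add. Qed.

Lemma adm_split s th n j x : adm s th (n + j) x <->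
  adm s th n x /\ adm s (fun i => th (n + i)%nat) j x.
Proof.
  unfold adm. rewrite bigsum_add.
  assert (P1 := bigsum_nonneg (fun i => zero_ind (x - th i)) n
                  (fun i _ => zero_ind_nonneg _)).
  assert (P2 := bigsum_nonneg (fun i => zero_ind (x - th (n + i)%nat)) j
                  (fun i _ => zero_ind_nonneg _)).
  split.
  - intros E; split; intros Hs; specialize (E Hs); lra.
  - intros [E1 E2] Hs; specialize (E1 Hs); specialize (E2 Hs); lra.
Qed.

Lemma pot_split s th n j x :
  pot s th (n + j) x = pot s th n x + pot s (fun i => th (n + i)%nat) j x.
Proof. unfold pot. apply bigsum_add. Qed.

Lemma greedy_upto_le s th N M : (M <= N)%nat ->
  greedy_upto s th N -> greedy_upto s th M.
Proof. intros HMN HG k Hk. apply HG; lia. Qed.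

(** The first [2^n] points form a coset of the roots of unity of order [2^n];
    testing against periodic functions avoids ordering the points and choosing
    their angles modulo [2 PI]. *)
Definition block_coset (th : nat -> R) (n : nat) : Prop :=
  forall F, periodic F -> bigsum (fun i => F (th i)) (2 ^ n) = coset_sum F (2 ^ n) (th O).

(** A minimizer inside the coset is what makes blocks independent: all points of
    that coset are equally good for the potential of an earlier block. *)
Definition coset_minimizer (s : R) (th : nat -> R) (n k : nat) : Prop :=
  exists l : Z, let z := th O + 2 * PI * IZR l / INR (2 ^ n) in
    minimizes s th k z /\ pot s th k z = min_pot s k.

Lemma block_potential F th n x : block_coset th n -> periodic F -> even_fun F ->
  bigsum (fun i => F (x - th i)) (2 ^ n) = coset_sum F (2 ^ n) (th O - x).
Proof.
  intros HB HF HE.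
  rewrite (HB (fun u => F (x - u))).
  - unfold coset_sum. apply bigsum_ext; intros i _. rewrite <- HE. f_equal. ring.
  - intros u. rewrite <- HF. f_equal. ring.
Qed.

Lemma midpoint_value F n a (m : Z) : periodic F -> even_fun F ->
  coset_sum F (2 ^ n) (a - (a + PI / INR (2 ^ n) + 2 * PI * IZR m / INR (2 ^ n))) =
  coset_sum F (2 ^ n) (PI / INR (2 ^ n)).
Proof.
  intros HF HE. assert (HM := nat_pow2_pos n).
  assert (0 < INR (2 ^ n)) by (apply lt_0_INR; exact HM).
  rewrite <- (coset_sum_neg F _ (PI / _)), <- (coset_sum_shift F _ (- (PI / _)) (- m))
    by assumption.
  f_equal. rewrite opp_IZR. field. lra.
Qed.

Lemma midpoint_adm n :
  coset_sum zero_ind (2 ^ n) (PI / INR (2 ^ n)) = 0.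
Proof.
  assert (HM := nat_pow2_pos n). pose proof PI_RGT_0 as HPI.
  assert (HM0 : 1 <= INR (2 ^ n)) by (apply INR_ge1; exact HM).
  unfold coset_sum. apply bigsum_0. intros l Hl. unfold zero_ind.
  set (M := INR (2 ^ n)) in *.
  assert (Hl1 : INR l <= M - 1).
  { unfold M. replace (INR (2 ^ n) - 1) with (INR (2 ^ n - 1))
      by (rewrite minus_INR; [reflexivity|lia]). apply le_INR; lia. }
  pose proof (pos_INR l).
  assert (0 < sin ((PI / M + 2 * PI * INR l / M) / 2)).
  { replace ((PI / M + 2 * PI * INR l / M) / 2) with
      (PI * (1 + 2 * INR l) / (2 * M)) by (field; lra).
    apply sin_gt_0.
    - apply Rdiv_lt_0_compat; nra.
    - apply Rmult_lt_reg_r with (2 * M); [lra|].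
      replace (PI * (1 + 2 * INR l) / (2 * M) * (2 * M)) with (PI * (1 + 2 * INR l))
        by (field; lra). nra. }
  destruct (Req_EM_T _ 0); lra.
Qed.

Section Greedy.

Context (s : R) (Hs : -1 <= s) (Hs0 : s <> 0).

Lemma block_adm th n x : block_coset th n -> adm s th (2 ^ n) x ->
  0 < s -> coset_sum zero_ind (2 ^ n) (th O - x) = 0.
Proof.
  intros HB Ha Hpos. rewrite <- block_potential;
    [now apply Ha|exact HB|apply zero_ind_periodic|apply zero_ind_even].
Qed.

Lemma adm_reduced th n x y (k : Z) : block_coset th n -> adm s th (2 ^ n) x ->
  0 < s -> th O - x = y + 2 * PI * IZR k / INR (2 ^ n) -> 0 <= y -> 0 < y.
Proof.
  intros HB Ha Hpos E [Hy|Hy]; [exact Hy|exfalso]. assert (HM := nat_pow2_pos n).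
  assert (Z := block_adm th n x HB Ha Hpos).
  rewrite E, coset_sum_shift in Z by (try apply zero_ind_periodic; assumption).
  unfold coset_sum in Z.
  assert (Q := bigsum_eq0_inv _ _ (fun i _ => zero_ind_nonneg _) Z O HM).
  cbv beta in Q. rewrite <- Hy in Q. unfold zero_ind in Q.
  replace ((0 + 2 * PI * INR 0 / INR (2 ^ n)) / 2) with 0 in Q
    by (simpl; field; apply not_0_INR; lia).
  rewrite sin_0 in Q. destruct (Req_EM_T 0 0); lra.
Qed.

Lemma block_pot th n x : block_coset th n ->
  pot s th (2 ^ n) x = coset_sum (kern s) (2 ^ n) (th O - x).
Proof.
  intros HB. unfold pot. apply block_potential; [exact HB|apply kern_periodic|apply kern_even].
Qed.

Lemma midpoint_minimizes th n (m : Z) : block_coset th n ->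
  let z := th O + PI / INR (2 ^ n) + 2 * PI * IZR m / INR (2 ^ n) in
  minimizes s th (2 ^ n) z /\ pot s th (2 ^ n) z = mid_pot s n.
Proof.
  intros HB z. assert (HM := nat_pow2_pos n).
  assert (V : pot s th (2 ^ n) z = mid_pot s n).
  { rewrite block_pot by assumption. unfold z.
    apply midpoint_value; [apply kern_periodic | apply kern_even]. }
  split; [|exact V]. split.
  - intros Hpos. rewrite (block_potential zero_ind) by
      (try assumption; try apply zero_ind_periodic; apply zero_ind_even).
    unfold z. rewrite midpoint_value by (try apply zero_ind_periodic; apply zero_ind_even).
    apply midpoint_adm.
  - intros x Hx. rewrite V, block_pot by assumption.
    destruct (coset_reduce (2 ^ n) (th O - x) HM) as [k [y [E Hy]]].
    rewrite E, coset_sum_shift by (try apply kern_periodic; assumption).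
    destruct (Req_dec y (PI / INR (2 ^ n))) as [->|Hne]; [apply Rle_refl|].
    apply Rlt_le, coset_kern_min; try assumption.
    intros Hpos. exact (adm_reduced th n x y k HB Hx Hpos E (proj1 Hy)).
Qed.

(** The strict part of the extremality: every minimizer lies midway. *)
Lemma minimizer_is_midpoint th n x : block_coset th n ->
  minimizes s th (2 ^ n) x ->
  exists m : Z, x = th O + PI / INR (2 ^ n) + 2 * PI * IZR m / INR (2 ^ n).
Proof.
  intros HB [Ha Hmin]. assert (HM := nat_pow2_pos n).
  assert (HM0 : 0 < INR (2 ^ n)) by (apply lt_0_INR; exact HM).
  destruct (midpoint_minimizes th n 0 HB) as [[Z1 _] Z2].
  specialize (Hmin _ Z1). rewrite Z2, block_pot in Hmin by assumption.
  destruct (coset_reduce (2 ^ n) (th O - x) HM) as [k [y [E Hy]]].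
  rewrite E, coset_sum_shift in Hmin by (try apply kern_periodic; assumption).
  assert (Ey : y = PI / INR (2 ^ n)).
  { destruct (Req_dec y (PI / INR (2 ^ n))) as [|Hne]; [assumption|exfalso].
    assert (Q : sg s * mid_pot s n < sg s * coset_sum (kern s) (2 ^ n) y); [|lra].
    apply coset_kern_min; try assumption.
    intros Hpos. exact (adm_reduced th n x y k HB Ha Hpos E (proj1 Hy)). }
  exists (- k - 1)%Z. rewrite minus_IZR, opp_IZR.
  replace x with (th O - (th O - x)) by ring. rewrite E, Ey. field. lra.
Qed.

(** After a full block the sequence starts afresh, as a greedy sequence of its
    own: its candidates inside the next coset are extremal both for the
    potential of the first block and for that of the new points, so a
    minimizer of the sum minimizes each of the two. *)
Lemma second_block th n j :
  (forall th, greedy_upto s th (2 ^ n) -> block_coset th n) ->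
  (forall th k, (1 <= k < 2 ^ n)%nat -> greedy_upto s th k -> coset_minimizer s th n k) ->
  (1 <= j <= 2 ^ n)%nat -> greedy_upto s th (2 ^ n + j) ->
  (exists m : Z, th (2 ^ n)%nat =
     th O + PI / INR (2 ^ n) + 2 * PI * IZR m / INR (2 ^ n)) /\
  greedy_upto s (fun i => th (2 ^ n + i)%nat) j.
Proof.
  intros HS HT Hj HG. assert (HM := nat_pow2_pos n).
  assert (HB : block_coset th n) by (apply HS, (greedy_upto_le _ _ (2 ^ n + j)); [lia|exact HG]).
  assert (Hb0 : exists m : Z, th (2 ^ n)%nat =
     th O + PI / INR (2 ^ n) + 2 * PI * IZR m / INR (2 ^ n)).
  { apply minimizer_is_midpoint; [exact HB|]. apply HG; lia. }
  split; [exact Hb0|]. destruct Hb0 as [m Hm].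
  set (b := fun i => th (2 ^ n + i)%nat).
  assert (Hb : forall i, (i <= j)%nat -> greedy_upto s b i).
  { induction i as [|i IH]; intros Hi; [intros k Hk; lia|].
    specialize (IH ltac:(lia)). intros k Hk.
    destruct (Nat.eq_dec k i) as [->|Hki]; [|apply IH; lia].
    (* This z minimizes the potential of the new points and, lying midway between
       points of the first block, that of the first block too. *)
    destruct (HT b i ltac:(lia) IH) as [l [[Za Zm] _]].
    set (z := b O + 2 * PI * IZR l / INR (2 ^ n)) in *.
    assert (Ez : z = th O + PI / INR (2 ^ n) + 2 * PI * IZR (m + l) / INR (2 ^ n)).
    { unfold z, b. rewrite Nat.add_0_r, Hm, plus_IZR. field.
      apply not_0_INR; lia. }
    destruct (midpoint_minimizes th n (m + l) HB) as [[Va Vm] _].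
    rewrite <- Ez in Va, Vm.
    destruct (HG (2 ^ n + i)%nat ltac:(lia)) as [Ga Gm].
    apply adm_split in Ga. destruct Ga as [Ga1 Ga2]. fold b in Ga2.
    specialize (Gm z). rewrite !pot_split in Gm. fold b in Gm.
    change (th (2 ^ n + i)%nat) with (b i) in *.
    assert (Q := Gm ltac:(apply adm_split; split; assumption)).
    specialize (Vm (b i) Ga1).
    split; [exact Ga2|]. intros x Hx. specialize (Zm x Hx). lra. }
  apply Hb; lia.
Qed.

(** Both facts for blocks of size [2^(n+1)] come from those for size [2^n], applied
    to the first block and to the sequence that starts after it. *)
Lemma greedy_blocks n :
  (forall th, greedy_upto s th (2 ^ n) -> block_coset th n) /\
  (forall th k, (1 <= k < 2 ^ n)%nat -> greedy_upto s th k -> coset_minimizer s th n k).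
Proof.
  induction n as [|n [HS HT]].
  - split.
    + intros th _ F HF. unfold coset_sum; simpl. rewrite !Rplus_0_l. f_equal. field.
    + intros th k Hk; simpl in Hk; lia.
  - assert (HM := nat_pow2_pos n). assert (HM0 : 0 < INR (2 ^ n)) by (apply lt_0_INR; exact HM).
    assert (E2 : INR (2 ^ S n) = 2 * INR (2 ^ n))
      by (rewrite Nat.pow_succ_r', mult_INR; simpl INR; ring).
    split.
    + intros th HG F HF.
      replace (2 ^ S n)%nat with (2 ^ n + 2 ^ n)%nat in HG by (simpl; lia).
      destruct (second_block th n (2 ^ n) HS HT ltac:(lia) HG) as [[m Hm] Hb].
      assert (HB1 : block_coset th n)
        by (apply HS, (greedy_upto_le _ _ (2 ^ n + 2 ^ n)); [lia|exact HG]).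
      assert (HB2 := HS _ Hb).
      replace (2 ^ S n)%nat with (2 ^ n + 2 ^ n)%nat at 1 by (simpl; lia).
      rewrite bigsum_add, (HB1 F HF), (HB2 F HF), Nat.add_0_r, Hm.
      rewrite coset_sum_shift by assumption.
      change (2 ^ S n)%nat with (2 * 2 ^ n)%nat.
      now rewrite coset_sum_double.
    + intros th k Hk HG.
      destruct (lt_eq_lt_dec k (2 ^ n)) as [[Hlt|Heq]|Hgt].
      * destruct (HT th k ltac:(lia) HG) as [l Hl]. exists (2 * l)%Z.
        rewrite E2, mult_IZR.
        replace (2 * PI * (2 * IZR l) / (2 * INR (2 ^ n))) with
          (2 * PI * IZR l / INR (2 ^ n)) by (field; lra). exact Hl.
      * subst k. exists 1%Z. rewrite E2.
        destruct (midpoint_minimizes th n 0 (HS th HG)) as [Z1 Z2].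
        replace (th O + PI / INR (2 ^ n) + 2 * PI * 0 / INR (2 ^ n)) with
          (th O + 2 * PI * 1 / (2 * INR (2 ^ n))) in Z1, Z2 by (field; lra).
        split; [exact Z1|]. cbv zeta. rewrite Z2.
        replace (2 ^ n)%nat with (2 ^ n + 0)%nat at 1 by lia.
        rewrite min_pot_add by lia. unfold min_pot, Rsum; simpl. ring.
      * set (j := (k - 2 ^ n)%nat). assert (Ek : k = (2 ^ n + j)%nat) by (unfold j; lia).
        assert (Hj : (1 <= j < 2 ^ n)%nat) by (simpl in Hk; unfold j; lia).
        clearbody j. subst k.
        destruct (second_block th n j HS HT ltac:(lia) HG) as [[m Hm] Hb].
        assert (HB : block_coset th n)
          by (apply HS, (greedy_upto_le _ _ (2 ^ n + j)); [lia|exact HG]).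
        destruct (HT _ j Hj Hb) as [l [[Za Zm] Zv]].
        rewrite Nat.add_0_r, Hm in Za, Zm, Zv.
        destruct (midpoint_minimizes th n (m + l) HB) as [[Va Vm] Vv].
        exists (1 + 2 * (m + l))%Z. cbv zeta.
        replace (th O + 2 * PI * IZR (1 + 2 * (m + l)) / INR (2 ^ S n)) with
          (th O + PI / INR (2 ^ n) + 2 * PI * IZR (m + l) / INR (2 ^ n)).
        2:{ rewrite E2, !plus_IZR, mult_IZR, plus_IZR. field. lra. }
        replace (th O + PI / INR (2 ^ n) + 2 * PI * IZR m / INR (2 ^ n) +
                 2 * PI * IZR l / INR (2 ^ n)) with
          (th O + PI / INR (2 ^ n) + 2 * PI * IZR (m + l) / INR (2 ^ n))
          in Za, Zm, Zv by (rewrite plus_IZR; field; lra).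
        split.
        -- split; [apply adm_split; split; assumption|].
           intros x Hx. apply adm_split in Hx. destruct Hx as [Hx1 Hx2].
           rewrite !pot_split. specialize (Vm x Hx1). specialize (Zm x Hx2). lra.
        -- rewrite pot_split, Vv, Zv, min_pot_add by lia. reflexivity.
Qed.

Lemma greedy_value th k : (1 <= k)%nat -> (forall N, greedy_upto s th N) ->
  pot s th k (th k) = min_pot s k.
Proof.
  intros Hk HG.
  destruct (greedy_blocks k) as [_ HT].
  destruct (HT th k) as [l [[Za Zm] Zv]].
  - split; [exact Hk|]. apply Nat.pow_gt_lin_r; lia.
  - apply HG.
  - destruct (HG (S k) k ltac:(lia)) as [Ga Gm].
    rewrite <- Zv. specialize (Gm _ Za). specialize (Zm _ Ga).
    unfold sg in *. destruct (Rlt_dec s 0); lra.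
Qed.

End Greedy.

(** Each pair counts twice, once in the potential that its later point meets on
    arrival. *)
Definition greedy_energy (s : R) (N : nat) : R := 2 * bigsum (min_pot s) N.

(** The points of the second block meet the potential [mid_pot s n] of the first
    one and, besides, form a greedy configuration. *)
Lemma greedy_energy_add s n j : (j <= 2 ^ n)%nat ->
  greedy_energy s (2 ^ n + j) =
  greedy_energy s (2 ^ n) + 2 * INR j * mid_pot s n + greedy_energy s j.
Proof.
  intros Hj. unfold greedy_energy. rewrite bigsum_add.
  rewrite (bigsum_ext (fun i => min_pot s (2 ^ n + i)) (fun i => mid_pot s n + min_pot s i)).
  - rewrite bigsum_plus, bigsum_const. ring.
  - intros i Hi. apply min_pot_add; lia.
Qed.

Lemma kern_0 s : kern s 0 = 0.
Proof.
  unfold kern. replace (0 / 2) with 0 by field. rewrite sin_0.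
  destruct (Req_EM_T 0 0); lra.
Qed.

Lemma coset_sum_root_sum s M : (0 < M)%nat ->
  coset_sum (kern s) M 0 = root_sum s M.
Proof.
  intros HM. assert (HM0 : 0 < INR M) by (apply lt_0_INR; exact HM).
  pose proof PI_RGT_0 as HPI.
  unfold coset_sum, root_sum. destruct M as [|M']; [lia|].
  rewrite bigsum_Sl. replace (S M' - 1)%nat with M' by lia.
  set (M := S M') in *.
  replace (0 + 2 * PI * INR 0 / INR M) with 0
    by (change (INR 0) with 0; field; lra).
  rewrite kern_0, Rplus_0_l. apply bigsum_ext; intros i Hi.
  assert (0 < INR (S i) < INR M) by (split; [apply lt_0_INR; lia | apply lt_INR; lia]).
  unfold kern. replace ((0 + 2 * PI * INR (S i) / INR M) / 2) with
    (PI * INR (S i) / INR M) by (field; lra).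
  assert (0 < sin (PI * INR (S i) / INR M)).
  { apply sin_gt_0.
    - apply Rdiv_lt_0_compat; nra.
    - apply Rmult_lt_reg_r with (INR M); [lra|].
      replace (PI * INR (S i) / INR M * INR M) with (PI * INR (S i)) by (field; lra).
      nra. }
  destruct (Req_EM_T _ 0); [lra|]. now rewrite Rabs_pos_eq by lra.
Qed.

(** The roots of unity of order [2^(n+1)] are those of order [2^n] and the points
    midway. *)
Lemma mid_pot_root_sum s n :
  mid_pot s n = root_sum s (2 ^ S n) - root_sum s (2 ^ n).
Proof.
  assert (HM := nat_pow2_pos n). unfold mid_pot.
  rewrite <- !coset_sum_root_sum by (apply nat_pow2_pos).
  change (2 ^ S n)%nat with (2 * 2 ^ n)%nat. rewrite coset_sum_double by assumption.
  rewrite Rplus_0_l. ring.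
Qed.

Lemma greedy_energy_pow2 s n :
  greedy_energy s (2 ^ n) = 2 ^ n * root_sum s (2 ^ n).
Proof.
  induction n as [|n IH].
  - unfold greedy_energy, root_sum, min_pot, Rsum. simpl. ring.
  - replace (2 ^ S n)%nat with (2 ^ n + 2 ^ n)%nat at 1 by (simpl; lia).
    rewrite greedy_energy_add, IH, mid_pot_root_sum, INR_pow2 by lia.
    simpl pow. ring.
Qed.

(** * From the energy of points to sums over angles *)

Definition cis (t : R) : C := (cos t, sin t).

Definition angle (z : C) : R := if Rle_dec 0 (Im z) then acos (Re z) else - acos (Re z).

Lemma on_circle_cis t : on_circle (cis t).
Proof.
  unfold on_circle, Cmod, cis; simpl. rewrite !Rmult_1_r.
  pose proof (sin2_cos2 t) as Q. unfold Rsqr in Q.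
  replace (cos t * cos t + sin t * sin t) with 1 by lra. apply sqrt_1.
Qed.

Lemma cis_angle z : on_circle z -> cis (angle z) = z.
Proof.
  unfold on_circle. destruct z as [x y]. intros Hz.
  assert (Q : x ^ 2 + y ^ 2 = 1).
  { pose proof (Cmod2_alt (x, y)) as E. rewrite Hz in E. simpl in E. simpl. lra. }
  assert (Hx : -1 <= x <= 1) by nra.
  unfold cis, angle; simpl.
  assert (Ey : sqrt (1 - Rsqr x) = Rabs y).
  { replace (1 - Rsqr x) with (Rsqr y) by (unfold Rsqr; nra). apply sqrt_Rsqr_abs. }
  destruct (Rle_dec 0 y); rewrite ?cos_neg, ?sin_neg, cos_acos, sin_acos, Ey by assumption.
  - rewrite Rabs_pos_eq by assumption. reflexivity.
  - rewrite Rabs_left by lra. rewrite Ropp_involutive. reflexivity.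
Qed.

Lemma Cmod_cis_minus a b : Cmod (cis a - cis b) = 2 * Rabs (sin ((a - b) / 2)).
Proof.
  unfold Cmod, cis; simpl. rewrite !Rmult_1_r.
  set (c := (a + b) / 2). set (d := (a - b) / 2).
  replace a with (c + d) by (unfold c, d; field).
  replace b with (c - d) by (unfold c, d; field).
  rewrite cos_plus, cos_minus, sin_plus, sin_minus.
  replace (_ + _) with (Rsqr (2 * sin d) * (Rsqr (sin c) + Rsqr (cos c)))
    by (unfold Rsqr; ring).
  rewrite sin2_cos2, Rmult_1_r, sqrt_Rsqr_abs, Rabs_mult, (Rabs_pos_eq 2) by lra.
  reflexivity.
Qed.

Lemma riesz_kernel_cis s a b : s <> 0 ->
  riesz_kernel s (cis a) (cis b) =
  if Req_EM_T (sin ((a - b) / 2)) 0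
  then (if Rlt_dec s 0 then Finite 0 else p_infty)
  else Finite (kern s (a - b)).
Proof.
  intros Hs. unfold riesz_kernel, kern.
  assert (E := Cmod_cis_minus a b).
  destruct (Ceq_dec (cis a) (cis b)) as [Heq|Hne];
    destruct (Req_EM_T (sin ((a - b) / 2)) 0) as [Z|Z].
  - reflexivity.
  - exfalso. rewrite Heq in E. replace (cis b - cis b)%C with (RtoC 0) in E by ring.
    rewrite Cmod_0 in E. apply Rabs_pos_lt in Z. lra.
  - exfalso. rewrite Z, Rabs_R0, Rmult_0_r in E. apply Cmod_eq_0 in E.
    apply Hne. apply Ceq_minus. exact E.
  - destruct (Req_EM_T s 0); [contradiction|]. now rewrite E.
Qed.

Lemma Rbar_sum_Finite {T} (g : T -> R) l :
  Rbar_sum (map (fun x => Finite (g x)) l) = Finite (Rsum (map g l)).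
Proof. induction l as [|x l IH]; simpl; [reflexivity|]. now rewrite IH. Qed.

Lemma Rbar_sum_p_infty l : (forall x, In x l -> x <> m_infty) -> In p_infty l ->
  Rbar_sum l = p_infty.
Proof.
  assert (NM : forall l, (forall x, In x l -> x <> m_infty) -> Rbar_sum l <> m_infty).
  { clear l; induction l as [|x l IH]; intros Hl; [discriminate|].
    assert (Hx := Hl x (or_introl eq_refl)).
    specialize (IH (fun y Hy => Hl y (or_intror Hy))).
    simpl. destruct x, (Rbar_sum l); simpl; congruence. }
  induction l as [|x l IH]; intros Hl Hin; [contradiction|].
  destruct Hin as [->|Hin]; simpl.
  - assert (Q := NM l (fun y Hy => Hl y (or_intror Hy))).
    destruct (Rbar_sum l); simpl; congruence.
  - rewrite IH; [|intros; apply Hl; now right|assumption].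
    assert (Hx := Hl x (or_introl eq_refl)). destruct x; simpl; congruence.
Qed.

Lemma Rsum_filter {T} (P : T -> bool) (g : T -> R) l :
  (forall x, P x = false -> g x = 0) ->
  Rsum (map g (filter P l)) = Rsum (map g l).
Proof.
  intros Hg. unfold Rsum. induction l as [|x l IH]; simpl; [reflexivity|].
  destruct (P x) eqn:E; simpl; rewrite IH; [reflexivity|]. rewrite (Hg x E); ring.
Qed.

Lemma Rsum_list_prod (g : nat -> nat -> R) A B :
  Rsum (map (fun ij => g (fst ij) (snd ij)) (list_prod A B)) =
  Rsum (map (fun i => Rsum (map (g i) B)) A).
Proof.
  induction A as [|x A IH]; simpl; [reflexivity|].
  rewrite map_app, Rsum_app, IH, map_map. reflexivity.
Qed.

Definition double_sum (s : R) (th : nat -> R) (n : nat) : R :=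
  bigsum (fun i => bigsum (fun j => kern s (th i - th j)) n) n.

Lemma double_sum_S s th n :
  double_sum s th (S n) = double_sum s th n + 2 * pot s th n (th n).
Proof.
  unfold double_sum. cbn [bigsum]. rewrite bigsum_plus.
  replace (th n - th n) with 0 by ring. rewrite kern_0.
  rewrite (bigsum_ext (fun i => kern s (th i - th n)) (fun i => kern s (th n - th i))).
  - unfold pot. ring.
  - intros i _. rewrite <- kern_even. f_equal; ring.
Qed.

Definition cis_list (th : nat -> R) (n : nat) : list C :=
  map (fun i => cis (th i)) (seq 0 n).

Lemma nth_cis_list th n i : (i < n)%nat -> nth i (cis_list th n) (RtoC 0) = cis (th i).
Proof.
  intros Hi. unfold cis_list.
  rewrite (nth_indep _ _ (cis (th O))) by (rewrite length_map, length_seq; exact Hi).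
  rewrite (map_nth (fun i => cis (th i))), seq_nth by exact Hi. reflexivity.
Qed.

Lemma cis_list_app th n x :
  cis_list th n ++ [cis x] = cis_list (fun i => if lt_dec i n then th i else x) (S n).
Proof.
  unfold cis_list. rewrite seq_S, map_app. simpl.
  destruct (lt_dec n n); [lia|]. f_equal.
  apply map_ext_in. intros i Hi. apply in_seq in Hi.
  destruct (lt_dec i n); [reflexivity|lia].
Qed.

(** Pairwise distinct points, required only when coincidences are penalized. *)
Definition admissible_points (s : R) (th : nat -> R) (n : nat) : Prop :=
  forall k, (k < n)%nat -> adm s th k (th k).

Lemma adm_not_coincide s th k x i : 0 < s -> adm s th k x -> (i < k)%nat ->
  sin ((x - th i) / 2) <> 0.
Proof.
  intros Hs Ha Hi E. specialize (Ha Hs).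
  assert (Q := bigsum_eq0_inv _ _ (fun i _ => zero_ind_nonneg (x - th i)) Ha i Hi).
  cbv beta in Q. unfold zero_ind in Q. destruct (Req_EM_T _ 0); [lra|contradiction].
Qed.

(** Diagonal terms may be included since [kern s 0 = 0]. *)
Lemma energy_admissible s th n : s <> 0 -> admissible_points s th n ->
  energy s (cis_list th n) = Finite (double_sum s th n).
Proof.
  intros Hs0 Hadm. unfold energy.
  assert (Len : length (cis_list th n) = n)
    by (unfold cis_list; rewrite length_map, length_seq; reflexivity).
  rewrite Len.
  rewrite (map_ext_in _ (fun ij => Finite (kern s (th (fst ij) - th (snd ij))))).
  - rewrite Rbar_sum_Finite. f_equal.
    rewrite Rsum_filter.
    + rewrite (Rsum_list_prod (fun i j => kern s (th i - th j))).
      unfold double_sum. rewrite <- Rsum_map_seq. f_equal.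
      apply map_ext. intros i. apply Rsum_map_seq.
    + intros [i j] E. simpl in *. apply Bool.negb_false_iff, Nat.eqb_eq in E.
      subst j. replace (th i - th i) with 0 by ring. apply kern_0.
  - intros [i j] Hij. apply filter_In in Hij. destruct Hij as [Hin Hne].
    apply in_prod_iff in Hin. rewrite !in_seq in Hin. simpl in *.
    apply Bool.negb_true_iff, Nat.eqb_neq in Hne.
    rewrite !nth_cis_list, riesz_kernel_cis by (lia || assumption).
    destruct (Req_EM_T _ 0) as [Z|Z]; [|reflexivity].
    destruct (Rlt_dec s 0) as [Hneg|Hpos].
    + unfold kern. destruct (Req_EM_T _ 0); [reflexivity|contradiction].
    + exfalso. assert (Hs : 0 < s)
        by (destruct (Rtotal_order s 0) as [|[|]]; [lra|contradiction|lra]).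
      destruct (lt_eq_lt_dec i j) as [[Hlt|Heq]|Hlt]; [|lia|].
      * apply (adm_not_coincide s th j (th j) i Hs (Hadm j ltac:(lia)) Hlt).
        replace ((th j - th i) / 2) with (- ((th i - th j) / 2)) by field.
        rewrite sin_neg, Z; ring.
      * exact (adm_not_coincide s th i (th i) j Hs (Hadm i ltac:(lia)) Hlt Z).
Qed.

Lemma energy_not_admissible s th n : s <> 0 -> ~ adm s th n (th n) ->
  energy s (cis_list th (S n)) = p_infty.
Proof.
  intros Hs0 Hna. unfold energy.
  assert (Len : length (cis_list th (S n)) = S n)
    by (unfold cis_list; rewrite length_map, length_seq; reflexivity).
  rewrite Len.
  assert (Hs : 0 < s).
  { destruct (Rlt_le_dec 0 s); [assumption|]. exfalso; apply Hna. intros Hp; lra. }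
  assert (exists i, (i < n)%nat /\ sin ((th n - th i) / 2) = 0) as [i [Hi Z]].
  { destruct (classic (exists i, (i < n)%nat /\ sin ((th n - th i) / 2) = 0)) as [|N];
      [assumption|].
    exfalso; apply Hna. intros _. apply bigsum_0. intros i Hi. unfold zero_ind.
    destruct (Req_EM_T _ 0); [|reflexivity]. exfalso; eauto. }
  apply Rbar_sum_p_infty.
  - intros x Hx. apply in_map_iff in Hx. destruct Hx as [[k l] [<- Hkl]].
    apply filter_In in Hkl. destruct Hkl as [Hin _].
    apply in_prod_iff in Hin. rewrite !in_seq in Hin. simpl in Hin. simpl fst. simpl snd.
    rewrite !nth_cis_list, riesz_kernel_cis by (lia || assumption).
    destruct (Req_EM_T _ 0), (Rlt_dec s 0); discriminate.
  - apply in_map_iff. exists (n, i). split.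
    + simpl fst. simpl snd.
      rewrite !nth_cis_list, riesz_kernel_cis by (lia || assumption).
      destruct (Req_EM_T _ 0); [|contradiction].
      destruct (Rlt_dec s 0); [lra|reflexivity].
    + apply filter_In. split.
      * apply in_prod_iff. rewrite !in_seq. lia.
      * simpl. apply Bool.negb_true_iff, Nat.eqb_neq. lia.
Qed.

Lemma adm_ext s th th' n x : (forall i, (i < n)%nat -> th i = th' i) ->
  adm s th n x -> adm s th' n x.
Proof.
  intros E Ha Hs. rewrite <- (Ha Hs). apply bigsum_ext; intros; now rewrite E.
Qed.

Lemma greedy_upto_admissible s th N : greedy_upto s th N -> admissible_points s th N.
Proof.
  intros HG [|k] Hk; [intros _; reflexivity|]. apply HG; lia.
Qed.

(** Adjoining a point adds its potential twice. *)
Lemma energy_extend s th n x : s <> 0 -> admissible_points s th n -> adm s th n x ->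
  energy s (cis_list th n ++ [cis x]) = Finite (double_sum s th n + 2 * pot s th n x).
Proof.
  intros Hs0 Hadm Hx. rewrite cis_list_app.
  set (th' := fun i => if lt_dec i n then th i else x).
  assert (E : forall i, (i < n)%nat -> th i = th' i).
  { intros i Hi; unfold th'. destruct (lt_dec i n); [reflexivity|lia]. }
  assert (En : th' n = x) by (unfold th'; destruct (lt_dec n n); [lia|reflexivity]).
  rewrite energy_admissible, double_sum_S, En; [|assumption|].
  - f_equal. f_equal.
    + unfold double_sum. apply bigsum_ext; intros i Hi. apply bigsum_ext; intros j Hj.
      now rewrite !E.
    + f_equal. unfold pot. apply bigsum_ext; intros i Hi. now rewrite E.
  - intros k Hk. destruct (Nat.eq_dec k n) as [->|Hkn].
    + rewrite En. apply (adm_ext s th); assumption.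
    + rewrite <- E by lia. apply (adm_ext s th); [intros; apply E; lia|apply Hadm; lia].
Qed.

(** An admissible competitor of finite energy exists at each step, namely the
    minimizer found in the coset, so the greedy point is admissible too. *)
Lemma greedy_angles s a : -1 <= s -> s <> 0 -> greedy_energy_sequence s a ->
  forall N, greedy_upto s (fun n => angle (a n)) N.
Proof.
  intros Hs Hs0 [Hc Hmin]. set (th := fun n => angle (a n)).
  assert (Ea : forall n, a n = cis (th n)) by (intros; symmetry; now apply cis_angle).
  assert (Pre : forall N, prefix a N = cis_list th N).
  { intros N. unfold prefix, cis_list. apply map_ext. exact Ea. }
  induction N as [|N IH]; [intros k Hk; lia|].
  intros k Hk. destruct (Nat.eq_dec k N) as [->|HkN]; [|apply IH; lia].
  assert (Hadm := greedy_upto_admissible s th N IH).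
  destruct (greedy_blocks s Hs Hs0 N) as [_ HT].
  destruct (HT th N) as [l [[Za _] _]];
    [split; [lia|apply Nat.pow_gt_lin_r; lia]|exact IH|].
  set (z := th O + 2 * PI * IZR l / INR (2 ^ N)) in *.
  assert (Cmp : forall x, adm s th N x -> adm s th N (th N) ->
            sg s * pot s th N (th N) <= sg s * pot s th N x).
  { intros x Hx HN.
    destruct (Hmin N ltac:(lia) (cis x) (on_circle_cis x)) as [M1 M2].
    rewrite Pre, Ea, !energy_extend in M1, M2 by assumption. simpl in M1, M2.
    unfold sg. destruct (Rlt_dec s 0) as [Hneg|Hnn].
    - specialize (M2 Hneg). lra.
    - specialize (M1 ltac:(lra)). lra. }
  assert (HN : adm s th N (th N)).
  { destruct (classic (adm s th N (th N))) as [|Hna]; [assumption|exfalso].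
    assert (Hpos : 0 < s).
    { destruct (Rlt_le_dec 0 s); [assumption|]. exfalso; apply Hna. intros Hp; lra. }
    destruct (Hmin N ltac:(lia) (cis z) (on_circle_cis z)) as [M1 _].
    specialize (M1 ltac:(lra)). rewrite Pre, (energy_extend s th N z) in M1 by assumption.
    assert (EN : cis_list th N ++ [a N] = cis_list th (S N)).
    { unfold cis_list. rewrite seq_S, map_app, Ea. reflexivity. }
    rewrite EN, energy_not_admissible in M1 by assumption. exact M1. }
  split; [exact HN|]. intros x Hx. now apply Cmp.
Qed.

Lemma energy_greedy s a N : -1 <= s -> s <> 0 -> greedy_energy_sequence s a ->
  energy s (prefix a N) = Finite (greedy_energy s N).
Proof.
  intros Hs Hs0 Ha. assert (HG := greedy_angles s a Hs Hs0 Ha).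
  set (th := fun n => angle (a n)) in *. destruct Ha as [Hc _].
  replace (prefix a N) with (cis_list th N).
  2:{ unfold prefix, cis_list. apply map_ext. intros n. now apply cis_angle. }
  rewrite energy_admissible by (try apply greedy_upto_admissible; auto).
  f_equal. unfold greedy_energy. rewrite <- bigsum_scal.
  induction N as [|N IH]; [reflexivity|].
  rewrite double_sum_S, IH. cbn [bigsum]. do 2 f_equal.
  destruct N as [|N]; [reflexivity|].
  apply greedy_value; try assumption. lia.
Qed.

(** * Assembling the binary blocks *)

Definition pow2_sum (l : list nat) : R := Rsum (map (fun n => 2 ^ n) l).

(** The energy of a configuration made of blocks of sizes [2^n], [n] in [l],
    when a point of a block of size [2^n] feels the potential [L n] of the rest
    of its own block, and every later point the potential [L (n+1) - L n] of
    that block. *)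
Fixpoint block_energy (L : nat -> R) (l : list nat) : R :=
  match l with
  | [] => 0
  | n :: l => 2 ^ n * L n + 2 * pow2_sum l * (L (S n) - L n) + block_energy L l
  end.

Lemma block_energy_plus L1 L2 l :
  block_energy (fun n => L1 n + L2 n) l = block_energy L1 l + block_energy L2 l.
Proof. induction l as [|n l IH]; simpl; [ring|]. rewrite IH; ring. Qed.

Lemma block_energy_scal c L l :
  block_energy (fun n => c * L n) l = c * block_energy L l.
Proof. induction l as [|n l IH]; simpl; [ring|]. rewrite IH; ring. Qed.

Lemma block_energy_ext L1 L2 l : (forall n, L1 n = L2 n) ->
  block_energy L1 l = block_energy L2 l.
Proof. intros E; induction l as [|n l IH]; simpl; [reflexivity|]. now rewrite IH, !E. Qed.

Lemma block_energy_sum (L : nat -> nat -> R) p l :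
  block_energy (fun n => bigsum (fun j => L j n) p) l =
  bigsum (fun j => block_energy (L j) l) p.
Proof.
  induction p as [|p IH]; cbn [bigsum].
  - induction l as [|n l IHl]; simpl; [ring|]. rewrite IHl; ring.
  - rewrite (block_energy_plus (fun n => bigsum (fun j => L j n) p)), IH. reflexivity.
Qed.

Lemma block_energy_square l : block_energy (fun n => 2 ^ n) l = pow2_sum l ^ 2.
Proof.
  unfold pow2_sum, Rsum. induction l as [|n l IH]; simpl; [ring|].
  rewrite IH. unfold pow2_sum, Rsum. ring.
Qed.

(** Induction over the binary expansion: peel off the highest bit. *)
Lemma binary_ind (P : nat -> Prop) :
  P O -> (forall n j, (j < 2 ^ n)%nat -> P j -> P (2 ^ n + j)%nat) -> forall N, P N.
Proof.
  intros P0 PS N. induction N as [N IH] using (well_founded_induction lt_wf).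
  destruct N as [|N]; [exact P0|].
  destruct (Nat.log2_spec (S N) ltac:(lia)) as [L1 L2].
  set (n := Nat.log2 (S N)) in *. simpl in L2.
  pose proof (nat_pow2_pos n).
  replace (S N) with (2 ^ n + (S N - 2 ^ n))%nat by lia.
  apply PS; [lia|]. apply IH; lia.
Qed.

Lemma pow2_sum_binary N : pow2_sum (binary_exponents N) = INR N.
Proof.
  induction N as [|n j Hj IH] using binary_ind; [reflexivity|].
  rewrite binary_exponents_add, plus_INR, INR_pow2, <- IH by assumption. reflexivity.
Qed.

(** A block of [2^n] points has the energy of the roots of unity, and each of the
    later points lies midway with respect to it. *)
Lemma greedy_energy_blocks s N :
  greedy_energy s N =
  block_energy (fun n => root_sum s (2 ^ n)) (binary_exponents N).
Proof.
  induction N as [|n j Hj IH] using binary_ind.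
  - unfold greedy_energy; simpl; ring.
  - rewrite binary_exponents_add, greedy_energy_add by lia. simpl block_energy.
    rewrite <- IH, greedy_energy_pow2, mid_pot_root_sum, pow2_sum_binary. simpl. ring.
Qed.

Lemma Rsum_nth l : Rsum (map (fun i => nth i l 0) (seq 0 (length l))) = Rsum l.
Proof.
  induction l as [|x l IH]; [reflexivity|]. simpl length. cbn [seq map].
  rewrite <- seq_shift, map_map. unfold Rsum in *. simpl. f_equal. exact IH.
Qed.

Lemma H_cons x l t :
  H (x :: l) t = Rpower x (t + 1) + 2 * (Rpower 2 t - 1) * (Rpower x t * Rsum l) + H l t.
Proof.
  unfold H. cbv zeta. simpl length. rewrite Nat.sub_succ, Nat.sub_0_r.
  set (p := length l).
  assert (E1 : Rsum (map (fun k => Rpower (nth k (x :: l) 0) (t + 1)) (seq 0 (S p))) =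
              Rpower x (t + 1) +
              Rsum (map (fun k => Rpower (nth k l 0) (t + 1)) (seq 0 p))).
  { rewrite <- cons_seq, map_cons, <- seq_shift, map_map. reflexivity. }
  assert (E2 : Rsum (map (fun k => Rpower (nth k (x :: l) 0) t *
                Rsum (map (fun i => nth i (x :: l) 0) (seq (k + 1) (p - k)))) (seq 0 p)) =
              Rpower x t * Rsum l +
              Rsum (map (fun k => Rpower (nth k l 0) t *
                Rsum (map (fun i => nth i l 0) (seq (k + 1) (p - 1 - k)))) (seq 0 (p - 1)))).
  { destruct l as [|y l']; [unfold p; simpl; unfold Rsum; simpl; ring|].
    set (l := y :: l') in *.
    assert (Hp : p = S (p - 1)) by (unfold p, l; simpl; lia).
    replace (seq 0 p) with (seq 0 (S (p - 1))) by (f_equal; lia).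
    rewrite <- cons_seq, map_cons, <- seq_shift, map_map.
    change (Rsum (?a :: ?m)) with (a + Rsum m). f_equal.
    - change (nth 0 (x :: l) 0) with x. f_equal. rewrite Nat.sub_0_r.
      change (0 + 1)%nat with 1%nat.
      rewrite <- seq_shift, map_map. apply Rsum_nth.
    - f_equal. apply map_ext. intros k. change (nth (S k) (x :: l) 0) with (nth k l 0).
      f_equal. replace (S k + 1)%nat with (S (k + 1)) by lia.
      rewrite <- seq_shift, map_map. replace (p - S k)%nat with (p - 1 - k)%nat by lia.
      reflexivity. }
  rewrite E1, E2. ring.
Qed.

Lemma Rsum_map_scal {T} (f : T -> R) c l :
  Rsum (map (fun x => f x / c) l) = Rsum (map f l) / c.
Proof.
  unfold Rsum. induction l as [|x l IH]; simpl; [unfold Rdiv; ring|].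
  rewrite IH. unfold Rdiv; ring.
Qed.

(** [H] is the block energy of the power [M^t], normalized by [X^(t+1)]. *)
Lemma block_energy_power X t l : 0 < X ->
  block_energy (fun n => Rpower (2 ^ n) t) l =
  Rpower X (t + 1) * H (map (fun n => 2 ^ n / X) l) t.
Proof.
  intros HX. induction l as [|n l IH].
  - unfold H; simpl. unfold Rsum; simpl. ring.
  - rewrite map_cons, H_cons. cbn [block_energy]. rewrite IH, Rsum_map_scal.
    change (Rsum (map (pow 2) l)) with (pow2_sum l). set (B := H _ t).
    assert (Hn : 0 < 2 ^ n) by (apply pow_lt; lra).
    assert (Hd : 0 < 2 ^ n / X) by (apply Rdiv_lt_0_compat; lra).
    assert (E1 : forall q, Rpower X q * Rpower (2 ^ n / X) q = Rpower (2 ^ n) q).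
    { intros q. rewrite <- Rpower_mult_base by assumption. f_equal. field. lra. }
    assert (E2 : 2 ^ n * Rpower (2 ^ n) t = Rpower (2 ^ n) (t + 1)).
    { rewrite Rpower_plus, Rpower_1 by assumption. ring. }
    assert (E3 : Rpower (2 ^ S n) t = Rpower 2 t * Rpower (2 ^ n) t).
    { simpl pow. apply Rpower_mult_base; lra. }
    assert (E4 : Rpower X (t + 1) = Rpower X t * X).
    { rewrite Rpower_plus, Rpower_1 by assumption. reflexivity. }
    rewrite E2, E3, <- (E1 (t + 1)), <- (E1 t), E4. field. lra.
Qed.

(** Each later block is shorter than the current one, so the contribution of a
    block is at most its size times the potentials. *)
Lemma block_energy_bound e K N : (N < 2 ^ K)%nat ->
  Rabs (block_energy e (binary_exponents N)) <=
  bigsum (fun n => 3 * (2 ^ n * Rabs (e n)) + 2 ^ S n * Rabs (e (S n))) K.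
Proof.
  assert (Pos : forall n, 0 <= 3 * (2 ^ n * Rabs (e n)) + 2 ^ S n * Rabs (e (S n))).
  { intros n. assert (0 < 2 ^ n) by (apply pow_lt; lra).
    assert (0 < 2 ^ S n) by (apply pow_lt; lra).
    pose proof (Rabs_pos (e n)). pose proof (Rabs_pos (e (S n))). nra. }
  revert K. induction N as [|n j Hj IH] using binary_ind; intros K HK.
  - simpl. rewrite Rabs_R0. now apply bigsum_nonneg.
  - assert (HnK : (n < K)%nat).
    { apply (Nat.pow_lt_mono_r_iff 2); lia. }
    rewrite binary_exponents_add by assumption. cbn [block_energy].
    rewrite pow2_sum_binary.
    specialize (IH n Hj).
    assert (Hj' : INR j <= 2 ^ n) by (rewrite <- INR_pow2; apply le_INR; lia).
    pose proof (pos_INR j). assert (0 < 2 ^ n) by (apply pow_lt; lra).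
    replace K with (S n + (K - S n))%nat by lia. rewrite bigsum_add. cbn [bigsum].
    assert (T := bigsum_nonneg (fun i => 3 * (2 ^ (S n + i) * Rabs (e (S n + i)%nat)) +
               2 ^ S (S n + i) * Rabs (e (S (S n + i)))) (K - S n) (fun i _ => Pos (S n + i)%nat)).
    eapply Rle_trans; [apply Rabs_triang|].
    assert (Q : Rabs (2 ^ n * e n + 2 * INR j * (e (S n) - e n)) <=
              3 * (2 ^ n * Rabs (e n)) + 2 ^ S n * Rabs (e (S n))).
    { eapply Rle_trans; [apply Rabs_triang|]. rewrite !Rabs_mult.
      rewrite (Rabs_pos_eq (2 ^ n)), (Rabs_pos_eq 2), (Rabs_pos_eq (INR j)) by lra.
      assert (Rabs (e (S n) - e n) <= Rabs (e (S n)) + Rabs (e n)).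
      { eapply Rle_trans; [apply Rabs_triang|]. rewrite Rabs_Ropp. lra. }
      pose proof (Rabs_pos (e (S n) - e n)).
      assert (2 * INR j * Rabs (e (S n) - e n) <=
              2 * 2 ^ n * (Rabs (e (S n)) + Rabs (e n))).
      { apply Rmult_le_compat; lra. }
      simpl pow. lra. }
    lra.
Qed.

Lemma bigsum_geom_bound r n : 0 <= r < 1 -> bigsum (fun i => r ^ i) n <= / (1 - r).
Proof.
  intros Hr.
  assert (E : bigsum (fun i => r ^ i) n = (1 - r ^ n) / (1 - r)).
  { induction n as [|n IH]; simpl; [field; lra|]. rewrite IH. field. lra. }
  rewrite E. unfold Rdiv. assert (0 <= r ^ n) by (apply pow_le; lra).
  assert (0 < / (1 - r)) by (apply Rinv_0_lt_compat; lra). nra.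
Qed.

(** An error [O(M^(-1-d))] per point is summable over dyadic sizes [M]. *)
Lemma block_energy_error_bound e W d : 0 < d ->
  (forall n, Rabs (e (S n)) <= W * Rpower (2 ^ n) (- (1 + d))) ->
  exists B, forall N, Rabs (block_energy e (binary_exponents N)) <= B.
Proof.
  intros Hd He.
  set (r := Rpower 2 (- d)).
  assert (Hr : 0 <= r < 1).
  { unfold r. split; [apply Rlt_le, Rpower_pos|].
    rewrite <- (Rpower_O 2) by lra. apply Rpower_lt; lra. }
  assert (HW : 0 <= W).
  { specialize (He O). simpl in He. rewrite Rpower_base1, Rmult_1_r in He.
    eapply Rle_trans; [apply Rabs_pos|exact He]. }
  pose (x := fun n => 2 ^ n * Rabs (e n)).
  assert (Hx : forall n, x (S n) <= 2 * W * r ^ n).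
  { intros n. unfold x. assert (0 < 2 ^ n) by (apply pow_lt; lra).
    replace (2 * W * r ^ n) with (2 ^ S n * (W * Rpower (2 ^ n) (- (1 + d)))).
    - apply Rmult_le_compat_l; [apply pow_le; lra|apply He].
    - replace (- (1 + d)) with (- (1) + - d) by ring.
      rewrite Rpower_plus, (Rpower_Ropp _ 1), Rpower_1 by assumption.
      replace (Rpower (2 ^ n) (- d)) with (r ^ n).
      + simpl pow. field. lra.
      + unfold r. rewrite <- Rpower_pow by apply Rpower_pos.
        rewrite <- (Rpower_pow n 2) by lra. rewrite !Rpower_mult. f_equal; ring. }
  assert (SX : forall K, bigsum (fun n => x (S n)) K <= 2 * W * / (1 - r)).
  { intros K. eapply Rle_trans; [apply bigsum_le; intros; apply Hx|].
    rewrite bigsum_scal. apply Rmult_le_compat_l; [lra|]. now apply bigsum_geom_bound. }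
  assert (Hx0 : forall n, 0 <= x n).
  { intros n. apply Rmult_le_pos; [apply pow_le; lra|apply Rabs_pos]. }
  exists (3 * (x O + 2 * W * / (1 - r)) + 2 * W * / (1 - r)). intros N.
  eapply Rle_trans; [apply (block_energy_bound e N N), Nat.pow_gt_lin_r; lia|].
  change (bigsum (fun n => 3 * x n + x (S n)) N <=
          3 * (x O + 2 * W * / (1 - r)) + 2 * W * / (1 - r)).
  rewrite bigsum_plus, bigsum_scal.
  assert (bigsum x N <= x O + 2 * W * / (1 - r)).
  { apply Rle_trans with (bigsum x (S N)).
    - cbn [bigsum]. specialize (Hx0 N). lra.
    - rewrite bigsum_Sl. specialize (SX N). lra. }
  specialize (SX N). lra.
Qed.

(** A linear term in the potential gives a perfect square and a power gives [H]. *)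
Lemma block_energy_root_main s b zeta p N : (0 < N)%nat ->
  block_energy (fun n => root_main s b zeta p (2 ^ n)) (binary_exponents N) =
  mean_potential s b * INR N ^ 2 +
  2 / Rpower (2 * PI) s *
    sum_f_R0 (fun j => b j * Re (zeta (RtoC (s - 2 * INR j))) *
       H (eta N) (s - 2 * INR j) * Rpower (INR N) (s - 2 * INR j + 1)) p.
Proof.
  intros HN. assert (HN0 : 0 < INR N) by (apply lt_0_INR; exact HN).
  unfold root_main.
  rewrite (block_energy_plus (fun n => mean_potential s b * 2 ^ n)),
    (block_energy_scal (mean_potential s b)), block_energy_square, pow2_sum_binary.
  f_equal. rewrite block_energy_scal. f_equal.
  rewrite (block_energy_sum (fun j n => b j * Re (zeta (RtoC (s - 2 * INR j))) *
             Rpower (2 ^ n) (s - 2 * INR j))).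
  rewrite bigsum_sum_f_R0. apply bigsum_ext. intros j _.
  rewrite block_energy_scal, (block_energy_power (INR N)) by assumption.
  unfold eta. ring.
Qed.

Theorem theorem2p3 (s : R) (zeta : C -> C) (beta : nat -> R) (a : nat -> C)
  (Hs : -1 <= s) (Hs0 : s <> 0)
  (Hsodd : forall m : nat, s <> INR (2 * m + 1))
  (Hzeta : is_riemann_zeta zeta)
  (Hbeta : is_sinc_coeffs s beta)
  (Ha : greedy_energy_sequence s a) :
  exists rho : nat -> R,
    (forall N : nat, (2 <= N)%nat ->
       energy s (prefix a N) =
       Finite (v s * INR N ^ 2 +
               2 / Rpower (2 * PI) s *
                 sum_f_R0 (fun j =>
                     beta j * Re (zeta (RtoC (s - 2 * INR j))) *
                     H (eta N) (s - 2 * INR j) *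
                     Rpower (INR N) (s - 2 * INR j + 1))
                   (Z.to_nat (Int_part ((s + 1) / 2))) +
               rho N)) /\
    (exists M : R, forall N : nat, (2 <= N)%nat -> Rabs (rho N) <= M) /\
    ((exists m : nat, (1 <= m)%nat /\ s = INR (2 * m)) ->
       v s = 0 /\ forall N : nat, (2 <= N)%nat -> rho N = 0).
Proof.
  set (p := Z.to_nat (Int_part ((s + 1) / 2))).
  assert (Hp : 2 * INR p <= s + 1 < 2 * INR p + 2).
  { destruct (base_Int_part ((s + 1) / 2)) as [P1 P2].
    assert (0 <= Int_part ((s + 1) / 2))%Z.
    { assert (-1 < Int_part ((s + 1) / 2))%Z by (apply lt_IZR; lra). lia. }
    unfold p. rewrite INR_IZR_INZ, Z2Nat.id by assumption. lra. }
  assert (Hodd : not_odd s).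
  { intros j E. apply (Hsodd j). rewrite plus_INR, mult_INR. simpl INR. lra. }
  assert (Hb := sinc_coeffs_power_series s beta Hbeta).
  assert (Hne : 2 * INR p + 1 <> s) by (specialize (Hodd p); lra).
  (* The first omitted exponent is s - 2(p+1) = -1 - (2p+1-s), and the cut-off at 1
     accounts for the error of Euler-Maclaurin. *)
  set (d := Rmin 1 (2 * INR p + 1 - s)).
  assert (Hd : 0 < d <= 1).
  { split; [|apply Rmin_l]. apply Rmin_pos; [lra|]. lra. }
  assert (Hd2 : d <= 2 * INR p + 1 - s) by apply Rmin_r.
  destruct (root_sum_asymptotic s beta zeta p d Hodd Hb Hzeta Hd) as [W HW].
  { intros j Hj. apply le_INR in Hj. lra. }
  { intros j Hj. apply (le_INR (S p)) in Hj. rewrite S_INR in Hj. lra. }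
  set (err := fun n => root_sum s (2 ^ n) - root_main s beta zeta p (2 ^ n)).
  exists (fun N => block_energy err (binary_exponents N)).
  split; [|split].
  - intros N HN. rewrite energy_greedy by assumption. f_equal.
    rewrite <- (mean_potential_v s beta) by assumption.
    rewrite <- block_energy_root_main by lia.
    rewrite greedy_energy_blocks, <- block_energy_plus.
    apply block_energy_ext. intros n. unfold err. ring.
  - destruct (block_energy_error_bound err W d (proj1 Hd)) as [B HB].
    + intros n. specialize (HW (2 ^ n)%nat (nat_pow2_pos n)).
      change (2 * 2 ^ n)%nat with (2 ^ S n)%nat in HW.
      rewrite !INR_pow2 in HW. exact HW.
    + exists B. intros N _. apply HB.
  - intros [m [Hm Em]]. split; [rewrite Em; now apply v_even|]. intros N _.
    assert (Epm : p = m).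
    { assert (E2 : s = 2 * INR m) by (rewrite Em, mult_INR; simpl INR; ring).
      assert (p < m + 1)%nat by (apply INR_lt; rewrite plus_INR; simpl INR; lra).
      assert (m < p + 1)%nat by (apply INR_lt; rewrite plus_INR; simpl INR; lra).
      lia. }
    rewrite (block_energy_ext err (fun _ => 0 * 0)), block_energy_scal; [ring|].
    intros n. unfold err. rewrite Epm. subst s.
    rewrite (root_sum_even m beta zeta n Hm Hb Hzeta). ring.
Qed.
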